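(* Let $\boldsymbol{P}$ be an M/G/1-type stochastic matrix with blocks $\{\boldsymbol{A}_k\}_{k\ge -1}$, $\{\boldsymbol{B}_k\}_{k\ge -1}$, let $\boldsymbol{\pi}=(\boldsymbol{\pi}_0,\boldsymbol{\pi}_1,\dots)$ be its stationary distribution vector, and let $\boldsymbol{\pi}^{(N)}=(\boldsymbol{\pi}^{(N)}_0,\boldsymbol{\pi}^{(N)}_1,\dots)$, $N\in\mathbb{N}$, be its level-increment truncation approximation (all as defined in the context). Suppose that the following hold. (1) (i) $\boldsymbol{P}$ is irreducible; (ii) $\boldsymbol{A}:=\sum_{k=-1}^\infty \boldsymbol{A}_k$ is an irreducible stochastic matrix; (iii) $\overline{\boldsymbol{m}}_B:=\sum_{k=1}^\infty k\boldsymbol{B}_k\boldsymbol{e}$ is finite; (iv) $\sigma:=\boldsymbol{\varpi}\,\overline{\boldsymbol{m}}_A<0$, where $\overline{\boldsymbol{m}}_A=\sum_{k=-1}^\infty k\boldsymbol{A}_k\boldsymbol{e}$ and $\boldsymbol{\varpi}$ is the unique stationary distribution (row) vector of $\boldsymbol{A}$. (2) The single communication class of the matrix $\boldsymbol{G}$ is aperiodic. (3) $r:=\min(r_A,r_B)>1$, where $r_A=\sup\{z\ge 1:\sum_{k=1}^\infty z^k\boldsymbol{A}_k<\infty\}$ and $r_B=\sup\{z\ge 1:\sum_{k=1}^\infty z^k\boldsymbol{B}_k<\infty\}$. (4) There exists a nonnegative function $f$ on $\mathbb{Z}_+$ such that $$\lim_{N\to\infty}\frac{\overline{\overline{\boldsymbol{A}}}_N\boldsymbol{e}}{r^{-N}f(N)}=\boldsymbol{c}_A,\qquad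 \lim_{N\to\infty}\frac{\overline{\overline{\boldsymbol{B}}}_N\boldsymbol{e}}{r^{-N}f(N)}=\boldsymbol{c}_B,\qquad \lim_{N\to\infty}\frac{f(N)}{f(N-1)}=1,$$ where $\boldsymbol{c}_A\ge\boldsymbol{0}$ and $\boldsymbol{c}_B\ge\boldsymbol{0}$ are finite column vectors of dimensions $M_1$ and $M_0$, respectively, at least one of which is non-zero (in particular $r<\infty$ and $f(N)>0$ for all sufficiently large $N$, so that the quotients make sense). Let $D_I$ be the integrated-tail distribution of the stationary nonnegative level-increment distribution $D$ (defined in the context) and let $\overline{D}_I(k)=1-D_I(k)$ for $k\in\mathbb{Z}_+$. Then, for every $k\in\mathbb{Z}_+$, $$\lim_{N\to\infty}\frac{\boldsymbol{\pi}^{(N)}_k-\boldsymbol{\pi}_k}{\overline{D}_I(N)}=\frac{r(\boldsymbol{\pi}_0\overline{\boldsymbol{m}}_B+\overline{\boldsymbol{\pi}}_0\overline{\boldsymbol{m}}_A^+)}{-\sigma}\,\boldsymbol{\pi}_k>\boldsymbol{0},$$ $$\lim_{N\to\infty}\frac{1}{\overline{D}_I(N)}\left\|\frac{\boldsymbol{\pi}^{(N)}_k-\boldsymbol{\pi}_k}{\boldsymbol{\pi}_k\boldsymbol{e}}\right\|=\frac{r(\boldsymbol{\pi}_0\overline{\boldsymbol{m}}_B+\overline{\boldsymbol{\pi}}_0\overline{\boldsymbol{m}}_A^+)}{-\sigma}>0,$$ where $\overline{\boldsymbol{\pi}}_0=\sum_{\ell=1}^\infty\boldsymbol{\pi}_\ell$,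 $\overline{\boldsymbol{m}}_A^+=\sum_{k=1}^\infty k\boldsymbol{A}_k\boldsymbol{e}=\overline{\boldsymbol{m}}_A+\boldsymbol{A}_{-1}\boldsymbol{e}$, and $\|\boldsymbol{x}\|=\sum_i|x_i|$ for any vector $\boldsymbol{x}=(x_i)$.
   Context: Notation: $\mathbb{N}=\{1,2,\dots\}$, $\mathbb{Z}_+=\{0,1,2,\dots\}$; $\boldsymbol{e}$ is the column vector of ones of appropriate dimension; $\boldsymbol{O}$ is the zero matrix; vector inequalities and limits are entrywise; for a nonnegative matrix $\boldsymbol{X}$, $\boldsymbol{X}<\infty$ means every entry is finite. M/G/1-type matrix: Let $M_0,M_1\in\mathbb{N}$, $\mathbb{L}_0=\{0\}\times\{1,\dots,M_0\}$, $\mathbb{L}_k=\{k\}\times\{1,\dots,M_1\}$ for $k\in\mathbb{N}$, and $\mathbb{S}=\bigcup_{k\ge0}\mathbb{L}_k$. The matrix $\boldsymbol{P}$ is a stochastic matrix on $\mathbb{S}$ with block form (blocks indexed by levels $\mathbb{L}_0,\mathbb{L}_1,\dots$) $$\boldsymbol{P}=\begin{pmatrix}\boldsymbol{B}_0&\boldsymbol{B}_1&\boldsymbol{B}_2&\boldsymbol{B}_3&\cdots\\ \boldsymbol{B}_{-1}&\boldsymbol{A}_0&\boldsymbol{A}_1&\boldsymbol{A}_2&\cdots\\ \boldsymbol{O}&\boldsymbol{A}_{-1}&\boldsymbol{A}_0&\boldsymbol{A}_1&\cdots\\ \boldsymbol{O}&\boldsymbol{O}&\boldsymbol{A}_{-1}&\boldsymbol{A}_0&\cdots\\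 \vdots&\vdots&\vdots&\vdots&\ddots\end{pmatrix},$$ where the $\boldsymbol{A}_k$ are $M_1\times M_1$, $\boldsymbol{B}_0$ is $M_0\times M_0$, $\boldsymbol{B}_{-1}$ is $M_1\times M_0$, and $\boldsymbol{B}_k$ ($k\ge1$) is $M_0\times M_1$, all nonnegative. Under hypothesis (1), $\boldsymbol{P}$ is irreducible and positive recurrent; its unique stationary distribution (row) vector $\boldsymbol{\pi}=(\pi_{k,i})_{(k,i)\in\mathbb{S}}$ is partitioned by levels as $\boldsymbol{\pi}=(\boldsymbol{\pi}_0,\boldsymbol{\pi}_1,\boldsymbol{\pi}_2,\dots)$. Tails: for $k\in\mathbb{Z}_+$, $\overline{\boldsymbol{A}}_k=\sum_{\ell=k+1}^\infty\boldsymbol{A}_\ell$, $\overline{\boldsymbol{B}}_k=\sum_{\ell=k+1}^\infty\boldsymbol{B}_\ell$, $\overline{\overline{\boldsymbol{A}}}_k=\sum_{\ell=k+1}^\infty\overline{\boldsymbol{A}}_\ell$, $\overline{\overline{\boldsymbol{B}}}_k=\sum_{\ell=k+1}^\infty\overline{\boldsymbol{B}}_\ell$. The matrix $\boldsymbol{G}$ is the minimal nonnegative solution of $\boldsymbol{G}=\sum_{m=-1}^\infty\boldsymbol{A}_m\boldsymbol{G}^{m+1}$. Under hypothesis (1), $\boldsymbol{G}$ is a stochastic matrix with a single communication class (i.e. exactly one closed communicating class, possibly together with transient states). Level-increment (LI) truncation approximation: for $N\in\mathbb{N}$, let $\boldsymbol{A}^{(N)}_k=\boldsymbol{A}_k$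 for $-1\le k\le N-1$, $\boldsymbol{A}^{(N)}_N=\overline{\boldsymbol{A}}_{N-1}=\sum_{\ell=N}^\infty\boldsymbol{A}_\ell$, $\boldsymbol{A}^{(N)}_k=\boldsymbol{O}$ for $k\ge N+1$, and similarly $\boldsymbol{B}^{(N)}_k=\boldsymbol{B}_k$ for $-1\le k\le N-1$, $\boldsymbol{B}^{(N)}_N=\overline{\boldsymbol{B}}_{N-1}=\sum_{\ell=N}^\infty\boldsymbol{B}_\ell$, $\boldsymbol{B}^{(N)}_k=\boldsymbol{O}$ for $k\ge N+1$. Let $\boldsymbol{P}^{(N)}$ be the stochastic matrix obtained from $\boldsymbol{P}$ by replacing each $\boldsymbol{A}_k,\boldsymbol{B}_k$ with $\boldsymbol{A}^{(N)}_k,\boldsymbol{B}^{(N)}_k$. Under hypothesis (1), $\boldsymbol{P}^{(N)}$ has a unique stationary distribution vector, denoted $\boldsymbol{\pi}^{(N)}=(\boldsymbol{\pi}^{(N)}_0,\boldsymbol{\pi}^{(N)}_1,\dots)$ (partitioned by levels). Stationary nonnegative level-increment (SNL) distribution: let $\{(X_n,J_n);n\in\mathbb{Z}_+\}$ be a Markov chain on $\mathbb{S}$ with transition probability matrix $\boldsymbol{P}$ and let $\Delta_+=\max(X_1-X_0,0)$. For $k\in\mathbb{Z}_+$, $$D(k)=\sum_{(\ell,i)\in\mathbb{S}}\pi_{\ell,i}\,\mathbb{P}(\Delta_+\le k\mid (X_0,J_0)=(\ell,i))=\sum_{n=0}^k\boldsymbol{\pi}_0\boldsymbol{B}_n\boldsymbol{e}+\sum_{n=-1}^k\overline{\boldsymbol{\pi}}_0\boldsymbol{A}_n\boldsymbol{e},$$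 with $\overline{\boldsymbol{\pi}}_0=\sum_{\ell=1}^\infty\boldsymbol{\pi}_\ell$. Its integrated-tail (equilibrium) distribution is $$D_I(k)=\frac{\sum_{\ell=0}^k(1-D(\ell))}{\sum_{\ell=0}^\infty(1-D(\ell))},\qquad k\in\mathbb{Z}_+,$$ whose denominator is the mean of $D$. *)

(* Defs.v *)
From HB Require Import structures.
From mathcomp Require Import all_boot all_order all_algebra.
From mathcomp Require Import all_classical all_reals all_analysis.

Set Implicit Arguments.
Unset Strict Implicit.
Unset Printing Implicit Defensive.

Import Order.TTheory GRing.Theory Num.Theory.
Import numFieldNormedType.Exports.
Local Open Scope classical_set_scope.
Local Open Scope ring_scope.

(** * Entrywise sums of sequences of matrices *)

Definition ones (R : realType) (n : nat) : 'cV[R]_n := const_mx 1.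

Definition l1norm (R : realType) (n : nat) (x : 'rV[R]_n) : R :=
  \sum_i `|x 0 i|.

(* A limit in [R]: the value is meaningful only when the series converges. *)
Definition rsum (R : realType) (k0 : nat) (u : nat -> R) : R :=
  limn (fun K => \sum_(k0 <= k < K) u k).

Definition mx_sum (R : realType) (m n k0 : nat) (X : nat -> 'M[R]_(m, n)) :
    'M[R]_(m, n) :=
  \matrix_(i, j) rsum k0 (fun k => X k i j).

Definition mx_summable (R : realType) (m n k0 : nat)
    (X : nat -> 'M[R]_(m, n)) : Prop :=
  forall i j, cvgn (fun K => \sum_(k0 <= k < K) X k i j).

Definition tail (R : realType) (m n : nat) (X : nat -> 'M[R]_(m, n)) :
    nat -> 'M[R]_(m, n) :=
  fun k => mx_sum k.+1 X.

(** * Finite stochastic matrices *)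

Definition fstochastic (R : realType) (n : nat) (A : 'M[R]_n) : Prop :=
  (forall i j, 0 <= A i j) /\ (forall i, \sum_j A i j = 1).

Definition leads_to (R : realType) (n : nat) (A : 'M[R]_n) (i j : 'I_n) : Prop :=
  exists p : nat, 0 < (A ^+ p) i j.

Definition firreducible (R : realType) (n : nat) (A : 'M[R]_n) : Prop :=
  forall i j, leads_to A i j.

Definition fstationary (R : realType) (n : nat) (A : 'M[R]_n) (v : 'rV[R]_n) :
    Prop :=
  [/\ forall i, 0 <= v 0 i, \sum_i v 0 i = 1 & v *m A = v].

Definition closed_class (R : realType) (n : nat) (A : 'M[R]_n)
    (C : {set 'I_n}) : Prop :=
  C != finset.set0 /\
  forall i, i \in C -> forall j, j \in C <-> leads_to A i j.

(* [d] is the gcd of the return times [p >= 1] of state [i]. *)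
Definition has_period (R : realType) (n : nat) (A : 'M[R]_n) (i : 'I_n)
    (d : nat) : Prop :=
  (forall p, (0 < p)%N -> 0 < (A ^+ p) i i -> (d %| p)%N) /\
  (forall c, (forall p, (0 < p)%N -> 0 < (A ^+ p) i i -> (c %| p)%N) ->
     (c %| d)%N).

Definition class_aperiodic (R : realType) (n : nat) (A : 'M[R]_n)
    (C : {set 'I_n}) : Prop :=
  forall i, i \in C -> has_period A i 1.

(** * Infinite matrices partitioned by levels *)

(* Number of phases of level [k]; the state space is {(k, i) | i : 'I_(lvl k)}. *)
Definition lvl (M0 M1 k : nat) : nat := if k is 0 then M0 else M1.

Definition bvec (R : realType) (M0 M1 : nat) : Type :=
  forall k, 'rV[R]_(lvl M0 M1 k).

Definition bmx (R : realType) (M0 M1 : nat) : Type :=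
  forall k l, 'M[R]_(lvl M0 M1 k, lvl M0 M1 l).

Definition stochastic (R : realType) (M0 M1 : nat) (P : bmx R M0 M1) : Prop :=
  (forall k l i j, 0 <= P k l i j) /\
  (forall k i, (fun L => \sum_(0 <= l < L) \sum_j P k l i j) @ \oo --> (1 : R)).

Fixpoint bpow (R : realType) (M0 M1 : nat) (P : bmx R M0 M1) (n : nat) :
    bmx R M0 M1 :=
  match n with
  | 0 => fun k l => \matrix_(i, j) ((k == l) && (i == j :> nat))%:R
  | n'.+1 => fun k l => mx_sum 0 (fun m => P k m *m bpow P n' m l)
  end.

Definition irreducible (R : realType) (M0 M1 : nat) (P : bmx R M0 M1) : Prop :=
  forall k l i j, exists n : nat, 0 < bpow P n k l i j.

Definition stationary (R : realType) (M0 M1 : nat) (P : bmx R M0 M1)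
    (v : bvec R M0 M1) : Prop :=
  [/\ forall k i, 0 <= v k 0 i,
      (fun K => \sum_(0 <= k < K) \sum_i v k 0 i) @ \oo --> (1 : R) &
      forall l j,
        (fun K => \sum_(0 <= k < K) (v k *m P k l) 0 j) @ \oo --> v l 0 j].

(** * M/G/1-type matrices *)

(* [blkAm] and [blkBm] are the blocks of index -1. [blkA k] is A_k for k >= 0 and [blkB k]
   is B_k for k >= 1; the value [blkB 0] is never used, since B_0 has another
   format and is the separate field [blkB0]. *)
Record mg1 (R : realType) (M0 M1 : nat) := MG1 {
  blkAm : 'M[R]_M1;
  blkA : nat -> 'M[R]_M1;
  blkBm : 'M[R]_(M1, M0);
  blkB0 : 'M[R]_M0;
  blkB : nat -> 'M[R]_(M0, M1) }.

Definition mg1_matrix (R : realType) (M0 M1 : nat) (Q : mg1 R M0 M1) :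
    bmx R M0 M1 :=
  fun k l =>
    match k, l return 'M[R]_(lvl M0 M1 k, lvl M0 M1 l) with
    | 0, 0 => blkB0 Q
    | 0, l'.+1 => blkB Q l'.+1
    | 1, 0 => blkBm Q
    | _.+2, 0 => 0
    | k'.+1, l'.+1 =>
        if (k' <= l')%N then blkA Q (l' - k')
        else if k' == l'.+1 then blkAm Q else 0
    end.

(* Meant for N >= 1. *)
Definition LI_trunc (R : realType) (M0 M1 : nat) (Q : mg1 R M0 M1) (N : nat) :
    mg1 R M0 M1 :=
  {| blkAm := blkAm Q;
     blkA := fun k => if (k < N)%N then blkA Q k
                   else if k == N then tail (blkA Q) N.-1 else 0;
     blkBm := blkBm Q;
     blkB0 := blkB0 Q;
     blkB := fun k => if (k < N)%N then blkB Q k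
                   else if k == N then tail (blkB Q) N.-1 else 0 |}.

Definition Asum (R : realType) (M0 M1 : nat) (Q : mg1 R M0 M1) : 'M[R]_M1 :=
  blkAm Q + mx_sum 0 (blkA Q).

Definition mB (R : realType) (M0 M1 : nat) (Q : mg1 R M0 M1) : 'cV[R]_M0 :=
  mx_sum 1 (fun k => k%:R *: (blkB Q k *m ones R M1)).

Definition mAplus (R : realType) (M0 M1 : nat) (Q : mg1 R M0 M1) : 'cV[R]_M1 :=
  mx_sum 1 (fun k => k%:R *: (blkA Q k *m ones R M1)).

(* sum_{k >= -1} k A_k e: the term k = -1 is - A_{-1} e, the term k = 0 is 0. *)
Definition mA (R : realType) (M0 M1 : nat) (Q : mg1 R M0 M1) : 'cV[R]_M1 :=
  - (blkAm Q *m ones R M1) + mAplus Q.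

Definition drift (R : realType) (M0 M1 : nat) (Q : mg1 R M0 M1)
    (varpi : 'rV[R]_M1) : R :=
  (varpi *m mA Q) 0 0.

Definition G_solution (R : realType) (M0 M1 : nat) (Q : mg1 R M0 M1)
    (X : 'M[R]_M1) : Prop :=
  (forall i j, 0 <= X i j) /\
  (forall i j,
     (fun K => (blkAm Q + \sum_(0 <= m < K) blkA Q m *m X ^+ m.+1) i j) @ \oo
       --> X i j).

Definition is_G (R : realType) (M0 M1 : nat) (Q : mg1 R M0 M1)
    (G : 'M[R]_M1) : Prop :=
  G_solution Q G /\
  forall X, G_solution Q X -> forall i j, G i j <= X i j.

Definition gf_radius (R : realType) (m n : nat) (X : nat -> 'M[R]_(m, n)) : \bar R :=
  ereal_sup [set z%:E | z in
    [set z : R | 1 <= z /\ mx_summable 1 (fun k => z ^+ k *: X k)]].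

(** * The stationary nonnegative level-increment distribution *)

Definition pibar0 (R : realType) (M0 M1 : nat) (pi : bvec R M0 M1) :
    'rV[R]_M1 :=
  mx_sum 0 (fun l => pi l.+1).

(* Starting from level l, the event max(X_1 - X_0, 0) <= k is X_1 <= l + k. *)
Definition SNL (R : realType) (M0 M1 : nat) (P : bmx R M0 M1)
    (pi : bvec R M0 M1) (k : nat) : R :=
  rsum 0 (fun l =>
    \sum_i pi l 0 i * (\sum_(0 <= m < (l + k).+1) \sum_j P l m i j)).

Definition integrated_tail (R : realType) (D : nat -> R) (k : nat) : R :=
  (\sum_(0 <= l < k.+1) (1 - D l)) / rsum 0 (fun l => 1 - D l).

(* Main.v *)
Require Import Defs.
From HB Require Import structures.
From mathcomp Require Import all_boot all_order all_algebra.
From mathcomp Require Import all_classical all_reals all_analysis.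
From mathcomp Require Import ring lra zify.

Set Implicit Arguments.
Unset Strict Implicit.
Unset Printing Implicit Defensive.

Import Order.TTheory GRing.Theory Num.Theory.
Import numFieldNormedType.Exports.
Local Open Scope classical_set_scope.
Local Open Scope ring_scope.

(** Fix a state [o] and let [P] be the transition matrix. The idea is to test the
    stationary vectors of [P] and of its truncation [P_N] against a solution [h] of
    Poisson's equation [h - P h = 1 - kap 1_o].

    Pairing with [pi] gives [kap * pi o = 1]. Pairing with the stationary vector
    [pi_N] of [P_N] gives [pi_N o / pi o - 1 = pi_N (P h - P_N h)]. The function [h]
    is asymptotically affine in the level: its increments tend to [s = 1 / - sigma],
    the mean time spent per level during a descent. Since [P_N] cuts the jumps of
    more than [N] levels down to [N], the loss [P h - P_N h] is, up to a factor
    tending to [1], [s] times the mean overshoot of the jumps above [N], which is a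
    double tail of the blocks ([difference_bound]). Hence
      [pi_N o - pi o ~ pi o * s * (pi_N,0 BB_(N-1) e + pibar_N,0 AA_(N-1) e)].
    In particular [pi_N] converges to [pi], and no mass escapes to infinity
    ([scheffe]), so [pi_N] may be replaced by [pi] in the bracket. The integrated
    tail of the increment distribution is the same bracket with [N] in place of
    [N-1], divided by the mean ([integrated_tail_compl]); the regularity of the
    double tails turns the shift of the index into the factor [r].

    Existence and shape of [h]. The linear function [ell = s n + a_j], with [a]
    solving a finite Poisson equation for [A], has [ell - P ell = 1] above level
    [1]. The defect on levels [0] and [1] is moved to the state [o] by bounded
    functions, built from the probabilities of hitting one state before another
    ([reducible_finsupp]); so [h] is [ell] plus a bounded function [w]. Above the
    level of [o], [w] is harmonic for the free walk with increments [A_m], and a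
    bounded harmonic function is given by the powers of [G] applied to its lowest
    value, as one sees by comparison with [ell] ([bounded_harmonic_exp]). These
    powers converge to a rank one matrix because [G] is stochastic with a single,
    aperiodic closed class ([harmonic_cvg]); so [w] converges at infinity.

    The stationary pairing with [h - P h] vanishes although [h] is unbounded: [h]
    is Lipschitz in the level and the jumps have bounded means ([balance]). *)

(** * Convergent series of real numbers *)

Section Series.
Variable R : realType.
Implicit Types (u v b : nat -> R) (s t : R).

Lemma cvgn_epsP u s :
  u @ \oo --> s <->
  (forall e, 0 < e -> exists N, forall n, (N <= n)%N -> `|u n - s| <= e).
Proof.
split=> [us e e0|us].
  have /cvgrPdist_le/(_ e e0)[N _ HN] := us.
  by exists N => n Nn; rewrite distrC; exact: HN.
apply/cvgrPdist_le => e e0; have [N HN] := us e e0.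
by exists N => // n Nn; rewrite distrC; exact: HN.
Qed.

Definition sums (k0 : nat) u s : Prop :=
  (fun K => \sum_(k0 <= k < K) u k) @ \oo --> s.

Lemma sums_rsum k0 u s : sums k0 u s -> rsum k0 u = s.
Proof. by move=> us; apply/cvg_lim. Qed.

Lemma sums_unique k0 u s t : sums k0 u s -> sums k0 u t -> s = t.
Proof. by move=> /sums_rsum <- /sums_rsum. Qed.

Lemma cvg_sums k0 u :
  cvgn (fun K => \sum_(k0 <= k < K) u k) -> sums k0 u (rsum k0 u).
Proof. by []. Qed.

Lemma sumsP k0 u : (exists s, sums k0 u s) -> sums k0 u (rsum k0 u).
Proof. by case=> s us; rewrite (sums_rsum us). Qed.

Lemma eq_sums k0 u v s :
  (forall k, (k0 <= k)%N -> u k = v k) -> sums k0 u s -> sums k0 v s.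
Proof.
move=> uv; rewrite /sums.
suff -> : (fun K => \sum_(k0 <= k < K) u k) = (fun K => \sum_(k0 <= k < K) v k) by [].
by apply/funext => K; apply: eq_big_nat => k /andP[/uv].
Qed.

Lemma eq_rsum k0 u v :
  (forall k, (k0 <= k)%N -> u k = v k) -> rsum k0 u = rsum k0 v.
Proof.
move=> uv; rewrite /rsum.
suff -> : (fun K => \sum_(k0 <= k < K) u k) = (fun K => \sum_(k0 <= k < K) v k) by [].
by apply/funext => K; apply: eq_big_nat => k /andP[/uv].
Qed.

Lemma sumsD k0 u v s t :
  sums k0 u s -> sums k0 v t -> sums k0 (fun k => u k + v k) (s + t).
Proof.
move=> us vt; rewrite /sums; under eq_fun do rewrite big_split/=.
exact: cvgD.
Qed.

Lemma sumsZ k0 u s c : sums k0 u s -> sums k0 (fun k => c * u k) (c * s).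
Proof.
move=> us; rewrite /sums; under eq_fun do rewrite -mulr_sumr.
exact: cvgMl_tmp.
Qed.
Arguments sumsZ {k0 u s} c _.

Lemma sumsZr k0 u s c : sums k0 u s -> sums k0 (fun k => u k * c) (s * c).
Proof. by move=> /(sumsZ c); rewrite mulrC; apply: eq_sums => k _; rewrite mulrC. Qed.

Lemma sumsN k0 u s : sums k0 u s -> sums k0 (fun k => - u k) (- s).
Proof. by move=> /(sumsZ (-1)); rewrite mulN1r; apply: eq_sums => k _; rewrite mulN1r. Qed.

Lemma sumsB k0 u v s t :
  sums k0 u s -> sums k0 v t -> sums k0 (fun k => u k - v k) (s - t).
Proof. by move=> us /sumsN; exact: sumsD. Qed.

Lemma sums0 k0 : sums k0 (fun=> 0) 0.
Proof. by rewrite /sums; under eq_fun do rewrite big1//; exact: cvg_cst. Qed.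

Lemma sums_big (I : Type) (r : seq I) k0 (u : I -> nat -> R) (s : I -> R) :
  (forall i, sums k0 (u i) (s i)) ->
  sums k0 (fun k => \sum_(i <- r) u i k) (\sum_(i <- r) s i).
Proof.
move=> us; elim: r => [|i r IH].
  by rewrite big_nil; apply: eq_sums (sums0 k0) => k _; rewrite big_nil.
by rewrite big_cons; apply: eq_sums (sumsD (us i) IH) => k _; rewrite big_cons.
Qed.

Lemma sums_finsupp k0 u L : (k0 <= L)%N -> (forall k, (L <= k)%N -> u k = 0) ->
  sums k0 u (\sum_(k0 <= k < L) u k).
Proof.
move=> k0L u0; apply/cvgn_epsP => e e0; exists L => n Ln.
have tail0 : \sum_(L <= k < n) u k = 0.
  by rewrite big_nat_cond big1// => k /andP[/andP[/u0]].
by rewrite (@big_cat_nat _ _ _ L)//= tail0 addr0 subrr normr0 ltW.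
Qed.

Lemma sums_split L k0 u s : (k0 <= L)%N ->
  sums L u (s - \sum_(k0 <= k < L) u k) <-> sums k0 u s.
Proof.
move=> k0L.
have E n : (L <= n)%N -> \sum_(L <= k < n) u k - (s - \sum_(k0 <= k < L) u k) =
    \sum_(k0 <= k < n) u k - s.
  by move=> Ln; rewrite (@big_cat_nat _ _ _ L k0 n)//=; ring.
split => [|] /cvgn_epsP us; apply/cvgn_epsP => e e0;
    have [N HN] := us e e0; exists (maxn N L) => n; rewrite geq_max => /andP[Nn Ln];
    have := HN n Nn; by rewrite E.
Qed.

Arguments sums_split L {k0} u {s} _.

Lemma sums_skip0 u s : u 0%N = 0 -> sums 1 u s <-> sums 0 u s.
Proof. by move=> u0; rewrite -(sums_split 1 _ (leq0n 1)) big_nat1 u0 subr0. Qed.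

Lemma sums_shift k0 u s : sums 0 (fun k => u (k + k0)%N) s <-> sums k0 u s.
Proof.
rewrite /sums -(cvg_shiftn k0 (fun K => \sum_(k0 <= k < K) u k)) /=.
suff -> : (fun K => \sum_(0 <= k < K) u (k + k0)%N) =
    (fun K => \sum_(k0 <= k < K + k0) u k) by [].
by apply/funext => K; rewrite -{2}(add0n k0) big_addn addnK.
Qed.

Lemma sums_le k0 u v s t :
  (forall k, (k0 <= k)%N -> u k <= v k) -> sums k0 u s -> sums k0 v t -> s <= t.
Proof.
move=> uv us vt; apply: (ler_cvg_to us vt).
by apply: nearW => K; rewrite big_nat_cond [leRHS]big_nat_cond;
  apply: ler_sum => k /andP[/andP[/uv]].
Qed.

Lemma sums_ge0 k0 u s : (forall k, (k0 <= k)%N -> 0 <= u k) -> sums k0 u s -> 0 <= s.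
Proof. by move=> u0 us; apply: sums_le (sums0 k0) us. Qed.

Lemma sums_partial_le k0 u s K : (forall k, (k0 <= k)%N -> 0 <= u k) ->
  sums k0 u s -> \sum_(k0 <= k < K) u k <= s.
Proof.
move=> u0 us; have [k0K|Kk0] := leqP k0 K; last first.
  by rewrite big_geq ?(sums_ge0 u0)// ltnW.
rewrite -subr_ge0; apply: (@sums_ge0 K u); last exact/(sums_split K _ k0K).
by move=> k Kk; apply: u0; apply: leq_trans Kk.
Qed.

Lemma sums_term_le k0 u s k : (forall k, (k0 <= k)%N -> 0 <= u k) ->
  sums k0 u s -> (k0 <= k)%N -> u k <= s.
Proof.
move=> u0 us k0k; apply: le_trans (sums_partial_le k.+1 u0 us).
rewrite big_nat_recr//= lerDr big_nat_cond; apply: sumr_ge0 => l.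
by rewrite andbT => /andP[/u0].
Qed.

Lemma sums_abs_le k0 u b s t :
  (forall k, (k0 <= k)%N -> `|u k| <= b k) -> sums k0 u s -> sums k0 b t -> `|s| <= t.
Proof.
move=> ub us bt; rewrite ler_norml; apply/andP; split.
  apply: (sums_le _ (sumsN bt) us) => k /ub.
  by rewrite ler_norml => /andP[].
apply: (sums_le _ us bt) => k /ub.
by rewrite ler_norml => /andP[].
Qed.

Lemma summable_abs k0 u b t :
  (forall k, (k0 <= k)%N -> `|u k| <= b k) -> sums k0 b t ->
  sums k0 u (rsum k0 u).
Proof.
move=> ub bt; apply: sumsP.
have : cvgn (series (fun k => u (k + k0)%N)).
  apply: normed_cvg; apply: (@series_le_cvg _ _ (fun k => b (k + k0)%N)) => //=.
  - by move=> n; apply: le_trans (ub _ _); rewrite ?leq_addl.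
  - by move=> n; apply: ub; rewrite leq_addl.
  - by apply/cvg_ex; exists t; apply/sums_shift.
by move=> /cvg_ex[s us]; exists s; apply/sums_shift.
Qed.

Lemma sums_eq0 u : (forall k, 0 <= u k) -> sums 0 u 0 -> forall k, u k = 0.
Proof.
move=> u0 us k; apply/eqP; rewrite eq_le u0 andbT.
by apply: (sums_term_le _ us).
Qed.

Lemma sums_tail_small k0 u s e : sums k0 u s -> 0 < e ->
  exists2 L, (k0 <= L)%N & exists2 t, sums L u t & `|t| <= e.
Proof.
move=> us e0; have /cvgn_epsP/(_ e e0)[N HN] := us.
exists (maxn N k0); first exact: leq_maxr.
exists (s - \sum_(k0 <= k < maxn N k0) u k).
  by apply/sums_split => //; exact: leq_maxr.
by rewrite distrC; apply: HN; exact: leq_maxl.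
Qed.

Lemma cvg_fsum (I : Type) (r : seq I) (u : I -> nat -> R) (s : I -> R) :
  (forall i, u i @ \oo --> s i) ->
  (fun n => \sum_(i <- r) u i n) @ \oo --> \sum_(i <- r) s i.
Proof.
move=> us; elim: r => [|i r IH].
  by rewrite big_nil; under eq_fun do rewrite big_nil; exact: cvg_cst.
by rewrite big_cons; under eq_fun do rewrite big_cons; exact: cvgD.
Qed.

(** Dominated convergence for series: past some level [L] both tails are
    controlled by that of [b], and below [L] the sum is finite. *)
Lemma tannery (u : nat -> nat -> R) v b B :
  (forall n k, `|u n k| <= b k) -> sums 0 b B ->
  (forall k, u ^~ k @ \oo --> v k) ->
  (fun n => rsum 0 (u n)) @ \oo --> rsum 0 v.
Proof.
move=> ub bB uv.
have vb k : `|v k| <= b k.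
  apply: (ler_cvg_to (cvg_norm (uv k)) (cvg_cst (b k))); exact: nearW.
have un n := summable_abs (fun k (_ : (0 <= k)%N) => ub n k) bB.
have vn := summable_abs (fun k (_ : (0 <= k)%N) => vb k) bB.
apply/cvgn_epsP => e e0; have e4 : 0 < e / 4 by rewrite divr_gt0.
have [L _ [t bt te]] := sums_tail_small bB e4.
have /cvgn_epsP/(_ (e / 4) e4)[N HN] :=
  @cvg_fsum nat (index_iota 0 L) (fun k n => u n k) v uv.
exists N => n Nn.
have tail_le w : (forall k, `|w k| <= b k) -> sums 0 w (rsum 0 w) ->
    `|rsum 0 w - \sum_(0 <= k < L) w k| <= e / 4.
  move=> wb ws; apply: le_trans te; apply: le_trans (ler_norm t).
  by apply: (@sums_abs_le L w b) bt => //; apply/sums_split.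
have := HN n Nn; have := tail_le _ (ub n) (un n); have := tail_le _ vb vn.
set x := \sum_(_ <= _ < _) _; set y := \sum_(_ <= _ < _) _.
rewrite !ler_norml => /andP[? ?] /andP[? ?] /andP[? ?]; apply/andP; split; lra.
Qed.

End Series.
Arguments sumsZ {R k0 u s} c _.
Arguments sumsZr {R k0 u s} c _.
Arguments sums_rsum {R k0 u s} _.
Arguments sums_split {R} L {k0} u {s} _.

(** * Tails and first moments *)

Section Tails.
Variable R : realType.
Implicit Types (u : nat -> R).

(** The factor [m] makes the condition insensitive to [u 0], which is arbitrary
    when [u] comes from the blocks [blkB]. *)
Definition finite_mean u := exists B, sums 0 (fun m => m%:R * `|u m|) B.

Lemma finite_mean_sums u c (k0 : nat) : finite_mean u ->
  (forall m, (k0 <= m)%N -> `|c m| <= m%:R) ->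
  sums k0 (fun m => c m * u m) (rsum k0 (fun m => c m * u m)).
Proof.
case=> B uB cm; apply: summable_abs ((sums_split k0 _ (leq0n k0)).2 uB) => m k0m.
by rewrite normrM ler_wpM2r// cm.
Qed.

Lemma finite_mean_sums_pos u l : finite_mean u ->
  sums l.+1 u (rsum l.+1 u).
Proof.
move=> ufin; have := @finite_mean_sums u (fun=> 1) l.+1 ufin.
have -> : (fun m => 1 * u m) = u by apply/funext => m; rewrite mul1r.
by apply; case=> // m _; rewrite normr1 ler1n.
Qed.

Lemma sums_indic u l s :
  sums 0 (fun m => (l < m)%N%:R * u m) s <-> sums l.+1 u s.
Proof.
rewrite -(sums_split l.+1 _ (leq0n l.+1)) big_nat_cond big1 => [|k]; last first.
  by rewrite andbT /= ltnS => kl; rewrite ltnNge kl mul0r.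
by rewrite subr0; split; apply: eq_sums => k lk; rewrite lk mul1r.
Qed.

(** Each mass [u m] lies in exactly [m - N] of the tails of index at least [N]. *)
Lemma sums_of_tails N u : finite_mean u ->
  sums N (fun l => rsum l.+1 u) (rsum 0 (fun m => (m - N)%N%:R * u m)).
Proof.
move=> ufin; rewrite /sums.
have E L : \sum_(N <= l < L) rsum l.+1 u =
    rsum 0 (fun m => (minn m L - N)%N%:R * u m).
  apply/esym/sums_rsum.
  have S : sums 0 (fun m => \sum_(l <- index_iota N L) (l < m)%N%:R * u m)
      (\sum_(l <- index_iota N L) rsum l.+1 u).
    by apply: sums_big => l; apply/sums_indic/finite_mean_sums_pos.
  apply: eq_sums S => m _; rewrite -mulr_suml; congr (_ * _).
  rewrite -natr_sum; congr (_%:R).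
  have [NL|LN] := leqP N L; last first.
    by rewrite big_geq ?(ltnW LN)//; lia.
  elim: L NL => [|L IH].
    by rewrite leqn0 => /eqP->; rewrite big_geq//; lia.
  rewrite leq_eqVlt => /orP[/eqP <-|]; first by rewrite big_geq//; lia.
  rewrite ltnS => NL; rewrite big_nat_recr//= IH//.
  by case: ltnP; lia.
under eq_fun do rewrite E.
have [B uB] := ufin.
apply: (tannery _ uB) => [L m|m].
  by rewrite normrM ler_wpM2r// ger0_norm ?ler0n// ler_nat; lia.
apply/cvgn_epsP => e e0; exists m => L mL.
by rewrite (minn_idPl mL) subrr normr0 ltW.
Qed.

Arguments sums_of_tails N {u} _.

Lemma rsum_of_tails N u : finite_mean u ->
  rsum N (fun l => rsum l.+1 u) = rsum 0 (fun m => (m - N)%N%:R * u m).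
Proof. by move=> /(sums_of_tails N) /sums_rsum. Qed.

End Tails.
Arguments sums_of_tails {R} N {u} _.

Section MatrixTails.
Variable R : realType.

Definition rowsum m n (X : 'M[R]_(m, n)) (i : 'I_m) : R := \sum_j X i j.

Lemma mul_ones m n (X : 'M[R]_(m, n)) i : (X *m ones R n) i 0 = rowsum X i.
Proof. by rewrite !mxE; apply: eq_bigr => j _; rewrite !mxE mulr1. Qed.

Lemma rowsum_ge0 m n (X : 'M[R]_(m, n)) i : (forall j, 0 <= X i j) -> 0 <= rowsum X i.
Proof. by move=> X0; apply: sumr_ge0. Qed.

Lemma le_rowsum m n (X : 'M[R]_(m, n)) i j : (forall j, 0 <= X i j) -> X i j <= rowsum X i.
Proof. by move=> X0; rewrite /rowsum (bigD1 j)//= lerDl sumr_ge0. Qed.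

Variables (m n : nat) (X : nat -> 'M[R]_(m, n)).
Hypothesis X_ge0 : forall k i j, (0 < k)%N -> 0 <= X k i j.

Lemma finite_mean_rowsum :
  mx_summable 1 (fun k => k%:R *: (X k *m ones R n)) ->
  forall i, finite_mean (fun k => rowsum (X k) i).
Proof.
move=> Xs i; exists (rsum 1 (fun k => (k%:R *: (X k *m ones R n)) i 0)).
apply/sums_skip0; first by rewrite mul0r.
apply: eq_sums (cvg_sums (Xs i 0)) => k k0; rewrite mxE mul_ones ger0_norm// rowsum_ge0// => j.
exact: X_ge0.
Qed.

Lemma finite_mean_entry i j :
  finite_mean (fun k => rowsum (X k) i) -> finite_mean (fun k => X k i j).
Proof.
case=> B XB; exists (rsum 0 (fun k => k%:R * `|X k i j|)).
apply: summable_abs XB => -[|k] _; first by rewrite !mul0r normr0.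
rewrite normrM normr_id ger0_norm ?ler0n// ler_wpM2l ?ler0n//.
by rewrite !ger0_norm ?rowsum_ge0 ?le_rowsum// => *; exact: X_ge0.
Qed.

Hypothesis X_mean : forall i, finite_mean (fun k => rowsum (X k) i).

Lemma rowsum_tail k i : rowsum (tail X k) i = rsum k.+1 (fun l => rowsum (X l) i).
Proof.
apply/esym/sums_rsum.
have -> : rowsum (tail X k) i = \sum_j rsum k.+1 (fun l => X l i j).
  by apply: eq_bigr => j _; rewrite mxE.
by apply: sums_big => j; apply: finite_mean_sums_pos; apply: finite_mean_entry.
Qed.

Lemma rowsum_tail2 N i : rowsum (tail (tail X) N) i =
  rsum 0 (fun k => (k - N.+1)%N%:R * rowsum (X k) i).
Proof.
rewrite -rsum_of_tails//; apply/esym/sums_rsum; rewrite /rowsum.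
have -> : (fun l => rsum l.+1 (fun k => \sum_j X k i j)) = 
    (fun l => \sum_j rsum l.+1 (fun k => X k i j)).
  by apply/funext => l; rewrite -rowsum_tail; apply: eq_bigr => j _; rewrite mxE.
apply: sums_big => j; rewrite mxE.
have -> : (fun k => tail X k i j) = (fun l => rsum l.+1 (fun k => X k i j)).
  by apply/funext => l; rewrite mxE.
apply: sumsP; eexists; apply: sums_of_tails.
exact: finite_mean_entry.
Qed.

Lemma rowsum_mean i : (mx_sum 1 (fun k => k%:R *: (X k *m ones R n))) i 0 =
  rsum 0 (fun k => k%:R * rowsum (X k) i).
Proof.
rewrite mxE; apply: sums_rsum.
have k0 k : (0 <= k)%N -> `|k%:R : R| <= k%:R by rewrite ger0_norm.
have /sums_skip0 := finite_mean_sums (X_mean i) k0.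
rewrite mul0r => /(_ erefl); apply: eq_sums => k _.
by rewrite mxE mul_ones.
Qed.

End MatrixTails.

Section Radius.
Variable R : realType.

(** Bernoulli's inequality bounds [k] by a multiple of [z ^+ k]. *)
Lemma gf_radius_mean m n (X : nat -> 'M[R]_(m, n)) :
  (forall k i j, (0 < k)%N -> 0 <= X k i j) ->
  (1%:E < gf_radius X)%E -> forall i, finite_mean (fun k => rowsum (X k) i).
Proof.
move=> X0 /ereal_sup_gt[_ [z [z1 zs] <-]]; rewrite lte_fin => lt1z i.
pose c := (z - 1)^-1; have c0 : 0 < c by rewrite invr_gt0 subr_gt0.
exists (rsum 0 (fun k => k%:R * `|rowsum (X k) i|)).
apply/sums_skip0; first by rewrite mul0r.
have zS : sums 1 (fun k => c * (z ^+ k * rowsum (X k) i))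
   (c * \sum_j rsum 1 (fun k => (z ^+ k *: X k) i j)).
  apply: sumsZ; have := @sums_big R _ (index_enum 'I_n) 1 (fun j k => (z ^+ k *: X k) i j) _
     (fun j => cvg_sums (zs i j)).
  by apply: eq_sums => k _; rewrite mulr_sumr; apply: eq_bigr => j _; rewrite mxE.
have S : sums 1 (fun k => k%:R * `|rowsum (X k) i|)
    (rsum 1 (fun k => k%:R * `|rowsum (X k) i|)).
  apply: summable_abs zS => k k1; have r0 : 0 <= rowsum (X k) i.
    by apply: rowsum_ge0 => j; exact: X0.
  rewrite normrM normr_id !ger0_norm// mulrA ler_wpM2r//.
  rewrite /c mulrC ler_pdivlMr ?subr_gt0//.
  have : 1 + k%:R * (z - 1) <= z ^+ k.
    elim: k {k1 r0} => [|k IH]; first by rewrite mul0r addr0 expr0.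
    rewrite exprS -subr_ge0; have k0 := ler0n R k.
    have : 0 <= (z ^+ k - (1 + k%:R * (z - 1))) * z.
      by rewrite mulr_ge0// ?subr_ge0//; lra.
    rewrite -natr1; have : 0 <= k%:R * (z - 1) ^+ 2 by rewrite mulr_ge0// sqr_ge0.
    rewrite expr2; nra.
  lra.
suff -> : rsum 0 (fun k => k%:R * `|rowsum (X k) i|) =
    rsum 1 (fun k => k%:R * `|rowsum (X k) i|) by [].
by apply: sums_rsum; apply/sums_skip0; rewrite ?mul0r.
Qed.

End Radius.
Arguments finite_mean_sums_pos {R u} l _.

(** * The transition operator on functions of the state *)

Section Chain.
Variables (R : realType) (M0 M1 : nat).

Definition fn : Type := forall k, 'I_(lvl M0 M1 k) -> R.

Implicit Types (g h : fn) (c : nat -> nat) (C : R).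

(** The block of the jumps of [m.+1] levels upwards. Writing the target level as
    [(k + m).+1] lets its type of phases reduce to ['I_M1]. *)
Definition up (Q : mg1 R M0 M1) k m : 'M[R]_(lvl M0 M1 k, M1) :=
  match k with 0 => blkB Q m.+1 | _.+1 => blkA Q m.+1 end.

(** With [c = id] this is the action of [mg1_matrix Q] on functions; with
    [c = minn ^~ N] every upward jump is cut down to at most [N.+1] levels, which
    is the action of the truncated matrix. *)
Definition step (Q : mg1 R M0 M1) c g k (i : 'I_(lvl M0 M1 k)) : R :=
  \sum_(0 <= l < k.+1) \sum_j mg1_matrix Q k l i j * g l j +
  rsum 0 (fun m => \sum_j up Q k m i j * g (k + c m).+1 j).

Definition finsupp (L : nat) g := forall k i, (L <= k)%N -> g k i = 0.
Definition lingrow C g := forall k i, `|g k i| <= C * k.+1%:R.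
Definition lip C g := forall k i l j, `|g k i - g l j| <= C * (1 + `|k%:R - l%:R|).
Definition capped c := forall m, (c m <= m)%N.

Lemma mg1_matrix_up (Q : mg1 R M0 M1) k m : mg1_matrix Q k (k + m).+1 = up Q k m.
Proof.
case: k => [|[|k]] //=.
have -> : (k.+1 <= k.+2 + m)%N by lia.
by have -> : (k.+2 + m - k.+1)%N = m.+1 by lia.
Qed.

Lemma mg1_matrix_low (Q : mg1 R M0 M1) k l : (l.+1 < k)%N -> mg1_matrix Q k l = 0.
Proof.
case: k => [|[|k]]//; case: l => [|l]//= lk.
by rewrite ifF ?ifF//; apply/negbTE; lia.
Qed.

Lemma sums_levels (F : nat -> R) k s :
  sums 0 (fun m => F (k + m).+1) s -> sums 0 F (\sum_(0 <= l < k.+1) F l + s).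
Proof.
move=> Fs; apply/(sums_split k.+1 _ (leq0n k.+1)).
rewrite [X in sums _ _ X](_ : _ = s); last by rewrite addrC addKr.
apply/sums_shift; apply: eq_sums Fs => m _.
by rewrite addnS addnC.
Qed.

Lemma sums_levels_inv (F : nat -> R) k s :
  sums 0 F s -> sums 0 (fun m => F (k + m).+1) (s - \sum_(0 <= l < k.+1) F l).
Proof.
move=> /(sums_split k.+1 _ (leq0n k.+1)) /sums_shift.
by apply: eq_sums => m _; rewrite addnS addnC.
Qed.

Section Operator.
Variable Q : mg1 R M0 M1.
Hypothesis P_stoch : stochastic (mg1_matrix Q).
Hypothesis A_mean : forall i, finite_mean (fun m => rowsum (blkA Q m) i).
Hypothesis B_mean : forall i, finite_mean (fun m => rowsum (blkB Q m) i).

Let P_ge0 k l i j : 0 <= mg1_matrix Q k l i j.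
Proof. by case: P_stoch => + _; apply. Qed.

Lemma up_ge0 k m i j : 0 <= up Q k m i j.
Proof. by by have := @P_ge0 k (k + m).+1 i j; rewrite mg1_matrix_up. Qed.

Lemma rowsum_up_ge0 k m i : 0 <= rowsum (up Q k m) i.
Proof. by apply: rowsum_ge0 => j; exact: up_ge0. Qed.

Lemma sums_up k i :
  sums 0 (fun m => rowsum (up Q k m) i)
    (1 - \sum_(0 <= l < k.+1) \sum_j mg1_matrix Q k l i j).
Proof.
have [_ /(_ k i)] := P_stoch => /(@sums_levels_inv _ k).
by apply: eq_sums => m _; rewrite mg1_matrix_up.
Qed.

Arguments sums_up {k} i.

(** The rows of jumps are those of level [0] and those of level [1], in finite
    number. *)
Lemma up_mean_bounded : exists2 mu : R, 0 <= mu & forall k i,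
  exists2 t, sums 0 (fun m => m.+1%:R * rowsum (up Q k m) i) t & t <= mu.
Proof.
have E m (X : nat -> 'M[R]_(m, M1)) i : finite_mean (fun k => rowsum (X k) i) ->
    sums 0 (fun k => k.+1%:R * rowsum (X k.+1) i) (rsum 0 (fun k => k.+1%:R * rowsum (X k.+1) i)).
  move=> Xi; apply: sumsP.
  have k0 k : (1 <= k)%N -> `|k%:R : R| <= k%:R by rewrite ger0_norm.
  eexists; have /sums_shift := finite_mean_sums Xi k0.
  by apply: eq_sums => k _; rewrite addn1.
pose a i := rsum 0 (fun k => k.+1%:R * rowsum (blkA Q k.+1) i).
pose b i := rsum 0 (fun k => k.+1%:R * rowsum (blkB Q k.+1) i).
exists (\sum_i `|a i| + \sum_i `|b i|).
  by rewrite addr_ge0// sumr_ge0.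
have le_norms p (d : 'I_p -> R) i : d i <= \sum_i `|d i|.
  by rewrite (bigD1 i)//= (le_trans (ler_norm _))// lerDl sumr_ge0.
case=> [|k] i; [exists (b i) | exists (a i)]; try exact: E.
  by apply: le_trans (le_norms _ b i) _; rewrite lerDr sumr_ge0.
by apply: le_trans (le_norms _ a i) _; rewrite lerDl sumr_ge0.
Qed.

Lemma norm_step_term c g C k m i : capped c -> lingrow C g ->
  `|\sum_j up Q k m i j * g (k + c m).+1 j| <=
   C * (k.+2%:R) * (m.+1%:R * rowsum (up Q k m) i).
Proof.
move=> cm gC; apply: le_trans (ler_norm_sum _ _ _) _.
rewrite !mulr_sumr; apply: ler_sum => j _; have u0 := @up_ge0 k m i j.
rewrite normrM ger0_norm// mulrC mulrA ler_wpM2r// -mulrA.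
apply: le_trans (gC _ _) _.
have C0 : 0 <= C.
  have := le_trans (normr_ge0 _) (gC (k + c m).+1 j).
  by rewrite pmulr_lge0// ltr0Sn.
by rewrite ler_wpM2l// -natrM ler_nat; have := cm m; nia.
Qed.

Lemma step_summable c g C k i : capped c -> lingrow C g ->
  sums 0 (fun m => \sum_j up Q k m i j * g (k + c m).+1 j)
    (rsum 0 (fun m => \sum_j up Q k m i j * g (k + c m).+1 j)).
Proof.
move=> cm gC; have [mu _ /(_ k i)[t tu _]] := up_mean_bounded.
apply: (summable_abs _ (sumsZ (C * (k.+2%:R)) tu)) => m _.
exact: (@norm_step_term _ _ _ k m i cm gC).
Qed.

Arguments step_summable {c g C k} i _ _.

Lemma step_lin c g h C C' a b k (i : 'I_(lvl M0 M1 k)) : capped c -> lingrow C g -> lingrow C' h ->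
  step Q c (fun k i => a * g k i + b * h k i) i =
  a * step Q c g i + b * step Q c h i :> R.
Proof.
move=> cm gC hC; rewrite /step !mulrDr addrACA; congr (_ + _).
  rewrite !mulr_sumr -big_split/=; apply: eq_bigr => l _.
  rewrite !mulr_sumr -big_split/=; apply: eq_bigr => j _; ring.
apply: sums_rsum; have := sumsD (sumsZ a (step_summable i cm gC))
  (sumsZ b (step_summable i cm hC)).
apply: eq_sums => m _; rewrite !mulr_sumr -big_split/=; apply: eq_bigr => j _; ring.
Qed.

Lemma step_cst c a k (i : 'I_(lvl M0 M1 k)) : step Q c (fun _ _ => a) i = a.
Proof.
rewrite /step; under eq_bigr do rewrite -mulr_suml.
rewrite -mulr_suml.
have /(sumsZr a) H := sums_up i.
have -> : rsum 0 (fun m => \sum_j up Q k m i j * a) =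
   (1 - \sum_(0 <= l < k.+1) \sum_j mg1_matrix Q k l i j) * a.
  by apply: sums_rsum; apply: eq_sums H => m _; rewrite mulr_suml.
by rewrite -mulrDl addrC subrK mul1r.
Qed.

Lemma step_ge0 c g C k (i : 'I_(lvl M0 M1 k)) : capped c -> lingrow C g ->
  (forall k i, 0 <= g k i) -> 0 <= step Q c g i.
Proof.
move=> cm gC g0; apply: addr_ge0.
  by do 2![apply: sumr_ge0 => ? _]; rewrite mulr_ge0.
apply: sums_ge0 (step_summable i cm gC) => m _.
by apply: sumr_ge0 => j _; rewrite mulr_ge0 ?up_ge0.
Qed.

(** Dominated convergence, the mean jump being the dominating series. *)
Lemma step_cvg c (g : nat -> fn) h C k (i : 'I_(lvl M0 M1 k)) : capped c ->
  (forall n, lingrow C (g n)) -> (forall k i, (fun n => g n k i) @ \oo --> h k i) ->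
  (fun n => step Q c (g n) i) @ \oo --> step Q c h i.
Proof.
move=> cm gC gh; apply: cvgD.
  apply: cvg_fsum => l; apply: cvg_fsum => j; apply: cvgMl_tmp; exact: gh.
have [mu _ /(_ k i)[t tu _]] := up_mean_bounded.
apply: (tannery _ (sumsZ (C * (k.+2%:R)) tu)) => [n m|m].
  exact: (@norm_step_term _ _ _ k m i cm (gC n)).
by apply: cvg_fsum => j; apply: cvgMl_tmp; exact: gh.
Qed.

(** Downward jumps are of at most one level and upward jumps have bounded means, so
    one step moves a Lipschitz function by a bounded amount. *)
Lemma step_lip : exists2 D : R, 0 <= D & forall c g C C', capped c -> lip C g -> lingrow C' g ->
  forall k i, `|g k i - step Q c g i| <= C * D.
Proof.
have [mu mu0 muP] := up_mean_bounded.
exists (2 * (1 + mu)) => [|c g C C' cm gC gC' k i].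
  by rewrite mulr_ge0// addr_ge0.
have C0 : 0 <= C.
  have := le_trans (normr_ge0 _) (gC k i k i).
  by rewrite subrr normr0 addr0 mulr1.
have [t tu tmu] := muP k i.
have up_i := sums_up i.
pose lo := \sum_(0 <= l < k.+1) \sum_j mg1_matrix Q k l i j.
have lo1 : lo <= 1.
  rewrite -subr_ge0; apply: sums_ge0 up_i => m _; exact: rowsum_up_ge0.
have -> : g k i - step Q c g i =
    \sum_(0 <= l < k.+1) \sum_j mg1_matrix Q k l i j * (g k i - g l j) +
    rsum 0 (fun m => \sum_j up Q k m i j * (g k i - g (k + c m).+1 j)).
  have -> : rsum 0 (fun m => \sum_j up Q k m i j * (g k i - g (k + c m).+1 j)) =
      (1 - lo) * g k i - rsum 0 (fun m => \sum_j up Q k m i j * g (k + c m).+1 j).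
    apply: sums_rsum.
    apply: eq_sums (sumsB (sumsZr (g k i) up_i) (step_summable i cm gC')) => m _.
    rewrite /rowsum mulr_suml -sumrB; apply: eq_bigr => j _; ring.
  have -> : \sum_(0 <= l < k.+1) \sum_j mg1_matrix Q k l i j * (g k i - g l j) =
     lo * g k i - \sum_(0 <= l < k.+1) \sum_j mg1_matrix Q k l i j * g l j.
    rewrite mulr_suml -sumrB; apply: eq_bigr => l _.
    rewrite mulr_suml -sumrB; apply: eq_bigr => j _; ring.
  rewrite /step; ring.
have H1 : `|\sum_(0 <= l < k.+1) \sum_j mg1_matrix Q k l i j * (g k i - g l j)| <= C * 2 * lo.
  apply: le_trans (ler_norm_sum _ _ _) _; rewrite mulr_sumr.
  rewrite big_nat_cond [leRHS]big_nat_cond; apply: ler_sum => l.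
  rewrite andbT ltnS /= => lk.
  apply: le_trans (ler_norm_sum _ _ _) _; rewrite mulr_sumr; apply: ler_sum => j _.
  have P0 := P_ge0 i j; rewrite normrM ger0_norm// mulrC.
  have [l1k|kl1] := ltnP l.+1 k; first by rewrite mg1_matrix_low// mxE !mulr0.
  rewrite ler_wpM2r//; apply: le_trans (gC _ _ _ _) _.
  rewrite ler_wpM2l// -natrB//.
  rewrite ger0_norm ?ler0n// -[X in X + _]/(1%:R) -natrD ler_nat; lia.
have H2 : `|rsum 0 (fun m => \sum_j up Q k m i j * (g k i - g (k + c m).+1 j))| <= C * 2 * t.
  have : forall m, (0 <= m)%N -> `|\sum_j up Q k m i j * (g k i - g (k + c m).+1 j)| <=
      C * 2 * (m.+1%:R * rowsum (up Q k m) i).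
    move=> m _; apply: le_trans (ler_norm_sum _ _ _) _; rewrite !mulr_sumr.
    apply: ler_sum => j _; have u0 := @up_ge0 k m i j.
    rewrite normrM ger0_norm// mulrC mulrA ler_wpM2r//.
    apply: le_trans (gC _ _ _ _) _; rewrite -mulrA ler_wpM2l//.
    rewrite distrC -natrB ?ger0_norm ?ler0n//; last by lia.
    rewrite -[X in X + _]/(1%:R) -natrD -natrM ler_nat; have := cm m; lia.
  move=> H; exact: (sums_abs_le H (summable_abs H (sumsZ (C * 2) tu)) (sumsZ (C * 2) tu)).
apply: le_trans (ler_normD _ _) _.
have -> : C * (2 * (1 + mu)) = C * 2 * 1 + C * 2 * mu by ring.
apply: lerD; [apply: le_trans H1 _ | apply: le_trans H2 _];
  by rewrite ler_wpM2l// mulr_ge0.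
Qed.

End Operator.
End Chain.
Arguments step_summable {R M0 M1 Q} _ _ _ {c g C k} i _ _.
Arguments sums_up {R M0 M1 Q} _ {k} i.
Arguments mg1_matrix_up {R M0 M1 Q} k m.
Arguments up_ge0 {R M0 M1 Q} _ k m i j.
Arguments rowsum_up_ge0 {R M0 M1 Q} _ k m i.

(** * Stationary distributions tested against functions of the state *)

Section Balance.
Variables (R : realType) (M0 M1 : nat).
Implicit Types (g h : fn R M0 M1) (c : nat -> nat) (C : R) (v : bvec R M0 M1).

(** Only finitely many column equations are involved when [g] has finite support. *)
Lemma stationary_finsupp (P : bmx R M0 M1) v g L : stationary P v -> finsupp L g ->
  sums 0 (fun k => \sum_i v k 0 i *
    (g k i - \sum_(0 <= l < L) \sum_j P k l i j * g l j)) 0.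
Proof.
case=> v0 v1 vP gL.
have S1 : sums 0 (fun k => \sum_i v k 0 i * g k i) (\sum_(0 <= k < L) \sum_i v k 0 i * g k i).
  by apply: sums_finsupp => // k Lk; apply: big1 => i _; rewrite gL// mulr0.
have S2 : sums 0 (fun k => \sum_(l <- index_iota 0 L) \sum_j (v k *m P k l) 0 j * g l j)
     (\sum_(l <- index_iota 0 L) \sum_j v l 0 j * g l j).
  by apply: sums_big => l; apply: sums_big => j; apply: sumsZr; exact: vP.
have := sumsB S1 S2; rewrite subrr; apply: eq_sums => k _.
under [RHS]eq_bigr do rewrite mulrBr.
rewrite sumrB; congr (_ - _).
under [RHS]eq_bigr do rewrite mulr_sumr.
rewrite [RHS]exchange_big/=; apply: eq_bigr => l _.
under [RHS]eq_bigr do rewrite mulr_sumr.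
rewrite [RHS]exchange_big/=; apply: eq_bigr => j _.
by rewrite mxE mulr_suml; apply: eq_bigr => i _; rewrite mulrA.
Qed.

(** The triangular cut-off at height [K], used to approximate a function of
    linear growth by finitely supported ones with a common Lipschitz constant. *)
Definition cutoff (K n : nat) : R := (K.+1 - n)%N%:R / K.+1%:R.

Lemma cutoff_bounds K n : 0 <= cutoff K n <= 1.
Proof.
rewrite divr_ge0 ?ler0n//= ler_pdivrMr ?ltr0Sn// mul1r ler_nat; lia.
Qed.

Lemma cutoff_cvg n : cutoff ^~ n @ \oo --> (1 : R).
Proof.
apply/cvgn_epsP => e e0; exists (maxn n (Num.truncn (n%:R / e))) => K.
rewrite geq_max => /andP[nK tK].
rewrite /cutoff natrB; last by lia.
have K0 : 0 < K.+1%:R :> R by rewrite ltr0Sn.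
rewrite mulrBl divff ?gt_eqF// addrC addrA addNr add0r normrN ger0_norm ?divr_ge0 ?ler0n//.
rewrite ler_pdivrMr// mulrC -ler_pdivrMr//.
apply: le_trans (ltW (truncnS_gt _)) _.
by rewrite ler_nat ltnS.
Qed.

(** The cut-off has slope [1 / K.+1], and it is not constant only on levels where
    [g] is at most of order [K]. *)
Lemma cutoff_mul_lip C C' g K : 0 <= C' -> lip C g -> lingrow C' g ->
  lip (C + C') (fun k i => cutoff K k * g k i).
Proof.
move=> C'0 gC gC'.
suff H k i l j : (l <= k)%N ->
    `|cutoff K k * g k i - cutoff K l * g l j| <= (C + C') * (1 + `|k%:R - l%:R|).
  move=> k i l j; have [lk|/ltnW kl] := leqP l k; first exact: H.
  by rewrite distrC (distrC k%:R); exact: H.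
move=> lk.
have -> : cutoff K k * g k i - cutoff K l * g l j =
  cutoff K k * (g k i - g l j) - (cutoff K l - cutoff K k) * g l j by ring.
rewrite [leRHS]mulrDl; apply: le_trans (ler_normB _ _) _; apply: lerD.
  rewrite normrM; apply: (le_trans _ (gC k i l j)).
  have /andP[c0 c1] := cutoff_bounds K k; rewrite ger0_norm//.
  by rewrite ler_piMl.
rewrite normrM.
have : `|cutoff K l - cutoff K k| * l.+1%:R <= `|k%:R - l%:R|.
  have [Kl|lK] := ltnP K l.
    rewrite /cutoff.
    have -> : (K.+1 - l = 0)%N by lia.
    have -> : (K.+1 - k = 0)%N by lia.
    by rewrite subrr normr0 mul0r.
  rewrite /cutoff -mulrBl normrM [X in _ * X * _]ger0_norm ?invr_ge0 ?ler0n//.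
  have -> : (K.+1 - l)%N%:R - (K.+1 - k)%N%:R = (K.+1 - l - (K.+1 - k))%N%:R :> R.
    by apply/esym/natrB; lia.
  rewrite -(natrB _ lk) !ger0_norm ?ler0n//.
  rewrite mulrAC ler_pdivrMr ?ltr0Sn// -!natrM ler_nat.
  by apply: leq_mul; lia.
move=> H; have ll : `|g l j| <= C' * l.+1%:R := gC' l j.
apply: le_trans (ler_wpM2l (normr_ge0 _) ll) _.
rewrite mulrCA ler_wpM2l//; apply: le_trans H _.
by rewrite lerDr.
Qed.

Section OneChain.
Variable Q : mg1 R M0 M1.
Hypothesis P_stoch : stochastic (mg1_matrix Q).
Hypothesis A_mean : forall i, finite_mean (fun m => rowsum (blkA Q m) i).
Hypothesis B_mean : forall i, finite_mean (fun m => rowsum (blkB Q m) i).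

Definition balanced v c := forall L g, finsupp L g ->
  sums 0 (fun k => \sum_i v k 0 i * (g k i - step Q c g i)) 0.

(** The functions [g - P g], for [g] ranging over the cut-offs of [h], are uniformly
    bounded because the mean jumps are, so dominated convergence applies to the
    pairing with [v], whether [h] is integrable or not. *)
Lemma balance v c h C C' : (forall k i, 0 <= v k 0 i) ->
  sums 0 (fun k => \sum_i v k 0 i) 1 -> balanced v c -> capped c ->
  lip C h -> lingrow C' h ->
  sums 0 (fun k => \sum_i v k 0 i * (h k i - step Q c h i)) 0.
Proof.
move=> v0 v1 vbal cc hC hC'.
have [D D0 HD] := step_lip P_stoch A_mean B_mean.
pose C'' : R := `|C'|.
have C''0 : 0 <= C'' by exact: normr_ge0.
have hC'' : lingrow C'' h.
  move=> k i; apply: le_trans (hC' k i) _.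
  by rewrite ler_wpM2r ?ler0n// ler_norm.
pose g K : fn R M0 M1 := fun k i => cutoff K k * h k i.
have gfin K : finsupp K.+1 (g K).
  move=> k i Kk; rewrite /g /cutoff.
  have -> : (K.+1 - k = 0)%N by lia.
  by rewrite !mul0r.
have glip K : lip (C + C'') (g K) by exact: (@cutoff_mul_lip _ _ _ K C''0 hC hC'').
have ggrow K : lingrow C'' (g K).
  move=> k i; apply: (le_trans _ (hC'' k i)); rewrite normrM.
  have /andP[c0 c1] := cutoff_bounds K k; rewrite ger0_norm//.
  by rewrite ler_piMl.
have gh k i : (fun K => g K k i) @ \oo --> h k i.
  by rewrite -[X in _ --> X]mul1r; apply: cvgMr_tmp; exact: cutoff_cvg.
have dom K k : `|\sum_i v k 0 i * (g K k i - step Q c (g K) i)| <=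
    ((C + C'') * D) * \sum_i v k 0 i.
  apply: le_trans (ler_norm_sum _ _ _) _; rewrite mulr_sumr; apply: ler_sum => i _.
  rewrite normrM ger0_norm// mulrC ler_wpM2r//.
  exact: (HD c (g K) _ _ cc (glip K) (ggrow K)).
have lims k : (fun K => \sum_i v k 0 i * (g K k i - step Q c (g K) i)) @ \oo -->
    \sum_i v k 0 i * (h k i - step Q c h i).
  apply: cvg_fsum => i; apply: cvgMl_tmp; apply: cvgB; first exact: gh.
  exact: (@step_cvg _ _ _ _ P_stoch A_mean B_mean c g h C'' k i cc ggrow gh).
have := tannery dom (sumsZ _ v1) lims.
have -> : (fun K => rsum 0 (fun k => \sum_i v k 0 i * (g K k i - step Q c (g K) i))) =
   fun=> 0.
  by apply/funext => K; apply: sums_rsum; exact: (vbal K.+1).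
move=> l0; have {l0} E := cvg_unique _ l0 (cvg_cst 0).
rewrite -[X in sums _ _ X]E//; apply: sumsP.
exists (rsum 0 (fun k => \sum_i v k 0 i * (h k i - step Q c h i))).
apply: summable_abs (sumsZ ((C + C'') * D) v1) => k _.
by apply: (ler_cvg_to (cvg_norm (lims k)) (cvg_cst _)); exact: nearW.
Qed.

Lemma step_finsupp c L g k (i : 'I_(lvl M0 M1 k)) : finsupp L g ->
  capped c -> 
  sums 0 (fun m => \sum_j up Q k m i j * g (k + c m).+1 j)
    (rsum 0 (fun m => \sum_j up Q k m i j * g (k + c m).+1 j)).
Proof.
move=> gL cc.
apply: (step_summable P_stoch A_mean B_mean i cc) (_ : lingrow (\sum_(0 <= l < L) \sum_j `|g l j|) g).
move=> l j; have [lL|Ll] := ltnP l L; last first.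
  rewrite gL// normr0 mulr_ge0//; by do 2![apply: sumr_ge0 => ? _].
apply: (@le_trans _ _ (\sum_(0 <= l < L) \sum_j `|g l j|)); last first.
  by rewrite ler_peMr ?ler1n//; do 2![apply: sumr_ge0 => ? _].
apply: (@le_trans _ _ (\sum_j `|g l j|)); first by rewrite (bigD1 j)//= lerDl sumr_ge0.
rewrite big_mkord (bigD1 (Ordinal lL))//= lerDl.
by do 2![apply: sumr_ge0 => ? _].
Qed.

Arguments step_finsupp {c L g k} i _ _.

Lemma balanced_stationary v : stationary (mg1_matrix Q) v -> balanced v id.
Proof.
move=> vst L g gL; have := stationary_finsupp vst gL.
apply: eq_sums => k _; apply: eq_bigr => i _; congr (_ * (_ - _)).
apply: (sums_unique (u := fun l => \sum_j mg1_matrix Q k l i j * g l j) (k0 := 0)).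
  apply: sums_finsupp => // l Ll; apply: big1 => j _; by rewrite gL// mulr0.
apply: sums_levels; have idc : capped id by move=> m.
by apply: eq_sums (step_finsupp i gL idc) => m _; rewrite mg1_matrix_up.
Qed.

Definition up_tail k N : 'M[R]_(lvl M0 M1 k, M1) :=
  match k with 0 => tail (blkB Q) N | _.+1 => tail (blkA Q) N end.

Lemma LI_trunc_up N k m : up (LI_trunc Q N.+1) k m =
  if (m < N)%N then up Q k m else if m == N then
    up_tail k N else 0.
Proof. by case: k => [|k] /=; rewrite ltnS eqSS. Qed.

Lemma LI_trunc_low N k l : (l <= k)%N ->
  mg1_matrix (LI_trunc Q N.+1) k l = mg1_matrix Q k l.
Proof.
case: k => [|[|k]]; case: l => [|l]//=; rewrite !ltnS => lk.
  have -> : (l - 0 = 0)%N by lia.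
  by [].
have [kl|] := leqP k.+1 l.
  have -> : (l - k.+1 = 0)%N by lia.
  by [].
by [].
Qed.

Lemma rsum_up_tail N k i j :
  up_tail k N i j = rsum N (fun m => up Q k m i j).
Proof.
have E p (X : nat -> 'M[R]_(p, M1)) i' : (forall k i j, (0 < k)%N -> 0 <= X k i j) ->
    (forall i, finite_mean (fun k => rowsum (X k) i)) ->
    tail X N i' j = rsum N (fun k => X k.+1 i' j).
  move=> X0 Xi; apply/esym/sums_rsum; rewrite mxE.
  have H := finite_mean_sums_pos N (finite_mean_entry X0 j (Xi i')).
  apply/sums_shift; move/sums_shift : H; apply: eq_sums => m _; by rewrite addnS.
case: k i => [|k] i.
  by apply: E => // -[|m] a b// _; have := up_ge0 P_stoch 0%N m a b.
by apply: E => // -[|m] a b// _; have := up_ge0 P_stoch 1%N m a b.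
Qed.

(** The truncated block of the jumps of [N.+1] levels gathers the masses of all
    the larger jumps. *)
Lemma balanced_LI_trunc N v : stationary (mg1_matrix (LI_trunc Q N.+1)) v ->
  balanced v (minn ^~ N).
Proof.
move=> vst L g gL; have := stationary_finsupp vst gL.
apply: eq_sums => k _; apply: eq_bigr => i _; congr (_ * (_ - _)).
apply: (sums_unique (u := fun l => \sum_j mg1_matrix (LI_trunc Q N.+1) k l i j * g l j) (k0 := 0)).
  apply: sums_finsupp => // l Ll; apply: big1 => j _; by rewrite gL// mulr0.
have -> : step Q (minn^~ N) g i =
  \sum_(0 <= l < k.+1) \sum_j mg1_matrix (LI_trunc Q N.+1) k l i j * g l j +
  rsum 0 (fun m => \sum_j up Q k m i j * g (k + minn m N).+1 j).
  congr (_ + _); rewrite big_nat_cond [RHS]big_nat_cond.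
  by apply: eq_bigr => l; rewrite andbT ltnS /= => lk; rewrite LI_trunc_low.
apply: sums_levels; have idc : capped (minn^~ N) by move=> m; exact: geq_minl.
have S := step_finsupp i gL idc.
pose F m := \sum_j up (LI_trunc Q N.+1) k m i j * g (k + m).+1 j.
suff E : rsum 0 (fun m => \sum_j up Q k m i j * g (k + minn m N).+1 j) =
    \sum_(0 <= m < N.+1) F m.
  rewrite E; apply: (@eq_sums _ _ F); first by move=> m _; rewrite /F mg1_matrix_up.
  apply: sums_finsupp => // m Nm; rewrite /F; apply: big1 => j _.
  by rewrite LI_trunc_up ltnNge (ltnW Nm)/= gtn_eqF// mxE mul0r.
rewrite big_nat_recr//=.
have FN : sums N (fun m => \sum_j up Q k m i j * g (k + minn m N).+1 j) (F N).
  rewrite /F; apply: (@eq_sums _ _ (fun m => \sum_j up Q k m i j * g (k + N).+1 j)).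
    by move=> m Nm; rewrite (minn_idPr Nm).
  apply: sums_big => j; rewrite LI_trunc_up ltnn eqxx rsum_up_tail; apply: sumsZr.
  have UP := (sums_split N _ (leq0n N)).2 (sums_up P_stoch i).
  apply: summable_abs UP => m _; have u0 := up_ge0 P_stoch k m i.
  by rewrite ger0_norm// le_rowsum.
apply: sums_rsum; apply/(sums_split N _ (leq0n N)).
rewrite [X in sums _ _ (_ - X)](_ : _ = \sum_(0 <= m < N) F m).
  suff -> : \sum_(0 <= m < N) F m + F N - \sum_(0 <= m < N) F m = F N by exact: FN.
  by rewrite addrC addKr.
rewrite big_nat_cond [RHS]big_nat_cond; apply: eq_bigr => m; rewrite andbT /= => mN.
by rewrite /F LI_trunc_up mN (minn_idPl (ltnW mN)).
Qed.

End OneChain.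
End Balance.

(** * Bounded solutions of Poisson's equation for finitely supported charges *)

Section Poisson.
Variables (R : realType) (M0 M1 : nat).
Notation fn := (fn R M0 M1).
Implicit Types (g h w b : fn) (C : R).

Definition bounded_fn C g := forall k i, `|g k i| <= C.

Lemma bounded_fn_lingrow C g k0 (i0 : 'I_(lvl M0 M1 k0)) : bounded_fn C g -> lingrow C g.
Proof.
move=> gC k i; apply: le_trans (gC k i) _.
by rewrite ler_peMr ?ler1n// (le_trans _ (gC _ i0)).
Qed.

(** Phases are compared as numbers, since those of different levels live in
    different types. *)
Definition ind k0 (i0 : 'I_(lvl M0 M1 k0)) : fn :=
  fun k i => ((k == k0) && (i == i0 :> nat))%:R.

Lemma ind_self k (i : 'I_(lvl M0 M1 k)) : ind i i = 1.
Proof. by rewrite /ind !eqxx. Qed.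

Lemma ind_neq0 k0 (i0 : 'I_(lvl M0 M1 k0)) k (i : 'I_(lvl M0 M1 k)) :
  ind i0 i != 0 -> existT (fun k => 'I_(lvl M0 M1 k)) k i = existT _ k0 i0.
Proof.
rewrite /ind; case: (k =P k0) => [e|] /=; last by rewrite eqxx.
subst k; case: ((i : nat) =P i0) => [/val_inj ->|_] //=; by rewrite eqxx.
Qed.

Lemma ind01 k0 (i0 : 'I_(lvl M0 M1 k0)) k (i : 'I_(lvl M0 M1 k)) : 0 <= ind i0 i <= 1.
Proof. by rewrite /ind ler0n lern1 leq_b1. Qed.

(** A nonzero entry of [bpow P n] contains a path of nonzero entries of [P], which
    stays in [T]. *)
Lemma irreducible_closed (P : bmx R M0 M1) (T : forall k, 'I_(lvl M0 M1 k) -> Prop) :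
  irreducible P ->
  (forall k i l j, T k i -> P k l i j != 0 -> T l j) ->
  forall k i, T k i -> forall l j, T l j.
Proof.
move=> Pirr Tc k i Tki l j; have [n] := Pirr k l i j.
move=> /lt0r_neq0; elim: n k i Tki => [|n IH] k i Tki /=.
  rewrite mxE; case: (k =P l) => [e|] /=; last by rewrite eqxx.
  subst l; case: ((i : nat) =P j) => [/val_inj <-|_] //=; by rewrite eqxx.
rewrite mxE => s0; apply: contrapT => nT; move/eqP: s0; apply.
apply: sums_rsum; apply: eq_sums (@sums0 R 0) => m _.
rewrite mxE big1// => i' _; apply/eqP; rewrite mulf_eq0.
have [//|P0] := eqVneq (P k m i i') 0.
apply/negPn/negP => b0; apply: nT; apply: IH b0; exact: Tc P0.
Qed.

Section Operator.
Variable Q : mg1 R M0 M1.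
Hypothesis P_stoch : stochastic (mg1_matrix Q).
Hypothesis A_mean : forall i, finite_mean (fun m => rowsum (blkA Q m) i).
Hypothesis B_mean : forall i, finite_mean (fun m => rowsum (blkB Q m) i).

Notation pstep := (step Q id).

Let id_capped : capped id. Proof. by []. Qed.

Lemma pstep_lin g h C C' (a c : R) k (i : 'I_(lvl M0 M1 k)) : lingrow C g -> lingrow C' h ->
  pstep (fun k i => a * g k i + c * h k i) i = a * pstep g i + c * pstep h i :> R.
Proof. exact: (step_lin P_stoch A_mean B_mean a c i id_capped). Qed.

Lemma pstep_ge0 g C k (i : 'I_(lvl M0 M1 k)) : lingrow C g ->
  (forall k i, 0 <= g k i) -> 0 <= pstep g i.
Proof. exact: (@step_ge0 _ _ _ _ P_stoch A_mean B_mean id g C k i id_capped). Qed.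

Lemma pstep_le g h C C' k (i : 'I_(lvl M0 M1 k)) : lingrow C g -> lingrow C' h ->
  (forall k i, g k i <= h k i) -> pstep g i <= pstep h i.
Proof.
move=> gC hC gh; rewrite -subr_ge0.
have -> : pstep h i - pstep g i = pstep (fun k i => 1 * h k i + -1 * g k i) i.
  by rewrite (pstep_lin _ _ _ hC gC) mul1r mulN1r.
apply: (@step_ge0 _ _ _ _ P_stoch A_mean B_mean id _ (C' + C)) => //.
  move=> l j; rewrite mul1r mulN1r mulrDl; apply: le_trans (ler_normB _ _) _.
  exact: lerD.
by move=> l j; rewrite mul1r mulN1r subr_ge0.
Qed.

Lemma pstep_eq0 g C k (i : 'I_(lvl M0 M1 k)) : lingrow C g ->
  (forall k i, 0 <= g k i) -> pstep g i = 0 ->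
  forall l j, mg1_matrix Q k l i j != 0 -> g l j = 0.
Proof.
move=> gC g0; have [P0 _] := P_stoch.
have S := step_summable P_stoch A_mean B_mean i id_capped gC.
have lo0 : 0 <= \sum_(0 <= l < k.+1) \sum_j mg1_matrix Q k l i j * g l j.
  by do 2![apply: sumr_ge0 => ? _]; rewrite mulr_ge0.
have t0 m : 0 <= \sum_j up Q k m i j * g (k + m).+1 j.
  by apply: sumr_ge0 => j _; rewrite mulr_ge0// (up_ge0 P_stoch).
have up0 := sums_ge0 (fun m _ => t0 m) S.
have row0 l (j : 'I_(lvl M0 M1 l)) :
    \sum_j mg1_matrix Q k l i j * g l j = 0 -> mg1_matrix Q k l i j != 0 -> g l j = 0.
  move=> /eqP; rewrite psumr_eq0 => [/allP/(_ j (mem_index_enum _))|*]; last by rewrite mulr_ge0.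
  by rewrite mulf_eq0 => /orP[/eqP-> /eqP|/eqP].
move=> /eqP; rewrite paddr_eq0// => /andP[/eqP lo /eqP upz] l j.
have [lk|kl] := leqP l k.
  apply: row0; move: lo => /eqP; rewrite big_mkord psumr_eq0 => [|l' _]; last first.
    by apply: sumr_ge0 => ? _; rewrite mulr_ge0.
  have lk1 : (l < k.+1)%N by [].
  by move/allP/(_ (Ordinal lk1) (mem_index_enum _))/eqP.
have [m e] : exists m, l = (k + m).+1 by exists (l - k).-1; lia.
subst l; apply: row0.
rewrite mg1_matrix_up.
have S0 : sums 0 (fun m => \sum_j up Q k m i j * g (k + m).+1 j) 0 by rewrite -[X in sums _ _ X]upz.
exact: (sums_eq0 t0 S0 m).
Qed.

Section Hitting.
Variables (k0 k1 : nat) (i0 : 'I_(lvl M0 M1 k0)) (i1 : 'I_(lvl M0 M1 k1)).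
Hypothesis ne01 : ind i0 i1 = 0.

(** The probability of reaching [i1] within [t] steps and before [i0]. *)
Fixpoint hit_by t : fn := if t is t'.+1 then
    fun k i => if ind i1 i == 1 then 1 else if ind i0 i == 1 then 0
               else pstep (hit_by t') i
  else ind i1.

Lemma hit_by01 t k (i : 'I_(lvl M0 M1 k)) : 0 <= hit_by t i <= 1.
Proof.
elim: t k i => [|t IH] k i /=; first exact: ind01.
case: ifP => _; first by rewrite ler01 lexx.
case: ifP => _; first by rewrite ler01 lexx.
have g1 : lingrow 1 (hit_by t).
  apply: (bounded_fn_lingrow i0) => l j; have /andP[? ?] := IH l j.
  by rewrite ger0_norm.
have c1 : lingrow (1 : R) ((fun _ _ => 1) : fn).
  by apply: (bounded_fn_lingrow i0) => l j; rewrite normr1.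
apply/andP; split.
  by apply: (pstep_ge0 _ g1) => // l j; have /andP[] := IH l j.
rewrite -[leRHS](step_cst P_stoch id 1 i); apply: (pstep_le _ g1 c1) => l j.
by have /andP[] := IH l j.
Qed.

Lemma hit_by_lingrow t : lingrow 1 (hit_by t).
Proof.
apply: (bounded_fn_lingrow i0) => l j; have /andP[? ?] := hit_by01 t j.
by rewrite ger0_norm.
Qed.

Lemma hit_by_le t k (i : 'I_(lvl M0 M1 k)) : hit_by t i <= hit_by t.+1 i.
Proof.
elim: t k i => [|t IH] k i.
  rewrite /=; case: ifP => [_|n1]; first by have /andP[] := ind01 i1 i.
  have -> : ind i1 i = 0 by move: n1; rewrite /ind; case: (_ && _); rewrite ?eqxx.
  case: ifP => // _; apply: (pstep_ge0 _ (hit_by_lingrow 0)) => //.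
rewrite /= -/(hit_by t) -/(hit_by t.+1); case: ifP => // _; case: ifP => // _.
exact: (pstep_le _ (hit_by_lingrow t) (hit_by_lingrow t.+1)).
Qed.

(** [q] is the increasing limit of [hit_by], the probability of reaching [i1]
    before [i0]. *)
Lemma hitting_probability : exists q : fn,
  [/\ forall k i, 0 <= q k i <= 1, q k1 i1 = 1, q k0 i0 = 0 &
      forall k i, ind i1 i != 1 -> ind i0 i != 1 -> q k i = pstep q i].
Proof.
pose q : fn := fun k i => limn (fun t => hit_by t i).
have qcv k i : (fun t => hit_by t i) @ \oo --> q k i.
  apply: nondecreasing_is_cvgn; first exact: (homo_leq (@lexx _ _) le_trans (fun t => hit_by_le t i)).
  by exists 1 => _ [t _ <-]; have /andP[] := hit_by01 t i.
have i10 : ind i1 i0 = 0.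
  by move: ne01; rewrite /ind eq_sym (eq_sym (i1 : nat)); case: (_ && _) => // /eqP; rewrite oner_eq0.
have step_q k i : (fun t => hit_by t.+1 i) @ \oo --> q k i.
  by rewrite (cvg_shiftS (fun t => hit_by t i)).
exists q; split.
- move=> k i; apply/andP; split.
    apply: (ler_cvg_to (cvg_cst 0) (qcv k i)); apply: nearW => t.
    by have /andP[] := hit_by01 t i.
  apply: (ler_cvg_to (qcv k i) (cvg_cst (1 : R))); apply: nearW => t.
  by have /andP[] := hit_by01 t i.
- apply: (cvg_unique _ (step_q _ i1)) => //=.
  by under eq_fun do rewrite ind_self eqxx; exact: cvg_cst.
- apply: (cvg_unique _ (step_q _ i0)) => //=.
  under eq_fun do rewrite i10 ind_self eqxx eq_sym oner_eq0; exact: cvg_cst.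
move=> k i /negbTE n1 /negbTE n0; apply: (cvg_unique _ (step_q _ i)) => //=.
under eq_fun do rewrite n1 n0.
exact: (@step_cvg _ _ _ _ P_stoch A_mean B_mean id hit_by q 1 k i id_capped hit_by_lingrow qcv).
Qed.

End Hitting.

Hypothesis P_irr : irreducible (mg1_matrix Q).
Variables (k0 : nat) (i0 : 'I_(lvl M0 M1 k0)).

(** Charges equivalent to a multiple of the unit charge at [i0], modulo the
    image of the bounded functions under [1 - P]. *)
Definition reducible b := exists w C kap,
  bounded_fn C w /\ forall k i, w k i - pstep w i = b k i - kap * ind i0 i.

(** For the probability [q] of reaching [i1] before [i0], the charge [q - P q] is
    carried by [i1] and [i0]; its value [al] at [i1] is the probability of not
    returning to [i1] before [i0], which is nonzero by irreducibility. *)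
Lemma reducible_ind k1 (i1 : 'I_(lvl M0 M1 k1)) : reducible (ind i1).
Proof.
have [n01|e01] := eqVneq (ind i0 i1) 0; last first.
  have := ind_neq0 e01 => /eqP e; have ek := congr1 (@projT1 _ _) (eqP e).
  exists (fun _ _ => 0), 0, 1; split=> [k i|k i]; first by rewrite normr0.
  rewrite (step_cst P_stoch) subrr mul1r.
  suff -> : ind i1 i = ind i0 i by rewrite subrr.
  rewrite /= in ek; subst k1.
  move: e01; rewrite /ind eqxx /=; case: ((i1 : nat) =P _) => [->//|_] /=; by rewrite eqxx.
have [q [q01 q1 q0 qh]] := hitting_probability n01.
have qlin : lingrow 1 q.
  apply: (bounded_fn_lingrow i0) => l j; have /andP[? ?] := q01 l j.
  by rewrite ger0_norm.
pose al := 1 - pstep q i1; pose be := - pstep q i0.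
have qE k i : q k i - pstep q i = al * ind i1 i + be * ind i0 i.
  have [e1|n1] := eqVneq (ind i1 i) 1.
    have /ind_neq0 e : ind i1 i != 0 by rewrite e1 oner_neq0.
    have ek := congr1 (@projT1 _ _) e; rewrite /= in ek; subst k.
    have {e} -> : i = i1.
      move: e1; rewrite /ind eqxx /=; case: ((i : nat) =P _) => [/val_inj//|_ /eqP].
      by rewrite eq_sym oner_eq0.
    by rewrite q1 ind_self n01 mulr0 addr0 mulr1.
  have -> : ind i1 i = 0 by move: n1; rewrite /ind; case: (_ && _); rewrite ?eqxx.
  have [e1|n0] := eqVneq (ind i0 i) 1.
    have /ind_neq0 e : ind i0 i != 0 by rewrite e1 oner_neq0.
    have ek := congr1 (@projT1 _ _) e; rewrite /= in ek; subst k.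
    have {e} -> : i = i0.
      move: e1; rewrite /ind eqxx /=; case: ((i : nat) =P _) => [/val_inj//|_ /eqP].
      by rewrite eq_sym oner_eq0.
    by rewrite q0 ind_self mulr0 add0r mulr1 sub0r.
  have -> : ind i0 i = 0 by move: n0; rewrite /ind; case: (_ && _); rewrite ?eqxx.
  by rewrite -qh// subrr !mulr0 addr0.
have al0 : al != 0.
  apply/negP => /eqP al0.
  (* Otherwise [q = 1] on a set containing [i1], closed under [P] and missing [i0]. *)
  have Tc k i l j : q k i = 1 -> mg1_matrix Q k l i j != 0 -> q l j = 1.
    move=> qki P0; have n0 : ind i0 i = 0.
      apply/eqP/negPn/negP => /ind_neq0 e.
      have ek := congr1 (@projT1 _ _) e; rewrite /= in ek; subst k.
      have e' : i = i0 by exact: (eq_from_Tagged e).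
      by move: qki; rewrite e' q0 => /eqP; rewrite eq_sym oner_eq0.
    have := qE k i; rewrite al0 n0 mul0r mulr0 addr0 qki => /eqP.
    rewrite subr_eq0 => /eqP q1'.
    have c1 : lingrow (1 : R) ((fun _ _ => 1) : fn).
      by apply: (bounded_fn_lingrow i0) => l' j'; rewrite normr1.
    suff : 1 * 1 + -1 * q l j = 0 by lra.
    apply: (@pstep_eq0 (fun k i => 1 * 1 + -1 * q k i) 1 k i _ _ _ l j P0).
    - apply: (bounded_fn_lingrow i0) => k' i'; have /andP[? ?] := q01 k' i'.
      by rewrite /= mul1r mulN1r ger0_norm; lra.
    - move=> k' i'; have /andP[? ?] := q01 k' i'; lra.
    - by rewrite (pstep_lin _ _ _ c1 qlin) (step_cst P_stoch) -q1'; ring.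
  have := irreducible_closed P_irr Tc q1 i0.
  by rewrite q0 => /eqP; rewrite eq_sym oner_eq0.
exists (fun k i => al^-1 * q k i + 0 * q k i), `|al^-1|, (- (al^-1 * be)); split.
  move=> k i; rewrite mul0r addr0 normrM; have /andP[? ?] := q01 k i.
  by rewrite ler_piMr// ger0_norm.
move=> k i; rewrite (pstep_lin _ _ _ qlin qlin) !mul0r !addr0 -mulrBr qE.
by rewrite mulrDr mulrA mulVf// mul1r; ring.
Qed.

Lemma reducible_lin b1 b2 c1 c2 : reducible b1 -> reducible b2 ->
  reducible (fun k i => c1 * b1 k i + c2 * b2 k i).
Proof.
move=> [w1 [C1 [kap1 [w1C w1E]]]] [w2 [C2 [kap2 [w2C w2E]]]].
exists (fun k i => c1 * w1 k i + c2 * w2 k i), (`|c1| * C1 + `|c2| * C2), (c1 * kap1 + c2 * kap2).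
split=> k i.
  apply: le_trans (ler_normD _ _) _; rewrite !normrM.
  by apply: lerD; rewrite ler_wpM2l.
rewrite (pstep_lin _ _ _ (bounded_fn_lingrow i0 w1C) (bounded_fn_lingrow i0 w2C)).
have -> : c1 * w1 k i + c2 * w2 k i - (c1 * pstep w1 i + c2 * pstep w2 i) =
  c1 * (w1 k i - pstep w1 i) + c2 * (w2 k i - pstep w2 i) by ring.
rewrite w1E w2E; ring.
Qed.

Lemma reducible_ext b1 b2 : (forall k i, b1 k i = b2 k i) -> reducible b1 -> reducible b2.
Proof.
move=> e [w [C [kap [wC wE]]]]; exists w, C, kap; split=> // k i.
by rewrite wE e.
Qed.

Lemma reducible0 : reducible (fun _ _ => 0).
Proof.
exists (fun _ _ => 0), 0, 0; split=> k i; first by rewrite normr0.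
by rewrite (step_cst P_stoch) mul0r !subr0.
Qed.

Lemma reducible_sum (I : Type) (r : seq I) (b : I -> fn) :
  (forall x, reducible (b x)) -> reducible (fun k i => \sum_(x <- r) b x k i).
Proof.
move=> bred; elim: r => [|x r IH].
  by apply: reducible_ext reducible0 => k i; rewrite big_nil.
apply: reducible_ext (reducible_lin 1 1 (bred x) IH) => k i.
by rewrite big_cons !mul1r.
Qed.

Lemma reducible_finsupp L b : finsupp L b -> reducible b.
Proof.
move=> bL.
apply: (@reducible_ext (fun k i => \sum_(l <- index_iota 0 L) \sum_j b l j * ind j i)).
  move=> k i; have [kL|Lk] := ltnP k L; last first.
    rewrite bL// big_nat_cond big1// => l; rewrite andbT /= => lL.
    apply: big1 => j _; rewrite /ind (gtn_eqF (leq_trans lL Lk)) mulr0//.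
  rewrite (big_mkord xpredT (fun l => \sum_j b l j * ind j i)).
  rewrite (bigD1 (Ordinal kL))//= (bigD1 i)//= ind_self mulr1.
  rewrite [X in _ + X + _]big1 ?addr0 => [|j ji]; last first.
    by rewrite /ind eqxx /= (negbTE (_ : (i != j :> nat)))  ?mulr0// eq_sym.
  rewrite big1 ?addr0// => l lk; apply: big1 => j _.
  by rewrite /ind (negbTE (_ : k != l)) ?mulr0//; apply: contra lk => /eqP e; apply/eqP/val_inj.
apply: reducible_sum => l; apply: reducible_sum => j.
apply: (reducible_ext _ (reducible_lin (b l j) 0 (reducible_ind j) reducible0)) => k i.
by rewrite mul0r addr0.
Qed.

End Operator.
End Poisson.

(** * Finite stochastic matrices *)

Section Semigroup.

(** The least positive difference [d] of two elements divides every element, as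
    reducing modulo [d] would give a smaller difference; so [d = 1]. Once [b] and
    [b + 1] are in the set, each [n >= b * b] is a sum of [n %/ b] copies of them. *)
Lemma semigroup_large (S : nat -> Prop) :
  S 0%N -> (forall a b, S a -> S b -> S (a + b)%N) ->
  (forall c, (forall p, (0 < p)%N -> S p -> (c %| p)%N) -> (c %| 1)%N) ->
  exists N, forall n, (N <= n)%N -> S n.
Proof.
move=> S0 SD Sgcd.
have SM k a : S a -> S (k * a)%N.
  by move=> Sa; elim: k => [|k IH]; rewrite ?mul0n// mulSn; exact: SD.
have [p [p0 Sp]] : exists p, (0 < p)%N /\ S p.
  apply: contrapT => nS.
  suff : (2 %| 1)%N by [].
  by apply: Sgcd => p p0 Sp; case: nS; exists p.
pose gap := [pred d | (0 < d)%N && `[< exists b, S b /\ S (b + d)%N >]].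
have gap_ex : exists d, gap d.
  by exists p; rewrite /= p0; apply/asboolP; exists 0%N.
case: (ex_minnP gap_ex) => d /= /andP[d0 /asboolP[b [Sb Sbd]]] dmin.
have d1 : d = 1%N.
  apply/eqP; rewrite -dvdn1; apply: Sgcd => q q0 Sq.
  apply/negPn/negP => ndq.
  have : (d <= q %% d)%N.
    apply: dmin; rewrite lt0n ndq/=; apply/asboolP.
    exists (q %/ d * (b + d))%N; split; first exact: SM.
    have -> : (q %/ d * (b + d) + q %% d = q + q %/ d * b)%N.
      rewrite {3}(divn_eq q d); lia.
    by apply: SD => //; exact: SM.
  by rewrite leqNgt ltn_mod d0.
subst d; exists (b * b)%N => n bn.
have [b0|b0] := posnP b.
  by subst b; rewrite -(muln1 n); apply: SM.
have tb : (b <= n %/ b)%N by rewrite leq_divRL.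
have rb : (n %% b < b)%N by rewrite ltn_mod.
have -> : (n = (n %/ b - n %% b) * b + n %% b * (b + 1))%N.
  rewrite {1}(divn_eq n b) mulnBl mulnDr muln1 addnA subnK//.
  by rewrite leq_mul2r (ltnW (leq_trans rb tb)) orbT.
by apply: SD; apply: SM.
Qed.

End Semigroup.

Section Finite.
Variables (R : realType) (n : nat).
Implicit Types (M : 'M[R]_n) (x : 'cV[R]_n).

Lemma exp_mxS M p i j : (M ^+ p.+1) i j = \sum_k M i k * (M ^+ p) k j.
Proof. by rewrite exprS mxE. Qed.

Lemma exp_mxD M p q i j : (M ^+ (p + q)) i j = \sum_k (M ^+ p) i k * (M ^+ q) k j.
Proof. by rewrite exprD mxE. Qed.

Lemma exp_mx0 M i j : (M ^+ 0) i j = (i == j)%:R.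
Proof. by rewrite expr0 mxE. Qed.

Lemma fstochastic_exp M p : fstochastic M -> fstochastic (M ^+ p).
Proof.
move=> [M0 M1]; elim: p => [|p [IH0 IH1]]; split=> [i j|i].
- by rewrite exp_mx0 ler0n.
- under eq_bigr do rewrite exp_mx0.
  by rewrite (bigD1 i)//= eqxx big1 ?addr0// => j /negbTE; rewrite eq_sym => ->.
- by rewrite exp_mxS sumr_ge0// => k _; rewrite mulr_ge0.
under eq_bigr do rewrite exp_mxS.
rewrite exchange_big/= -[RHS](M1 i); apply: eq_bigr => k _.
by rewrite -mulr_sumr IH1 mulr1.
Qed.

Lemma leads_to_refl M i : leads_to M i i.
Proof. by exists 0%N; rewrite exp_mx0 eqxx ltr01. Qed.

Lemma leads_to_trans M i j k : (forall p i j, 0 <= (M ^+ p) i j) ->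
  leads_to M i j -> leads_to M j k -> leads_to M i k.
Proof.
move=> M0 [p ij] [q jk]; exists (p + q)%N; rewrite exp_mxD.
rewrite (bigD1 j)//=; apply: ltr_pwDl; first exact: mulr_gt0.
by apply: sumr_ge0 => l _; rewrite mulr_ge0.
Qed.

Lemma leads_to_closed M (T : 'I_n -> Prop) :
  (forall i j, T i -> M i j != 0 -> T j) ->
  forall i j, leads_to M i j -> T i -> T j.
Proof.
move=> Tc i j [p /lt0r_neq0]; elim: p i => [|p IH] i.
  by rewrite exp_mx0; case: (i =P j) => [->//|_]; rewrite eqxx.
rewrite exp_mxS => s0 Ti.
have [k /negP] : exists k, ~ (M i k * (M ^+ p) k j == 0).
  apply: contrapT => nk; move/eqP: s0; apply; apply: big1 => k _.
  by apply/eqP/negPn/negP => H; apply: nk; exists k; exact/negP.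
rewrite mulf_eq0 negb_or => /andP[ik kj]; exact: IH kj (Tc _ _ Ti ik).
Qed.

(** The set where [x] attains its maximum is closed under [M]. *)
Lemma harmonic_const M x : fstochastic M -> firreducible M -> M *m x = x ->
  forall i j, x i 0 = x j 0.
Proof.
move=> [M0 M1] Mirr Mx; suff H (i : 'I_n) : exists k, forall j, x j 0 = x k 0.
  by move=> i j; have [k Hk] := H i; rewrite !Hk.
have [k _ kmax] := Order.TotalTheory.arg_maxP (P := xpredT) (i0 := i) (fun i => x i 0) erefl.
exists k => j.
apply: (leads_to_closed (T := fun j => x j 0 = x k 0) _ (Mirr k j)) => // {}i {}j ik ij.
have : \sum_l M i l * (x k 0 - x l 0) = 0.
  under eq_bigr do rewrite mulrBr.
  rewrite sumrB -mulr_suml M1 mul1r -ik -{1}Mx mxE subrr//.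
move/eqP; rewrite psumr_eq0 => [/allP/(_ j (mem_index_enum _))|l _]; last first.
  by rewrite mulr_ge0// subr_ge0; exact: kmax.
by rewrite mulf_eq0 (negbTE ij)/= subr_eq0 => /eqP.
Qed.

(** Fredholm alternative: the left kernel of [1 - A] is spanned by the stationary
    vector, because its right kernel consists of constants. *)
Lemma poisson_finite (A : 'M[R]_n) (varpi : 'rV[R]_n) (b : 'cV[R]_n) :
  fstochastic A -> firreducible A -> fstationary A varpi -> varpi *m b = 0 ->
  exists a : 'cV[R]_n, a - A *m a = b.
Proof.
move=> Ast Airr [v0 v1 vA] vb.
pose B := (1%:M - A)^T.
have kerB : (kermx B <= (const_mx 1 : 'rV[R]_n))%MS.
  apply/row_subP => i; set u := row i _.
  have uB : u *m B = 0 by apply/sub_kermxP; exact: row_sub.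
  have Au : A *m u^T = u^T.
    apply/esym/eqP; rewrite -subr_eq0 -{1}[u^T]mul1mx -mulmxBl.
    by rewrite -[_ *m _]trmxK trmx_mul trmxK uB trmx0.
  have uc := harmonic_const Ast Airr Au.
  apply/sub_rVP; have [n0|n0] := posnP n.
    exists 0; apply/rowP => j; exfalso.
    by have := leq_ltn_trans (leq0n j) (ltn_ord j); rewrite n0.
  exists (u 0 (Ordinal n0)); apply/rowP => j; rewrite !mxE mulr1.
  by have := uc j (Ordinal n0); rewrite !mxE.
have rB : (n - 1 <= \rank B)%N.
  have := mxrankS kerB; rewrite mxrank_ker => H.
  have := rank_leq_row (const_mx 1 : 'rV[R]_n); lia.
have vker : (varpi <= kermx (1%:M - A))%MS.
  by apply/sub_kermxP; rewrite mulmxBr mulmx1 vA subrr.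
have vneq0 : varpi != 0.
  apply/eqP => v00; move: v1; rewrite v00.
  under eq_bigr do rewrite mxE.
  by rewrite big1// => /eqP; rewrite eq_sym oner_eq0.
have kerv : (kermx (1%:M - A) <= varpi)%MS.
  rewrite -(geq_leqif (mxrank_leqif_sup vker)) mxrank_ker.
  by rewrite rank_rV vneq0 -mxrank_tr -/B; lia.
have : (b^T <= B)%MS.
  rewrite submxE; apply/eqP.
  have : ((cokermx B)^T <= varpi)%MS.
    apply: submx_trans kerv; apply/sub_kermxP.
    by rewrite -[LHS]trmxK trmx_mul trmxK -/B mulmx_coker trmx0.
  case/submxP => D cD; rewrite -[cokermx B]trmxK cD trmx_mul.
  by rewrite mulmxA -trmx_mul vb trmx0 mul0mx.
case/submxP => D bD; exists D^T.
rewrite -{1}[D^T]mul1mx -mulmxBl.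
by rewrite -[RHS]trmxK bD trmx_mul trmxK.
Qed.

Section Powers.
Variables (M : 'M[R]_n).
Hypothesis M_stoch : fstochastic M.

Lemma stochastic_between x lo hi : (forall i, lo <= x i 0 <= hi) ->
  forall p i, lo <= (M ^+ p *m x) i 0 <= hi.
Proof.
move=> xb p i; have [M0 M1] := fstochastic_exp p M_stoch.
rewrite mxE; apply/andP; split.
  rewrite -[leLHS]mul1r -(M1 i) mulr_suml; apply: ler_sum => j _.
  by have /andP[? ?] := xb j; rewrite ler_wpM2l.
rewrite -[leRHS]mul1r -(M1 i) mulr_suml; apply: ler_sum => j _.
by have /andP[? ?] := xb j; rewrite ler_wpM2l.
Qed.

Variables (p0 : nat) (j0 : 'I_n) (delta : R).
Hypothesis delta_gt0 : 0 < delta.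
Hypothesis minor : forall i, delta <= (M ^+ p0) i j0.

Lemma delta_le1 : delta <= 1.
Proof.
have [M0 M1] := fstochastic_exp p0 M_stoch.
apply: le_trans (minor j0) _; rewrite -(M1 j0) (bigD1 j0)//= lerDl.
by apply: sumr_ge0.
Qed.

(** The mass [delta] put on [j0] contributes equally from all states; only the
    remaining mass [1 - delta] sees the range of [x]. *)
Lemma doeblin_step x lo hi : (forall i, lo <= x i 0 <= hi) -> exists lo' hi',
  hi' - lo' = (1 - delta) * (hi - lo) /\
  forall i, lo' <= (M ^+ p0 *m x) i 0 <= hi'.
Proof.
move=> xb; have [M0 M1] := fstochastic_exp p0 M_stoch.
exists (delta * x j0 0 + (1 - delta) * lo), (delta * x j0 0 + (1 - delta) * hi).
split=> [|i]; first by ring.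
pose q j := (M ^+ p0) i j - delta * (j == j0)%:R.
have q0 j : 0 <= q j.
  rewrite /q; case: eqP => [->|_]; first by rewrite mulr1 subr_ge0.
  by rewrite mulr0 subr0.
have q1 : \sum_j q j = 1 - delta.
  rewrite sumrB M1 -mulr_sumr (bigD1 j0)//= eqxx big1 ?addr0 ?mulr1//.
  by move=> j /negbTE->.
have E : (M ^+ p0 *m x) i 0 = delta * x j0 0 + \sum_j q j * x j 0.
  rewrite mxE; under [X in _ = _ + X]eq_bigr do rewrite mulrBl.
  rewrite sumrB addrC -addrA [X in _ + X](_ : _ = 0) ?addr0//.
  apply/eqP; rewrite addrC subr_eq0 (bigD1 j0)//= eqxx mulr1 big1 ?addr0//.
  by move=> j /negbTE->; rewrite mulr0 mul0r.
rewrite E -q1 !mulr_suml !lerD2l; apply/andP; split; apply: ler_sum => j _;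
  by have /andP[? ?] := xb j; rewrite ler_wpM2l.
Qed.

Lemma doeblin_iter x lo hi t : (forall i, lo <= x i 0 <= hi) -> exists lo' hi',
  hi' - lo' = (1 - delta) ^+ t * (hi - lo) /\
  forall m i, (p0 * t <= m)%N -> lo' <= (M ^+ m *m x) i 0 <= hi'.
Proof.
elim: t x lo hi => [|t IH] x lo hi xb.
  by exists lo, hi; split=> [|m i _]; [rewrite expr0 mul1r | exact: stochastic_between].
have [lo1 [hi1 [w1 b1]]] := doeblin_step xb.
have [lo2 [hi2 [w2 b2]]] := IH _ _ _ b1.
exists lo2, hi2; split=> [|m i pm]; first by rewrite w2 w1 mulrA -exprSr.
have pm' : (p0 * t <= m - p0)%N by rewrite mulnS in pm; lia.
have := b2 (m - p0)%N i pm'.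
rewrite mulmxA; have -> : M ^+ (m - p0) *m M ^+ p0 = M ^+ m.
  have -> : m = (m - p0 + p0)%N by rewrite mulnS in pm; lia.
  by rewrite exprD addnK.
by [].
Qed.

Lemma powers_cvg x : exists L, forall e, 0 < e -> exists N, forall m i, (N <= m)%N ->
  `|(M ^+ m *m x) i 0 - L| <= e.
Proof.
pose B : R := \sum_i `|x i 0|.
have xB i : - B <= x i 0 <= B.
  by rewrite -ler_norml /B (bigD1 i)//= lerDl sumr_ge0.
have H (e : R) : 0 < e -> exists N, exists lo hi, hi - lo <= e /\
    forall m i, (N <= m)%N -> lo <= (M ^+ m *m x) i 0 <= hi.
  move=> e0.
  have geo : (fun t => (1 - delta) ^+ t * (B - - B)) @ \oo --> (0 : R).
    rewrite -[X in _ --> X](mul0r (B - - B)); apply: cvgMr_tmp.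
    apply: cvg_expr; have d1 := delta_le1; have d0 := delta_gt0; rewrite ger0_norm; lra.
  have /cvgn_epsP/(_ e e0)[t /(_ t (leqnn t))] := geo.
  rewrite subr0 => Ht.
  have [lo [hi [w b]]] := doeblin_iter t xB.
  exists (p0 * t)%N, lo, hi; split=> //.
  by rewrite w (le_trans (ler_norm _)).
have : cvgn (fun m => (M ^+ m *m x) j0 0).
  apply: cauchy_cvg; apply: cauchy_exP => e e0.
  have e2 : 0 < e / 2 by rewrite divr_gt0.
  have [N [lo [hi [w b]]]] := H _ e2.
  exists lo; exists N => // m /= Nm; rewrite /ball/=.
  have /andP[? ?] := b _ j0 Nm.
  rewrite ltr_norml; apply/andP; split; lra.
case/cvg_ex => L /cvgn_epsP HL; exists L => e e0.
have e2 : 0 < e / 2 by rewrite divr_gt0.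
have [N [lo [hi [w b]]]] := H _ e2; have [N' HN'] := HL _ e2.
exists (maxn N N') => m i; rewrite geq_max => /andP[Nm N'm].
have /andP[? ?] := b _ i Nm; have /andP[? ?] := b _ j0 Nm.
have := HN' _ N'm; rewrite !ler_norml => /andP[? ?]; apply/andP; split; lra.
Qed.

End Powers.

(** All large numbers are return times of [j0], so for a large common exponent
    [j0] is reached with positive probability from all states: this is Doeblin's
    condition. *)
Lemma aperiodic_powers_cvg (M : 'M[R]_n) (j0 : 'I_n) : fstochastic M ->
  (forall i, leads_to M i j0) -> has_period M j0 1 ->
  forall x, exists L, forall e, 0 < e -> exists N, forall m i, (N <= m)%N ->
  `|(M ^+ m *m x) i 0 - L| <= e.
Proof.
move=> Mst to0 [_ per]; have Mp p := fstochastic_exp p Mst.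
have M0 p i j : 0 <= (M ^+ p) i j by have [] := Mp p.
have prod_gt0 p q i j k : 0 < (M ^+ p) i j -> 0 < (M ^+ q) j k -> 0 < (M ^+ (p + q)) i k.
  move=> ij jk; rewrite exp_mxD (bigD1 j)//=; apply: ltr_pwDl; first exact: mulr_gt0.
  by apply: sumr_ge0 => l _; rewrite mulr_ge0.
have [N HN] : exists N, forall m, (N <= m)%N -> 0 < (M ^+ m) j0 j0.
  apply: semigroup_large; first by rewrite exp_mx0 eqxx ltr01.
    by move=> a b; exact: prod_gt0.
  by move=> c cS; apply: per => p; exact: cS.
have [q qP] := choice to0.
pose p := (\max_i q i + N)%N.
have pos i : 0 < (M ^+ p) i j0.
  have qi : (q i <= \max_i q i)%N by exact: leq_bigmax.
  have -> : p = (q i + (p - q i))%N by rewrite /p; lia.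
  apply: prod_gt0 (qP i) _; apply: HN; rewrite /p; lia.
have [k _ kmin] := Order.TotalTheory.arg_minP (P := xpredT) (i0 := j0) (fun i => (M ^+ p) i j0) erefl.
by apply: (powers_cvg Mst (pos k)) => i; exact: kmin.
Qed.

(** Among the states that [i0] leads to, take one that leads to as few states as
    possible. *)
Lemma exists_closed_class (M : 'M[R]_n) (i0 : 'I_n) :
  (forall p i j, 0 <= (M ^+ p) i j) ->
  exists2 i, leads_to M i0 i & closed_class M [set j | `[< leads_to M i j >]]%SET.
Proof.
move=> M0; pose reach i := [set j | `[< leads_to M i j >]]%SET.
have P0 : [pred i | `[< leads_to M i0 i >]] i0 by apply/asboolP; exact: leads_to_refl.
have [i /asboolP i0i imin] := arg_minnP (fun i => #|reach i|) P0.
exists i => //; split.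
  by apply/set0Pn; exists i; rewrite inE; apply/asboolP; exact: leads_to_refl.
move=> j; rewrite inE => /asboolP ij k; rewrite inE.
have sub : reach j \subset reach i.
  apply/fintype.subsetP => l; rewrite inE => /asboolP jl; rewrite inE; apply/asboolP.
  exact: (leads_to_trans M0 ij jl).
have /eqP E : reach j == reach i.
  rewrite eqEcard sub imin//; apply/asboolP; exact: (leads_to_trans M0 i0i ij).
have : (k \in reach j) = (k \in reach i) by rewrite E.
rewrite inE [in RHS]inE => <-; exact: (iff_sym (rwP (asboolP _))).
Qed.

End Finite.

(** * The free walk above the boundary *)

Section FreeWalk.
Variables (R : realType) (M0 M1 : nat).
Notation fn := (fn R M0 M1).
Variable Q : mg1 R M0 M1.
Hypothesis P_stoch : stochastic (mg1_matrix Q).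
Hypothesis A_mean : forall i, finite_mean (fun m => rowsum (blkA Q m) i).
Hypothesis B_mean : forall i, finite_mean (fun m => rowsum (blkB Q m) i).
Hypothesis A_stoch : fstochastic (Asum Q).

Notation pstep := (step Q id).
Let id_capped : capped id. Proof. by []. Qed.

Lemma blkA_ge0 m i j : 0 <= blkA Q m i j.
Proof. by have [/(_ 1%N m.+1 i j)] := P_stoch; rewrite /= subn0. Qed.

Lemma blkAm_ge0 i j : 0 <= blkAm Q i j.
Proof. by have [/(_ 2%N 1%N i j)] := P_stoch. Qed.

Lemma sums_blkA i j : sums 0 (fun m => blkA Q m i j) (mx_sum 0 (blkA Q) i j).
Proof.
rewrite mxE; apply: sumsP; eexists; apply/(sums_split 1 _ (leq0n 1)).
have S := finite_mean_sums_pos 0 (finite_mean_entry (fun k i j _ => blkA_ge0 k i j) j (A_mean i)).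
rewrite [X in sums _ _ X](_ : _ = rsum 1 (fun m => blkA Q m i j)); first exact: S.
exact: addrK.
Qed.

Lemma sums_rowsum_blkA i :
  sums 0 (fun m => rowsum (blkA Q m) i) (1 - rowsum (blkAm Q) i).
Proof.
have -> : 1 - rowsum (blkAm Q) i = \sum_j mx_sum 0 (blkA Q) i j.
  have [_ /(_ i)] := A_stoch; rewrite /Asum.
  under eq_bigr do rewrite mxE.
  by rewrite big_split/= => <-; rewrite /rowsum [X in X - _]addrC addrK.
by apply: sums_big => j; exact: sums_blkA.
Qed.

Arguments sums_blkA i j : clear implicits.
Arguments sums_rowsum_blkA i : clear implicits.

(** Rewriting the level in [g p.+1 j] is blocked by the type of [j]. *)
Lemma eq_fn_level (g : fn) p q (j : 'I_M1) : p = q -> g p.+1 j = g q.+1 j.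
Proof. by move->. Qed.

Lemma step_inner (g : fn) C n (i : 'I_M1) : lingrow C g ->
  sums 0 (fun m => \sum_j blkA Q m i j * g (n.+2 + m)%N j)
   (step Q id g (k := n.+2) i - \sum_j blkAm Q i j * g n.+1 j).
Proof.
move=> gC.
have S := step_summable P_stoch A_mean B_mean (i : 'I_(lvl M0 M1 n.+2)) id_capped gC.
apply/(sums_split 1 _ (leq0n 1)); rewrite big_nat1.
apply/sums_shift.
have E : step Q id g (k := n.+2) i = \sum_j blkAm Q i j * g n.+1 j +
    \sum_j blkA Q 0 i j * g n.+2 j +
    rsum 0 (fun m => \sum_j up Q n.+2 m i j * g (n.+2 + m).+1 j).
  pose F l := \sum_j mg1_matrix Q n.+2 l i j * g l j.
  rewrite /step; congr (_ + _).
  have F1 : F n.+1 = \sum_j blkAm Q i j * g n.+1 j.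
    by apply: eq_bigr => j _ /=; rewrite ltnn eqxx.
  have F2 : F n.+2 = \sum_j blkA Q 0 i j * g n.+2 j.
    by apply: eq_bigr => j _ /=; rewrite leqnn subnn.
  rewrite -F1 -F2 -[LHS]/(\sum_(0 <= l < n.+3) F l) big_nat_recr// big_nat_recr//= big_nat_cond big1 ?add0r// => l.
  rewrite andbT /= => ln; rewrite /F big1// => j _.
  by rewrite mg1_matrix_low ?mxE ?mul0r.
have -> : step Q id g (k := n.+2) i - \sum_j blkAm Q i j * g n.+1 j -
    \sum_j blkA Q 0 i j * g (n.+2 + 0)%N j =
    rsum 0 (fun m => \sum_j up Q n.+2 m i j * g (n.+2 + m).+1 j).
  under [X in _ - X]eq_bigr do rewrite (eq_fn_level g _ (addn0 n.+1)).
  rewrite E; ring.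
apply: (eq_sums _ S) => m _; apply: eq_bigr => j _.
by rewrite addn1 (eq_fn_level g _ (addnS n.+1 m)).
Qed.

Arguments step_inner {g C} n i _.

(** Level [0] gets the value [0]: it is not reached in one step from the levels
    above [1], the only ones where [step] is applied to these functions. *)
Definition on_levels (y : nat -> 'cV[R]_M1) : fn := fun k =>
  match k return 'I_(lvl M0 M1 k) -> R with
  | 0 => fun _ => 0 | n.+1 => fun j => y n j 0 end.

Arguments on_levels y k i : clear implicits.

Definition bounded_by B (y : nat -> 'cV[R]_M1) := forall n i, `|y n i 0| <= B.

(** Harmonicity for the walk with increments [A_m], stopped when it leaves the
    levels above [0]. *)
Definition free_harmonic (y : nat -> 'cV[R]_M1) := forall n i,
  sums 0 (fun m => \sum_j blkA Q m i j * y (n.+1 + m)%N j 0)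
    (y n.+1 i 0 - \sum_j blkAm Q i j * y n j 0).

Lemma on_levels_lingrow B y : 0 <= B -> bounded_by B y -> lingrow B (on_levels y).
Proof.
move=> B0 yB [|n] i /=; first by rewrite normr0 mulr_ge0 ?ler0n.
by apply: le_trans (yB n i) _; rewrite ler_peMr ?ler1n.
Qed.

Lemma harmonic_step B y n (i : 'I_M1) : 0 <= B -> bounded_by B y -> free_harmonic y ->
  step Q id (on_levels y) (k := n.+2) i = y n.+1 i 0.
Proof.
move=> B0 yB yh; have H := step_inner n i (on_levels_lingrow B0 yB).
have := sums_unique H (yh n i).
by move/(congr1 (fun x => x + \sum_j blkAm Q i j * y n j 0)); rewrite !subrK.
Qed.

Lemma harmonicB y y' : free_harmonic y -> free_harmonic y' -> free_harmonic (fun n => y n - y' n).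
Proof.
move=> yh y'h n i; have := sumsB (yh n i) (y'h n i).
rewrite [X in sums _ _ X](_ : _ = (y n.+1 - y' n.+1) i 0 -
    \sum_j blkAm Q i j * (y n - y' n) j 0); last first.
  rewrite !mxE; under [X in _ = _ - X]eq_bigr do rewrite !mxE mulrDr mulrN.
  rewrite sumrB; ring.
apply: eq_sums => m _; rewrite -sumrB; apply: eq_bigr => j _.
by rewrite !mxE mulrBr.
Qed.

Lemma harmonic_cst (c : R) : free_harmonic (fun=> const_mx c).
Proof.
move=> n i; have := sumsZr c (sums_rowsum_blkA i).
rewrite [X in sums _ _ X](_ : _ = (const_mx c : 'cV[R]_M1) i 0 -
    \sum_j blkAm Q i j * (const_mx c : 'cV[R]_M1) j 0); last first.
  rewrite mxE mulrBl mul1r mulr_suml; congr (_ - _).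
  by apply: eq_bigr => j _; rewrite mxE.
by apply: eq_sums => m _; rewrite mulr_suml; apply: eq_bigr => j _; rewrite mxE.
Qed.

Arguments harmonic_cst c : clear implicits.

Section LinearFunction.
Variables (s : R) (a : 'cV[R]_M1).
Hypothesis s_gt0 : 0 < s.
Hypothesis a_eq : forall i, a i 0 - (Asum Q *m a) i 0 = 1 + s * mA Q i 0.

(** The height divided by the speed of descent, corrected by [a] according to the
    phase: every step of the free walk decreases it by exactly [1] in mean. *)
Definition ell : fn := on_levels (fun n => \col_j (s * n.+1%:R + a j 0)).

Arguments ell k i : clear implicits.

Lemma ell_lingrow : lingrow (s + \sum_i `|a i 0|) ell.
Proof.
have a0 : 0 <= \sum_i `|a i 0| by rewrite sumr_ge0.
have s0 := ltW s_gt0.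
move=> [|n] i /=; first by rewrite normr0 mulr1 addr_ge0.
rewrite mxE mulrDl; apply: le_trans (ler_normD _ _) _; apply: lerD.
  by rewrite normrM !ger0_norm ?ler0n// ler_wpM2l// ler_nat.
apply: (@le_trans _ _ (\sum_i `|a i 0|)); last by rewrite ler_peMr ?ler1n.
by rewrite (bigD1 i)//= lerDl sumr_ge0.
Qed.

Lemma ell_step n (i : 'I_M1) : ell n.+2 i - step Q id ell (k := n.+2) i = 1.
Proof.
have H := step_inner n i ell_lingrow.
have S0 := sumsZ (s * n.+2%:R) (sums_rowsum_blkA i).
have k0 k : (0 <= k)%N -> `|k%:R : R| <= k%:R by rewrite ger0_norm.
have S1 := sumsZ s (finite_mean_sums (A_mean i) k0).
have S2 := @sums_big R _ (index_enum 'I_M1) 0 _ _ (fun j => sumsZr (a j 0) (sums_blkA i j)).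
have := sumsD (sumsD S0 S1) S2.
have E m : s * n.+2%:R * rowsum (blkA Q m) i + s * (m%:R * rowsum (blkA Q m) i) +
   \sum_j blkA Q m i j * a j 0 = \sum_j blkA Q m i j * ell (n.+2 + m)%N j.
  rewrite -mulrA -mulrDr -mulrDl -natrD mulrA mulr_sumr -big_split/=.
  apply: eq_bigr => j _; rewrite mxE addSn; ring.
move=> /(eq_sums (fun m _ => E m))/(sums_unique H).
rewrite -(rowsum_mean A_mean).
rewrite -/(mAplus Q) => {}H.
have mAE : mA Q i 0 = - rowsum (blkAm Q) i + mAplus Q i 0.
  by rewrite /mA mxE [X in X + _]mxE mul_ones.
have AE : (Asum Q *m a) i 0 =
    (blkAm Q *m a) i 0 + \sum_j mx_sum 0 (blkA Q) i j * a j 0.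
  by rewrite /Asum mulmxDl mxE [X in _ + X]mxE.
have E2 : \sum_j blkAm Q i j * ell n.+1 j =
    s * n.+1%:R * rowsum (blkAm Q) i + (blkAm Q *m a) i 0.
  rewrite /rowsum mulr_sumr mxE -big_split/=; apply: eq_bigr => j _.
  by rewrite mxE; ring.
have := a_eq i; rewrite AE mAE; move: H; rewrite E2.
have -> : ell n.+2 i = s * n.+2%:R + a i 0 by rewrite /= mxE.
rewrite -(natr1 n.+1); nra.
Qed.

(** Compare with small multiples of [ell], which is strictly superharmonic and tends
    to infinity. *)
Lemma harmonic_le0 B y : 0 <= B -> bounded_by B y -> free_harmonic y ->
  (forall i, y 0%N i 0 = 0) -> forall n i, y n i 0 <= 0.
Proof.
move=> B0 yB yh y0.
pose K := \sum_i `|a i 0|.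
have aK i : 0 <= a i 0 + K.
  have : `|a i 0| <= K by rewrite /K (bigD1 i)//= lerDl sumr_ge0.
  by rewrite ler_norml => /andP[? _]; lra.
have main e : 0 < e -> forall n i, y n i 0 <= e * (s * n.+1%:R + a i 0 + K).
  move=> e0 n0 i0.
  (* A positive maximum of [z] would exist, as [z] is not positive at infinity, and
     be taken above the bottom level; there the mean of [z] after one step
     exceeds [z] by [e], hence exceeds the maximum. *)
  pose z (p : nat * 'I_M1) := y p.1 p.2 0 - e * (s * p.1.+1%:R + a p.2 0 + K).
  suff : z (n0, i0) <= 0 by rewrite /z /= subr_le0.
  rewrite leNgt; apply/negP => z0.
  have es0 : 0 < e * s by rewrite mulr_gt0.
  pose Nb := (maxn n0 (Num.truncn (B / (e * s)))).+1.
  have far n i : (Nb <= n)%N -> z (n, i) <= 0.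
    move=> Nn; rewrite /z /= subr_le0.
    apply: (@le_trans _ _ (e * (s * n.+1%:R))); last first.
      by rewrite ler_wpM2l ?(ltW e0)// -addrA lerDl.
    apply: le_trans (ler_norm _) _; apply: le_trans (yB _ _) _.
    rewrite mulrA mulrC -ler_pdivrMr//.
    apply: le_trans (ltW (truncnS_gt _)) _; rewrite ler_nat ltnS.
    exact: leq_trans (leq_maxr _ _) (ltnW Nn).
  have n0N : (n0 < Nb)%N by rewrite ltnS leq_maxl.
  pose p0 := (Ordinal n0N, i0).
  pose zo (p : 'I_Nb * 'I_M1) := z (val p.1, p.2).
  have [[ns im] _ zmax] := Order.TotalTheory.arg_maxP (P := xpredT) (i0 := p0) zo erefl.
  have zs0 : 0 < zo (ns, im) by apply: lt_le_trans z0 _; exact: (zmax p0 erefl).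
  have zall n i : z (n, i) <= zo (ns, im).
    have [Nn|nN] := leqP Nb n; first by apply: le_trans (far n i Nn) (ltW zs0).
    exact: (zmax (Ordinal nN, i) erefl).
  case: ns zs0 zmax zall => -[|n1] n1N zs0 _ zall.
    move: zs0; rewrite /zo /z /= y0 sub0r oppr_gt0 ltNge => /negP; apply.
    by rewrite mulr_ge0 ?(ltW e0)// -addrA addr_ge0// mulr_ge0// ltW.
  set zs := zo _ in zs0 zall.
  pose Z : fn := fun k i => 1 * on_levels y k i + (- e) * ell k i.
  have ylin := on_levels_lingrow B0 yB.
  have Zle k i : Z k i <= zs + e * K.
    have eK : 0 <= e * K by rewrite mulr_ge0 ?(ltW e0)// sumr_ge0.
    case: k i => [|k] i; first by rewrite /Z /= !mulr0 addr0 addr_ge0// ltW.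
    have := zall k i; rewrite /Z /z /= mxE; lra.
  have Zlin : lingrow (B + e * (s + K)) Z.
    move=> k i; rewrite /Z mul1r mulNr mulrDl; apply: le_trans (ler_normB _ _) _.
    apply: lerD; first exact: ylin.
    by rewrite normrM ger0_norm ?(ltW e0)// -mulrA ler_wpM2l ?(ltW e0)//; exact: ell_lingrow.
  have clin : lingrow (zs + e * K) ((fun _ _ => zs + e * K) : fn).
    have zK : 0 <= zs + e * K by rewrite addr_ge0 ?(ltW zs0)// mulr_ge0 ?(ltW e0)// sumr_ge0.
    by move=> k i; rewrite ger0_norm// ler_peMr ?ler1n.
  have := pstep_le P_stoch A_mean B_mean (im : 'I_(lvl M0 M1 n1.+2)) Zlin clin Zle.
  rewrite (step_cst P_stoch).
  rewrite (pstep_lin P_stoch A_mean B_mean _ _ _ ylin ell_lingrow).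
  rewrite (harmonic_step _ _ B0 yB yh).
  have := ell_step n1 im; rewrite /= mxE => /eqP; rewrite subr_eq => /eqP el.
  have -> : zs = y n1.+1 im 0 - e * (s * n1.+2%:R + a im 0 + K) by [].
  rewrite leNgt => /negP; apply; rewrite el; lra.
move=> n i; rewrite leNgt; apply/negP => yp.
have c0 : 0 < s * n.+1%:R + a i 0 + K by rewrite -addrA ltr_pwDl// mulr_gt0.
have := main (y n i 0 / (s * n.+1%:R + a i 0 + K) / 2) _ n i.
rewrite mulrAC divfK ?gt_eqF// => /(_ _); rewrite divr_gt0 ?divr_gt0//.
move=> /(_ erefl); lra.
Qed.

Lemma harmonic_eq0 B y : bounded_by B y -> free_harmonic y ->
  (forall i, y 0%N i 0 = 0) -> forall n i, y n i 0 = 0.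
Proof.
move=> yB yh y0 n i.
have B0 : 0 <= B by apply: le_trans (yB n i).
apply/eqP; rewrite eq_le (harmonic_le0 B0 yB yh)//=.
rewrite -oppr_le0.
have : (const_mx 0 - y n) i 0 <= 0.
  apply: (@harmonic_le0 B (fun n => const_mx 0 - y n) B0).
  - by move=> m j; rewrite !mxE sub0r normrN.
  - by apply: harmonicB => //; exact: harmonic_cst.
  - by move=> j; rewrite !mxE y0 subr0.
by rewrite !mxE sub0r.
Qed.

End LinearFunction.
End FreeWalk.
Arguments sums_blkA {R M0 M1 Q} _ _ i j.
Arguments sums_rowsum_blkA {R M0 M1 Q} _ _ _ i.
Arguments harmonic_cst {R M0 M1 Q} _ _ _ c.
Arguments step_inner {R M0 M1 Q} _ _ _ {g C} n i _.
Arguments on_levels {R M0 M1} y k i.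
Arguments ell {R M0 M1} s a k i.

(** * Substochastic matrices and the matrix [G] *)

Section Substochastic.
Variables (R : realType) (n : nat).
Implicit Types X Y : 'M[R]_n.

Definition substoch X := (forall i j, 0 <= X i j) /\ forall i, rowsum X i <= 1.

Lemma substoch_le1 X i j : substoch X -> X i j <= 1.
Proof. by case=> X0 X1; apply: le_trans (X1 i); exact: le_rowsum. Qed.

Lemma rowsum_mul p (A : 'M[R]_(p, n)) X i :
  rowsum (A *m X) i = \sum_k A i k * rowsum X k.
Proof.
rewrite /rowsum; under eq_bigr do rewrite mxE.
by rewrite exchange_big/=; apply: eq_bigr => k _; rewrite mulr_sumr.
Qed.

Lemma rowsum_mul_le p (A : 'M[R]_(p, n)) X i : (forall i j, 0 <= A i j) ->
  substoch X -> rowsum (A *m X) i <= rowsum A i.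
Proof.
move=> A0 [_ X1]; rewrite rowsum_mul; apply: ler_sum => k _.
by rewrite ler_piMr.
Qed.

Lemma substoch_exp X p : substoch X -> substoch (X ^+ p).
Proof.
move=> Xs; have [X0 X1] := Xs; elim: p => [|p [IH0 IH1]].
  split=> [i j|i]; first by rewrite exp_mx0 ler0n.
  rewrite /rowsum; under eq_bigr do rewrite exp_mx0.
  by rewrite (bigD1 i)//= eqxx big1 ?addr0// => j /negbTE; rewrite eq_sym => ->.
split=> [i j|i]; first by rewrite exp_mxS sumr_ge0// => k _; rewrite mulr_ge0.
rewrite exprS -[X * _]/(X *m _); apply: le_trans (X1 i).
exact: rowsum_mul_le.
Qed.

Lemma exp_mx_le X Y p : (forall i j, 0 <= X i j) -> (forall i j, X i j <= Y i j) ->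
  forall i j, 0 <= (X ^+ p) i j <= (Y ^+ p) i j.
Proof.
move=> X0 XY; elim: p => [|p IH] i j; first by rewrite !exp_mx0 ler0n lexx.
rewrite !exp_mxS; apply/andP; split.
  by apply: sumr_ge0 => k _; rewrite mulr_ge0//; have /andP[] := IH k j.
by apply: ler_sum => k _; have /andP[? ?] := IH k j; rewrite ler_pM.
Qed.

Lemma cvg_exp_mx (X : nat -> 'M[R]_n) Y p : (forall i j, (fun t => X t i j) @ \oo --> Y i j) ->
  forall i j, (fun t => (X t ^+ p) i j) @ \oo --> (Y ^+ p) i j.
Proof.
move=> XY; elim: p => [|p IH] i j.
  by under eq_fun do rewrite exp_mx0; rewrite exp_mx0; exact: cvg_cst.
under eq_fun do rewrite exp_mxS; rewrite exp_mxS.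
by apply: cvg_fsum => k; apply: cvgM.
Qed.

End Substochastic.

Section GMatrix.
Variables (R : realType) (M0 M1 : nat).
Notation fn := (fn R M0 M1).
Variable Q : mg1 R M0 M1.
Hypothesis P_stoch : stochastic (mg1_matrix Q).
Hypothesis A_mean : forall i, finite_mean (fun m => rowsum (blkA Q m) i).
Hypothesis B_mean : forall i, finite_mean (fun m => rowsum (blkB Q m) i).
Hypothesis A_stoch : fstochastic (Asum Q).

(** The map of which [G] is the least fixed point. *)
Definition Gmap (X : 'M[R]_M1) : 'M[R]_M1 :=
  blkAm Q + mx_sum 0 (fun m => blkA Q m *m X ^+ m.+1).

Let A0 m i j : 0 <= blkA Q m i j := blkA_ge0 P_stoch m i j.

Lemma Gmap_term X m i j : substoch X ->
  0 <= (blkA Q m *m X ^+ m.+1) i j <= rowsum (blkA Q m) i.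
Proof.
move=> Xs; have [X0 X1] := substoch_exp m.+1 Xs.
have T0 k : 0 <= (blkA Q m *m X ^+ m.+1) i k.
  by rewrite mxE sumr_ge0// => l _; rewrite mulr_ge0.
rewrite T0/=; apply: le_trans (rowsum_mul_le i (A0 m) (substoch_exp m.+1 Xs)).
exact: le_rowsum.
Qed.

Lemma Gmap_sums X i j : substoch X ->
  sums 0 (fun m => (blkA Q m *m X ^+ m.+1) i j) (Gmap X i j - blkAm Q i j).
Proof.
move=> Xs.
have -> : Gmap X i j - blkAm Q i j = rsum 0 (fun m => (blkA Q m *m X ^+ m.+1) i j).
  rewrite /Gmap mxE [X in _ + X - _]mxE; ring.
apply: (summable_abs _ (sums_rowsum_blkA P_stoch A_mean A_stoch i)) => m _.
by have /andP[? ?] := Gmap_term m i j Xs; rewrite ger0_norm.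
Qed.

Arguments Gmap_sums {X} i j _.

Lemma substoch_Gmap X : substoch X -> substoch (Gmap X).
Proof.
move=> Xs; split=> [i j|i].
  have := blkAm_ge0 P_stoch i j.
  have : 0 <= Gmap X i j - blkAm Q i j.
    by apply: (sums_ge0 _ (Gmap_sums i j Xs)) => m _; have /andP[] := Gmap_term m i j Xs.
  lra.
have S := @sums_big R _ (index_enum 'I_M1) 0 _ _ (fun j => Gmap_sums i j Xs).
have : \sum_j (Gmap X i j - blkAm Q i j) <= 1 - rowsum (blkAm Q) i.
  apply: (sums_le _ S (sums_rowsum_blkA P_stoch A_mean A_stoch i)) => m _.
  exact: (rowsum_mul_le i (A0 m) (substoch_exp m.+1 Xs)).
rewrite sumrB -!/(rowsum _ i); lra.
Qed.

Lemma Gmap_le X Y : substoch X -> substoch Y -> (forall i j, X i j <= Y i j) ->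
  forall i j, Gmap X i j <= Gmap Y i j.
Proof.
move=> Xs Ys XY i j.
have : Gmap X i j - blkAm Q i j <= Gmap Y i j - blkAm Q i j.
  apply: (sums_le _ (Gmap_sums i j Xs) (Gmap_sums i j Ys)) => m _.
  rewrite !mxE; apply: ler_sum => k _.
  by have /andP[? ?] := exp_mx_le m.+1 Xs.1 XY k j; rewrite ler_wpM2l.
lra.
Qed.

Lemma G_solution_fixpoint X : substoch X -> Gmap X = X -> G_solution Q X.
Proof.
move=> Xs XE; split=> [i j|i j]; first exact: Xs.1.
have := Gmap_sums i j Xs; rewrite XE /sums => H.
have -> : (fun K => (blkAm Q + \sum_(0 <= m < K) blkA Q m *m X ^+ m.+1) i j) =
   (fun K => blkAm Q i j + \sum_(0 <= m < K) (blkA Q m *m X ^+ m.+1) i j).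
  by apply/funext => K; rewrite mxE summxE.
rewrite -[X in _ --> X](subrKC (blkAm Q i j)).
by apply: cvgD => //; exact: cvg_cst.
Qed.

(** Iterating [Gmap] from [0] stays among substochastic matrices and increases,
    so the minimal solution is substochastic. *)
Lemma substoch_G G : is_G Q G -> substoch G.
Proof.
case=> [[G0 _]] Gmin.
pose X t := iter t Gmap 0.
have Xs t : substoch (X t).
  elim: t => [|t IH]; last exact: substoch_Gmap.
  split=> [i j|i]; first by rewrite mxE.
  by rewrite /rowsum big1// => j _; rewrite mxE.
have Xinc t i j : X t i j <= X t.+1 i j.
  elim: t i j => [|t IH] i j; first by rewrite [leLHS]mxE (Xs 1%N).1.
  exact: (Gmap_le (Xs t) (Xs t.+1) IH).
pose Y : 'M[R]_M1 := \matrix_(i, j) limn (fun t => X t i j).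
have XY i j : (fun t => X t i j) @ \oo --> Y i j.
  rewrite mxE; apply: nondecreasing_is_cvgn.
    exact: (homo_leq (@lexx _ _) le_trans (fun t => Xinc t i j)).
  by exists 1 => _ [t _ <-]; exact: substoch_le1.
have Ys : substoch Y.
  split=> [i j|i].
    apply: (ler_cvg_to (cvg_cst 0) (XY i j)); apply: nearW => t; exact: (Xs t).1.
  have rowsX : (fun t => rowsum (X t) i) @ \oo --> rowsum Y i by apply: cvg_fsum => j; exact: XY.
  apply: (ler_cvg_to rowsX (cvg_cst (1 : R))).
  apply: nearW => t; exact: (Xs t).2.
have YE : Gmap Y = Y.
  apply/matrixP => i j.
  have c1 : (fun t => X t.+1 i j) @ \oo --> Y i j by rewrite (cvg_shiftS (fun t => X t i j)).
  have E Z : Gmap Z i j = blkAm Q i j + rsum 0 (fun m => (blkA Q m *m Z ^+ m.+1) i j).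
    by rewrite /Gmap mxE [X in _ + X]mxE.
  have c2 : (fun t => Gmap (X t) i j) @ \oo --> Gmap Y i j.
    rewrite E; under eq_fun do rewrite E.
    apply: cvgD; first exact: cvg_cst.
    apply: (tannery _ (sums_rowsum_blkA P_stoch A_mean A_stoch i)) => [t m|m].
      by have /andP[? ?] := Gmap_term m i j (Xs t); rewrite ger0_norm.
    rewrite mxE; under eq_fun do rewrite mxE.
    by apply: cvg_fsum => k; apply: cvgMl_tmp; exact: cvg_exp_mx.
  exact: (cvg_unique _ c2 c1).
have Ysol := G_solution_fixpoint Ys YE.
split=> // i; apply: le_trans (Ys.2 i).
by apply: ler_sum => j _; exact: Gmin.
Qed.

(** Applying both sides of the equation of [G] to [G ^+ n *m x]. For the minimal
    solution, [G ^+ n *m x] is the mean of [x] at the phase where the walk first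
    comes down by [n] levels. *)
Lemma harmonic_exp (G : 'M[R]_M1) (x : 'cV[R]_M1) : G_solution Q G -> free_harmonic Q (fun n => G ^+ n *m x).
Proof.
case=> G0 Gsol n i.
have S : (fun K => \sum_j (blkAm Q + \sum_(0 <= m < K) blkA Q m *m G ^+ m.+1) i j *
    (G ^+ n *m x) j 0) @ \oo --> \sum_j G i j * (G ^+ n *m x) j 0.
  by apply: cvg_fsum => j; apply: cvgMr_tmp; exact: Gsol.
have E1 : \sum_j G i j * (G ^+ n *m x) j 0 = (G ^+ n.+1 *m x) i 0.
  by rewrite exprS -[G * _]/(G *m _) -mulmxA [RHS]mxE.
have E2 K : \sum_j (blkAm Q + \sum_(0 <= m < K) blkA Q m *m G ^+ m.+1) i j *
    (G ^+ n *m x) j 0 = \sum_j blkAm Q i j * (G ^+ n *m x) j 0 +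
    \sum_(0 <= m < K) \sum_j blkA Q m i j * (G ^+ (n.+1 + m) *m x) j 0.
  under eq_bigr do rewrite mxE mulrDl.
  rewrite big_split/=; congr (_ + _).
  under eq_bigr do rewrite summxE mulr_suml.
  rewrite exchange_big/=; apply: eq_bigr => m _.
  have -> : G ^+ (n.+1 + m) = G ^+ m.+1 *m G ^+ n.
    by rewrite -[_ *m _]/(_ * _) -exprD; congr (_ ^+ _); lia.
  transitivity ((blkA Q m *m G ^+ m.+1 *m (G ^+ n *m x)) i 0); first by rewrite [RHS]mxE.
  by rewrite -!mulmxA [LHS]mxE; apply: eq_bigr => j _; rewrite !mulmxA.
rewrite -E1 /sums; set c := \sum_j blkAm Q i j * _.
rewrite [X in X @ \oo --> _](_ : _ = (fun K => \sum_j (blkAm Q +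
    \sum_(0 <= m < K) blkA Q m *m G ^+ m.+1) i j * (G ^+ n *m x) j 0 - c)).
  by apply: cvgB => //; exact: cvg_cst.
by apply/funext => K; rewrite E2 -/c addrC addKr.
Qed.

Arguments harmonic_exp {G} x _.

Lemma bounded_exp (G : 'M[R]_M1) (x : 'cV[R]_M1) : substoch G -> bounded_by (\sum_j `|x j 0|) (fun n => G ^+ n *m x).
Proof.
move=> Gs n i; have Gn := substoch_exp n Gs; rewrite mxE.
apply: le_trans (ler_norm_sum _ _ _) _; apply: ler_sum => j _.
by rewrite normrM ger0_norm ?ler_piMl ?(substoch_le1 i j Gn) ?Gn.1.
Qed.

Section LinearFunction.
Variables (s : R) (a : 'cV[R]_M1).
Hypothesis s_gt0 : 0 < s.
Hypothesis a_eq : forall i, a i 0 - (Asum Q *m a) i 0 = 1 + s * mA Q i 0.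
Variable G : 'M[R]_M1.
Hypothesis G_min : is_G Q G.

Let Gs : substoch G := substoch_G G_min.

(** Both sides are bounded, harmonic and agree at the bottom level. *)
Lemma bounded_harmonic_exp B y : bounded_by B y -> free_harmonic Q y ->
  forall n i, y n i 0 = (G ^+ n *m y 0%N) i 0.
Proof.
move=> yB yh n i; apply/eqP; rewrite -subr_eq0.
have h := harmonicB yh (harmonic_exp (y 0%N) G_min.1).
have b : bounded_by (B + \sum_j `|y 0%N j 0|) (fun n => y n - G ^+ n *m y 0%N).
  move=> m j; rewrite !mxE; apply: le_trans (ler_normB _ _) _; apply: lerD => //.
  by have := bounded_exp (y 0%N) Gs m j; rewrite mxE.
have := harmonic_eq0 P_stoch A_mean B_mean A_stoch s_gt0 a_eq b h.
move=> /(_ _ n i)H; have : (y n - G ^+ n *m y 0%N) i 0 = 0.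
  by apply: H => j; rewrite expr0 -[1]/(1%:M) mul1mx mxE [X in _ + X]mxE subrr.
by rewrite mxE [X in _ + X]mxE => ->.
Qed.

(** The constant [1] is bounded and harmonic, hence equal to [G ^+ n *m 1]: the
    negative drift makes the descent certain. *)
Lemma fstochastic_G : fstochastic G.
Proof.
split=> [i j|i]; first exact: Gs.1.
have b : bounded_by 1 (fun=> const_mx 1 : 'cV[R]_M1) by move=> n j; rewrite mxE normr1.
have := bounded_harmonic_exp b (harmonic_cst P_stoch A_mean A_stoch 1) 1 i.
by rewrite expr1 mul_ones mxE.
Qed.

Hypothesis A_irr : firreducible (Asum Q).

(** If [C] is a closed class, [G ^+ n *m 1_C] is harmonic in [n]; it equals [1] on
    [C], hence, as the phase process is irreducible, at all phases for large [n]. *)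
Lemma closed_class_reached i1 : closed_class G [set j | `[< leads_to G i1 j >]]%SET ->
  forall i, leads_to G i i1.
Proof.
set C := [set j | _]%SET => -[_ Ccl].
have G0 p i j : 0 <= (G ^+ p) i j by exact: (substoch_exp p Gs).1.
have G1 p i : rowsum (G ^+ p) i = 1 by have [_ +] := fstochastic_exp p fstochastic_G; apply.
have i1C : i1 \in C by rewrite inE; apply/asboolP; exact: leads_to_refl.
pose x : 'cV[R]_M1 := \col_j (j \in C)%:R.
pose y n := G ^+ n *m x.
have yh : free_harmonic Q y by apply: harmonic_exp; exact: G_min.1.
have y01 n i : 0 <= y n i 0 <= 1.
  rewrite mxE; apply/andP; split.
    by apply: sumr_ge0 => j _; rewrite mxE mulr_ge0 ?ler0n.
  rewrite -(G1 n i); apply: ler_sum => j _; rewrite mxE.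
  by case: (j \in C); rewrite ?mulr1// mulr0.
have yC n i : i \in C -> y n i 0 = 1.
  move=> iC; rewrite mxE -(G1 n i); apply: eq_bigr => j _; rewrite mxE.
  case jC: (j \in C); first by rewrite mulr1.
  rewrite mulr0; apply/eqP/negPn/negP => ne0.
  have : leads_to G i j by exists n; rewrite lt0r G0 andbT eq_sym.
  by move/(Ccl i iC j).2; rewrite jC.
have y1 : bounded_by 1 y.
  by move=> n i; have /andP[? ?] := y01 n i; rewrite ger0_norm.
have ylin := on_levels_lingrow (M0 := M0) ler01 y1.
pose good i := exists n0, forall n, (n0 <= n)%N -> y n i 0 = 1.
have good_step i j : good i -> Asum Q i j != 0 -> good j.
  case=> n0 Hn0 Aij.
  have prop n l : mg1_matrix Q n.+2 l.+1 i j != 0 -> (n0 <= n.+1)%N -> y l j 0 = 1.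
    move=> Pij nn0.
    pose g : fn := fun k i => 1 * 1 + -1 * on_levels y k i.
    have clin : lingrow (1 : R) ((fun _ _ => 1) : fn).
      by move=> k i'; rewrite normr1 mul1r ler1n.
    have glin : lingrow 2 g.
      move=> k i'; rewrite /g mul1r mulN1r; apply: le_trans (ler_normB _ _) _.
      have := clin k i'; have := ylin k i'; lra.
    have g0 k i' : 0 <= g k i'.
      rewrite /g; case: k i' => [|k] i' /=; first lra.
      have /andP[? ?] := y01 k i'; lra.
    have := @pstep_eq0 _ _ _ _ P_stoch A_mean B_mean g 2 n.+2 i glin g0.
    rewrite (pstep_lin P_stoch A_mean B_mean _ _ _ clin ylin).
    rewrite (step_cst P_stoch) (harmonic_step P_stoch A_mean B_mean _ _ ler01 y1 yh).
    rewrite Hn0// => /(_ _ l.+1 j Pij); rewrite /g /=; have -> : 1 * 1 + -1 * 1 = 0 :> R by ring.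
    move=> /(_ erefl); lra.
  have [Am0|] := eqVneq (blkAm Q i j) 0; last first.
    move=> Am; exists n0 => n nn0; case: n nn0 => [|n] nn0.
      by apply: (prop 0%N 0%N) => //; move: nn0; rewrite leqn0 => /eqP ->.
    by apply: (prop n.+1 n.+1); [rewrite /= ltnn eqxx | exact: leq_trans nn0 (leqnSn _)].
  have [m Am] : exists m, blkA Q m i j != 0.
    apply: contrapT => nm; move/eqP: Aij; apply; rewrite /Asum mxE Am0 add0r.
    apply: (sums_unique (sums_blkA P_stoch A_mean i j)).
    apply: (eq_sums _ (@sums0 R 0)) => m _; apply/esym/eqP/negPn/negP => Am.
    by apply: nm; exists m.
  exists (n0 + m).+1 => n nn0; have [n' nE] : exists n', n = (n'.+1 + m)%N.
    by exists (n - m).-1; lia.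
  rewrite nE; apply: (prop n'); last by lia.
  rewrite /= ifT; last by lia.
  by have -> : (n'.+1 + m - n'.+1 = m)%N by lia.
have allgood i : good i.
  apply: (leads_to_closed (T := good) good_step (A_irr i1 i)).
  by exists 0%N => n _; exact: yC.
move=> i; have [n0 /(_ n0 (leqnn _))] := allgood i; rewrite mxE => yn0.
have [j /negP jn] : exists j, ~ ((G ^+ n0) i j * x j 0 == 0).
  apply: contrapT => nj; move/eqP: yn0; rewrite big1 1?eq_sym ?oner_eq0// => j _.
  by apply/eqP/negPn/negP => H; apply: nj; exists j; exact/negP.
move: jn; rewrite mulf_eq0 negb_or mxE => /andP[Gij].
case jC: (j \in C) => /=; last by rewrite eqxx.
move=> _; apply: (leads_to_trans G0 (j := j)).
  by exists n0; rewrite lt0r Gij G0.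
by apply/(Ccl j jC).
Qed.

Hypothesis M1_gt0 : (0 < M1)%N.
Hypothesis G_aperiodic : forall C : {set 'I_M1}, closed_class G C -> class_aperiodic G C.

Lemma harmonic_cvg B y : bounded_by B y -> free_harmonic Q y ->
  exists L, forall e, 0 < e -> exists N, forall n i, (N <= n)%N -> `|y n i 0 - L| <= e.
Proof.
move=> yB yh.
have G0 p i j : 0 <= (G ^+ p) i j by exact: (substoch_exp p Gs).1.
have [i1 _ Ccl] := exists_closed_class (Ordinal M1_gt0) G0.
have per : has_period G i1 1.
  by apply: (G_aperiodic Ccl); rewrite inE; apply/asboolP; exact: leads_to_refl.
have [L HL] := aperiodic_powers_cvg fstochastic_G (closed_class_reached Ccl) per (y 0%N).
exists L => e /HL[N HN]; exists N => n i Nn.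
by rewrite (bounded_harmonic_exp yB yh); exact: HN.
Qed.

End LinearFunction.
End GMatrix.

(** * Poisson's equation for the point masses *)

Section PoissonSolution.
Variables (R : realType) (M0 M1 : nat).
Notation fn := (fn R M0 M1).
Variable Q : mg1 R M0 M1.
Hypothesis P_stoch : stochastic (mg1_matrix Q).
Hypothesis A_mean : forall i, finite_mean (fun m => rowsum (blkA Q m) i).
Hypothesis B_mean : forall i, finite_mean (fun m => rowsum (blkB Q m) i).
Hypothesis A_stoch : fstochastic (Asum Q).
Hypothesis A_irr : firreducible (Asum Q).
Variable varpi : 'rV[R]_M1.
Hypothesis varpi_stat : fstationary (Asum Q) varpi.
Hypothesis drift_lt0 : drift Q varpi < 0.
Let s := (- drift Q varpi)^-1.

Lemma slope_gt0 : 0 < s.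
Proof. by rewrite invr_gt0 oppr_gt0. Qed.

(** The slope [s] is the one that makes [1 + s mA] orthogonal to [varpi]. *)
Lemma drift_corrector : exists a : 'cV[R]_M1,
  forall i, a i 0 - (Asum Q *m a) i 0 = 1 + s * mA Q i 0.
Proof.
have [|a aE] := @poisson_finite R M1 (Asum Q) varpi (const_mx 1 + s *: mA Q) A_stoch A_irr varpi_stat.
  apply/matrixP => i j; rewrite !ord1 mulmxDr -scalemxAr mxE [X in _ + X]mxE.
  rewrite -/(drift Q varpi) -[const_mx 1]/(ones R M1) mul_ones [RHS]mxE.
  have [_ v1 _] := varpi_stat; rewrite /rowsum v1 /s invrN mulNr mulVf ?subrr//.
  by rewrite lt_eqF.
exists a => i; have := congr1 (fun B : 'cV[R]_M1 => B i 0) aE.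
by rewrite mxE [X in _ + X]mxE [RHS]mxE [X in _ = X + _]mxE [X in _ = _ + X]mxE.
Qed.

Variable a : 'cV[R]_M1.
Hypothesis a_eq : forall i, a i 0 - (Asum Q *m a) i 0 = 1 + s * mA Q i 0.
Hypothesis P_irr : irreducible (mg1_matrix Q).
Variable G : 'M[R]_M1.
Hypothesis G_min : is_G Q G.
Hypothesis M1_gt0 : (0 < M1)%N.
Hypothesis G_aperiodic : forall C : {set 'I_M1}, closed_class G C -> class_aperiodic G C.

Let elin := @ell_lingrow R M0 M1 s a slope_gt0.

Lemma ell_diff_le k (i : 'I_(lvl M0 M1 k)) l (j : 'I_(lvl M0 M1 l)) :
  `|ell s a k i - ell s a l j| <= s * `|k%:R - l%:R| + 2 * \sum_i `|a i 0|.
Proof.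
have s0 := ltW slope_gt0; set A := \sum_i _.
have A0 : 0 <= A by rewrite sumr_ge0.
have H p (x : 'I_(lvl M0 M1 p)) : `|ell s a p x - s * p%:R| <= A.
  case: p x => [|p] x /=; first by rewrite mulr0 subr0 normr0.
  by rewrite mxE addrC addKr /A (bigD1 x)//= lerDl sumr_ge0.
have -> : ell s a k i - ell s a l j = s * (k%:R - l%:R) +
    ((ell s a k i - s * k%:R) - (ell s a l j - s * l%:R)) by ring.
apply: le_trans (ler_normD _ _) _; rewrite normrM ger0_norm// lerD2l.
apply: le_trans (ler_normB _ _) _; have := H _ i; have := H _ j; lra.
Qed.

(** [ell] has the right charge above level [1]; the finitely supported defect is
    moved to [i0] by a bounded [w], which is harmonic above the level of [i0] and
    therefore converges at infinity. *)
Lemma poisson_solution k0 (i0 : 'I_(lvl M0 M1 k0)) :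
  exists (h : fn) (C kap L : R),
  [/\ forall k i, h k i - step Q id h i = 1 - kap * ind R i0 i,
      forall k i, `|h k i - ell s a k i| <= C &
      forall e : R, 0 < e -> exists N, forall n (i : 'I_M1), (N <= n)%N ->
        `|h n.+1 i - (ell s a : fn) n.+1 i - L| <= e].
Proof.
pose b : fn := fun k i => 1 - (ell s a k i - step Q id (ell s a) i).
have bfin : finsupp 2 b.
  move=> [|[|n]]// i _; rewrite /b.
  by rewrite (ell_step P_stoch A_mean B_mean A_stoch slope_gt0 a_eq n i) subrr.
have [w [C [kap [wC wE]]]] := reducible_finsupp P_stoch A_mean B_mean P_irr i0 bfin.
have wlin := bounded_fn_lingrow i0 wC.
pose y n : 'cV[R]_M1 := \col_i w (n + k0).+1 i.
have yC : bounded_by C y by move=> n i; rewrite mxE; exact: wC.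
have yh : free_harmonic Q y.
  move=> n i; have := step_inner P_stoch A_mean B_mean (n + k0) i wlin.
  have := wE (n + k0).+2 i.
  rewrite bfin// [ind _ _ _](_ : _ = 0) ?mulr0 ?subr0; last first.
    by rewrite /ind gtn_eqF// ltnS leqW ?leq_addl.
  move=> /eqP; rewrite subr_eq0 => /eqP <-.
  have -> : \sum_j blkAm Q i j * y n j 0 = \sum_j blkAm Q i j * w (n + k0).+1 j.
    by apply: eq_bigr => j _; rewrite mxE.
  rewrite [y _ _ _]mxE; apply: eq_sums => m _; apply: eq_bigr => j _.
  rewrite mxE; congr (_ * _).
  by apply: (@eq_fn_level _ _ _ w ((n + k0).+1 + m)%N (n.+1 + m + k0)%N j); lia.
have [L HL] := harmonic_cvg P_stoch A_mean B_mean A_stoch slope_gt0 a_eq G_min A_irr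
  M1_gt0 G_aperiodic yC yh.
exists (fun k i => 1 * ell s a k i + 1 * w k i), C, kap, L; split.
- move=> k i; rewrite (pstep_lin P_stoch A_mean B_mean _ _ _ elin wlin) !mul1r.
  by have := wE k i; rewrite /b; lra.
- move=> k i; rewrite !mul1r addrC addKr; exact: wC.
move=> e /HL[N HN]; exists (N + k0)%N => n i Nn; rewrite !mul1r [X in X - L](_ : _ = w n.+1 i); last by rewrite addrC addKr.
have {Nn} [n' [nE Nn']] : exists n', n = (n' + k0)%N /\ (N <= n')%N.
  by exists (n - k0)%N; split; lia.
by rewrite nE; have := HN n' i Nn'; rewrite mxE.
Qed.

End PoissonSolution.

(** * Probability vectors on the levels *)

Section Pairing.
Variables (R : realType) (M0 M1 : nat).
Implicit Types v : bvec R M0 M1.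

Definition two_level (u0 : 'I_M0 -> R) (u1 : 'I_M1 -> R) : fn R M0 M1 := fun k =>
  match k return 'I_(lvl M0 M1 k) -> R with 0 => u0 | _.+1 => u1 end.

Definition pairing v (u0 : 'I_M0 -> R) (u1 : 'I_M1 -> R) : R :=
  \sum_i v 0%N 0 i * u0 i + \sum_j pibar0 v 0 j * u1 j.

Definition prob v := (forall k i, 0 <= v k 0 i) /\ sums 0 (fun k => \sum_i v k 0 i) 1.

Lemma prob_level_le1 v k : prob v -> \sum_i v k 0 i <= 1.
Proof.
case=> v0 v1; apply: (sums_term_le (u := fun k => \sum_i v k 0 i) _ v1) => // l _.
by apply: sumr_ge0.
Qed.

Lemma prob_le_level v k i : prob v -> v k 0 i <= \sum_i v k 0 i.
Proof. by case=> v0 _; rewrite (bigD1 i)//= lerDl sumr_ge0. Qed.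

Lemma prob_le1 v k i : prob v -> v k 0 i <= 1.
Proof. by move=> vp; apply: le_trans (prob_level_le1 k vp); exact: prob_le_level. Qed.

Lemma sums_pibar0 v (j : 'I_M1) : prob v -> sums 0 (fun l => v l.+1 0 j) (pibar0 v 0 j).
Proof.
move=> vp; have [v0 v1] := vp; rewrite mxE.
have /(sums_split 1 _ (leq0n 1)) := v1 => /sums_shift v1'.
apply: (summable_abs _ v1') => k _; rewrite ger0_norm// addn1.
exact: (@prob_le_level v k.+1 j vp).
Qed.
Arguments sums_pibar0 {v} j _.

Lemma pibar0_ge0 v j : prob v -> 0 <= pibar0 v 0 j.
Proof. by move=> vp; apply: (sums_ge0 _ (sums_pibar0 j vp)) => l _; exact: vp.1. Qed.

Lemma pibar0_le1 v j : prob v -> pibar0 v 0 j <= 1.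
Proof.
move=> vp; have [v0 v1] := vp.
have /(sums_split 1 _ (leq0n 1)) := v1 => /sums_shift v1'.
apply: (@le_trans _ _ (1 - \sum_(0 <= k < 1) \sum_i v k 0 i)).
  apply: (sums_le _ (sums_pibar0 j vp) v1') => k _; rewrite addn1.
  exact: (@prob_le_level v k.+1 j vp).
rewrite lerBlDr lerDl; do 2![apply: sumr_ge0 => ? _]; exact: v0.
Qed.

Lemma sums_pairing v u0 u1 : prob v ->
  sums 0 (fun k => \sum_i v k 0 i * two_level u0 u1 i) (pairing v u0 u1).
Proof.
move=> vp; apply/(sums_split 1 _ (leq0n 1)); rewrite big_nat1.
rewrite /pairing [X in sums _ _ X](_ : _ = \sum_j pibar0 v 0 j * u1 j); last by rewrite addrC addKr.
apply/sums_shift.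
have := @sums_big R _ (index_enum 'I_M1) 0 _ _ (fun j => sumsZr (u1 j) (sums_pibar0 j vp)).
by apply: eq_sums => k _; rewrite addn1.
Qed.

Lemma pairing_ge0 v u0 u1 : prob v -> (forall i, 0 <= u0 i) -> (forall i, 0 <= u1 i) ->
  0 <= pairing v u0 u1.
Proof.
move=> vp u00 u10; apply: addr_ge0; apply: sumr_ge0 => i _; rewrite mulr_ge0//.
  exact: vp.1.
exact: pibar0_ge0.
Qed.

Lemma pairing_le_sum v u0 u1 : prob v -> (forall i, 0 <= u0 i) -> (forall i, 0 <= u1 i) ->
  pairing v u0 u1 <= \sum_i u0 i + \sum_j u1 j.
Proof.
move=> vp u00 u10; apply: lerD; apply: ler_sum => i _; rewrite ler_piMl//.
  exact: prob_le1.
exact: pibar0_le1.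
Qed.

(** For probability vectors, entrywise convergence forbids any loss of mass at
    infinity, so that the level sums converge as well. *)
Lemma scheffe (vN : nat -> bvec R M0 M1) v : (forall N, prob (vN N)) -> prob v ->
  (forall k i, (fun N => vN N k 0 i) @ \oo --> v k 0 i) ->
  forall j, (fun N => pibar0 (vN N) 0 j) @ \oo --> pibar0 v 0 j.
Proof.
move=> vNp vp vNv j.
have mass w L : prob w -> 0 <= pibar0 w 0 j - \sum_(0 <= l < L) w l.+1 0 j <=
    1 - \sum_(0 <= k < L.+1) \sum_i w k 0 i.
  move=> wp; have S := (sums_split L _ (leq0n L)).2 (sums_pibar0 j wp).
  have T := (sums_split L.+1 _ (leq0n L.+1)).2 wp.2.
  apply/andP; split; first by apply: (sums_ge0 _ S) => l _; exact: wp.1.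
  move/sums_shift : S => S; move/sums_shift : T => T.
  apply: (sums_le _ S T) => l _; rewrite addnS.
  exact: (@prob_le_level w (l + L).+1 j wp).
apply/cvgn_epsP => e e0; have e4 : 0 < e / 4 by rewrite divr_gt0.
have [L _ [t vt te]] := sums_tail_small vp.2 e4.
have vt1 : `|1 - \sum_(0 <= k < L.+1) \sum_i v k 0 i| <= e / 4.
  have pos k : (0 <= k)%N -> 0 <= \sum_i v k 0 i by move=> _; apply: sumr_ge0 => i _; exact: vp.1.
  have := sums_partial_le L.+1 pos vp.2.
  have := sums_unique vt ((sums_split L _ (leq0n L)).2 vp.2) => tE.
  rewrite -subr_ge0 => H; rewrite ger0_norm//; apply: le_trans te.
  rewrite tE; apply: le_trans (ler_norm _); rewrite lerD2l lerN2 big_nat_recr//= lerDl.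
  exact: pos.
have c1 : (fun N => \sum_(0 <= k < L.+1) \sum_i vN N k 0 i) @ \oo -->
    \sum_(0 <= k < L.+1) \sum_i v k 0 i.
  by apply: cvg_fsum => k; apply: cvg_fsum => i; exact: vNv.
have c2 : (fun N => \sum_(0 <= l < L) vN N l.+1 0 j) @ \oo --> \sum_(0 <= l < L) v l.+1 0 j.
  by apply: cvg_fsum => l; exact: vNv.
have /cvgn_epsP/(_ _ e4)[Na HNa] := c1; have /cvgn_epsP/(_ _ e4)[Nb HNb] := c2.
exists (maxn Na Nb) => N; rewrite geq_max => /andP[/HNa Ha /HNb Hb].
have := mass _ L (vNp N); have := mass _ L vp.
move: Ha Hb vt1; rewrite !ler_norml.
set x1 := \sum_(_ <= _ < _) _; set x2 := \sum_(_ <= _ < _) _.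
set x3 := \sum_(_ <= _ < _) _; set x4 := \sum_(_ <= _ < _) _.
move=> /andP[? ?] /andP[? ?] /andP[? ?] /andP[? ?] /andP[? ?].
apply/andP; split; lra.
Qed.

End Pairing.
Arguments sums_pibar0 {R M0 M1 v} j _.
Arguments sums_pairing {R M0 M1 v} u0 u1 _.

(** * The difference formula for truncated stationary distributions *)

Section Difference.
Variables (R : realType) (M0 M1 : nat).
Notation fn := (fn R M0 M1).
Variable Q : mg1 R M0 M1.
Hypothesis P_stoch : stochastic (mg1_matrix Q).
Hypothesis A_mean : forall i, finite_mean (fun m => rowsum (blkA Q m) i).
Hypothesis B_mean : forall i, finite_mean (fun m => rowsum (blkB Q m) i).

Lemma blkB_ge0_pos m i j : (0 < m)%N -> 0 <= blkB Q m i j.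
Proof. by case: m => // m _; have := up_ge0 P_stoch 0%N m i j. Qed.

Definition tail2A N i := rowsum (tail (tail (blkA Q)) N) i.
Definition tail2B N i := rowsum (tail (tail (blkB Q)) N) i.

(** The double tail is the mean overshoot of the jumps above [N.+1] levels. *)
Lemma sums_excess N k (i : 'I_(lvl M0 M1 k)) :
  sums 0 (fun m => (m - N)%N%:R * rowsum (up Q k m) i) (two_level (tail2B N) (tail2A N) i).
Proof.
have E p (X : nat -> 'M[R]_(p, M1)) (x : 'I_p) :
    (forall k i j, (0 < k)%N -> 0 <= X k i j) ->
    (forall i, finite_mean (fun k => rowsum (X k) i)) ->
    sums 0 (fun m => (m - N)%N%:R * rowsum (X m.+1) x) (rowsum (tail (tail X) N) x).
  move=> X0 Xm; rewrite rowsum_tail2//.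
  have n0 n : (0 <= n)%N -> `|(n - N.+1)%N%:R : R| <= n%:R.
    by rewrite ger0_norm ?ler0n// ler_nat leq_subr.
  have /sums_skip0 := finite_mean_sums (Xm x) n0.
  rewrite sub0n mul0r => /(_ erefl)/sums_shift.
  by apply: eq_sums => m _; rewrite addn1 subSS.
case: k i => [|k] i; first by apply: E => // *; exact: blkB_ge0_pos.
by apply: E => // *; exact: blkA_ge0.
Qed.
Arguments sums_excess N {k} i.

Lemma two_level_ge0 N k (i : 'I_(lvl M0 M1 k)) : 0 <= two_level (tail2B N) (tail2A N) i.
Proof.
apply: (sums_ge0 _ (sums_excess N i)) => m _.
by rewrite mulr_ge0 ?ler0n// (rowsum_up_ge0 P_stoch).
Qed.

Lemma tail2B_ge0 N i : 0 <= tail2B N i.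
Proof. exact: (@two_level_ge0 N 0%N i). Qed.

Lemma tail2A_ge0 N i : 0 <= tail2A N i.
Proof. exact: (@two_level_ge0 N 1%N i). Qed.

Lemma two_level_cvg0 k (i : 'I_(lvl M0 M1 k)) :
  (fun N => two_level (tail2B N) (tail2A N) i) @ \oo --> (0 : R).
Proof.
have -> : (fun N => two_level (tail2B N) (tail2A N) i) =
    (fun N => rsum 0 (fun m => (m - N)%N%:R * rowsum (up Q k m) i)).
  by apply/funext => N; rewrite (sums_rsum (sums_excess N i)).
rewrite -(sums_rsum (@sums0 R 0)).
have [mu _ /(_ k i)[t tmu _]] := up_mean_bounded A_mean B_mean.
apply: (tannery _ tmu) => [N m|m].
  have r0 := rowsum_up_ge0 P_stoch k m i.
  rewrite ger0_norm ?mulr_ge0 ?ler0n// ler_wpM2r// ler_nat; lia.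
apply/cvgn_epsP => e e0; exists m => N mN.
have -> : (m - N = 0)%N by lia.
by rewrite mul0r subrr normr0 ltW.
Qed.

(** The jumps of more than [N.+1] levels lose their overshoot, over which [h] grows
    like [l], with slope [s], up to the oscillation of [h - l] at infinity. *)
Lemma step_diff (h l : fn) (Ch s L eps : R) N : lingrow Ch h ->
  (forall k (i : 'I_M1), l k.+1 i - l 0%N.+1 i = s * k%:R) ->
  (forall n (i : 'I_M1), (N <= n)%N -> `|h n.+1 i - l n.+1 i - L| <= eps / 2) ->
  forall k (i : 'I_(lvl M0 M1 k)),
  `|step Q id h i - step Q (minn^~ N) h i - s * two_level (tail2B N) (tail2A N) i| <=
  eps * two_level (tail2B N) (tail2A N) i.
Proof.
move=> hC lE hl k i.
have idc : capped id by [].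
have mc : capped (minn^~ N) by move=> m; exact: geq_minl.
have S1 := step_summable P_stoch A_mean B_mean i idc hC.
have S2 := step_summable P_stoch A_mean B_mean i mc hC.
have T := sums_excess N i.
have D := sumsB (sumsB S1 S2) (sumsZ s T).
rewrite [X in `|X|](_ : _ = rsum 0 (fun m => \sum_j up Q k m i j * h (k + id m).+1 j) -
    rsum 0 (fun m => \sum_j up Q k m i j * h (k + minn m N).+1 j) -
    s * two_level (tail2B N) (tail2A N) i); last by rewrite /step; ring.
apply: (sums_abs_le _ D (sumsZ eps T)) => m _.
rewrite /rowsum -sumrB !mulr_sumr -sumrB.
apply: le_trans (ler_norm_sum _ _ _) _; apply: ler_sum => j _.
have u0 := up_ge0 P_stoch k m i j.
have [mN|Nm] := leqP m N.
  rewrite subrr (_ : (m - N = 0)%N); last by lia.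
  by rewrite !mul0r !mulr0 subrr normr0.
rewrite -mulrBr.
have -> : up Q k m i j * (h (k + m).+1 j - h (k + N).+1 j) - s * ((m - N)%N%:R * up Q k m i j) =
  up Q k m i j * ((h (k + m).+1 j - l (k + m).+1 j - L) -
    (h (k + N).+1 j - l (k + N).+1 j - L)).
  have := lE (k + m)%N j; have := lE (k + N)%N j.
  rewrite (natrB _ (ltnW Nm)) !natrD => e1 e2.
  have -> : l (k + m).+1 j = l 1%N j + s * (k%:R + m%:R) by rewrite -e2 addrC subrK.
  have -> : l (k + N).+1 j = l 1%N j + s * (k%:R + N%:R) by rewrite -e1 addrC subrK.
  ring.
have eps0 : 0 <= eps.
  have := le_trans (normr_ge0 _) (hl N j (leqnn N)); lra.
rewrite normrM ger0_norm// [leRHS]mulrA [leRHS]mulrC ler_wpM2l//.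
apply: le_trans (ler_normB _ _) _.
have := hl (k + m)%N j; have := hl (k + N)%N j.
move=> /(_ (leq_addl _ _)) h1 /(_ (leq_trans (ltnW Nm) (leq_addl _ _))) h2.
apply: (@le_trans _ _ eps); first lra.
by rewrite ler_peMr// ler1n subn_gt0.
Qed.

End Difference.
Arguments sums_excess {R M0 M1 Q} _ _ _ N {k} i.

Section DifferenceBound.
Variables (R : realType) (M0 M1 : nat).
Notation fn := (fn R M0 M1).
Variable Q : mg1 R M0 M1.
Hypothesis P_stoch : stochastic (mg1_matrix Q).
Hypothesis A_mean : forall i, finite_mean (fun m => rowsum (blkA Q m) i).
Hypothesis B_mean : forall i, finite_mean (fun m => rowsum (blkB Q m) i).
Hypothesis A_stoch : fstochastic (Asum Q).
Hypothesis A_irr : firreducible (Asum Q).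
Variable varpi : 'rV[R]_M1.
Hypothesis varpi_stat : fstationary (Asum Q) varpi.
Hypothesis drift_lt0 : drift Q varpi < 0.
Hypothesis P_irr : irreducible (mg1_matrix Q).
Variable G : 'M[R]_M1.
Hypothesis G_min : is_G Q G.
Hypothesis M1_gt0 : (0 < M1)%N.
Hypothesis G_aperiodic : forall C : {set 'I_M1}, closed_class G C -> class_aperiodic G C.
Variable pi : bvec R M0 M1.
Hypothesis pi_stat : stationary (mg1_matrix Q) pi.
Let s := (- drift Q varpi)^-1.

Lemma stationary_prob (P : bmx R M0 M1) v : stationary P v -> prob v.
Proof. by case. Qed.

Lemma sums_ind (v : bvec R M0 M1) kap k0 (i0 : 'I_(lvl M0 M1 k0)) : prob v ->
  sums 0 (fun k => \sum_i v k 0 i * (1 - kap * ind R i0 i)) (1 - kap * v k0 0 i0).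
Proof.
move=> [v0 v1].
have S : sums 0 (fun k => \sum_i v k 0 i * ind R i0 i)
    (\sum_(0 <= k < k0.+1) \sum_i v k 0 i * ind R i0 i).
  apply: sums_finsupp => // k kk0; apply: big1 => i _.
  by rewrite /ind gtn_eqF// mulr0.
rewrite big_nat_recr//= [X in sums _ _ (X + _)]big_nat_cond in S.
rewrite [X in sums _ _ (X + _)]big1 ?add0r in S; last first.
  move=> k; rewrite andbT /= => kk0; apply: big1 => i _.
  by rewrite /ind ltn_eqF// mulr0.
rewrite (bigD1 i0)//= ind_self mulr1 [X in _ + X]big1 ?addr0 in S; last first.
  move=> i ne; rewrite /ind eqxx /= (negbTE (_ : (i != i0 :> nat))) ?mulr0//.
apply: (eq_sums _ (sumsB v1 (sumsZ kap S))) => k _.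
rewrite mulr_sumr -sumrB; apply: eq_bigr => i _; ring.
Qed.

Arguments sums_ind {v} kap {k0} i0 _.

(** With [h] as in [poisson_solution], [balance] for [pi] reads [kap * pi i0 = 1],
    and for the truncated vector [v] it says that [kap * v i0 - 1] is the mean loss
    of [h] caused by the cut jumps, which [step_diff] evaluates. *)
Lemma difference_bound k0 (i0 : 'I_(lvl M0 M1 k0)) :
  0 < pi k0 0 i0 /\ forall eps, 0 < eps -> exists N0, forall N v, (N0 <= N)%N ->
    stationary (mg1_matrix (LI_trunc Q N.+1)) v ->
    `|v k0 0 i0 - pi k0 0 i0 - pi k0 0 i0 * s * pairing v (tail2B Q N) (tail2A Q N)| <=
    eps * (pi k0 0 i0 * pairing v (tail2B Q N) (tail2A Q N)).
Proof.
have s0 : 0 < s := slope_gt0 drift_lt0.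
have [a aE] := drift_corrector A_stoch A_irr varpi_stat drift_lt0.
have [h [C [kap [L [hE hC hL]]]]] := poisson_solution P_stoch A_mean B_mean A_stoch
  A_irr drift_lt0 aE P_irr G_min M1_gt0 G_aperiodic i0.
set A := \sum_i `|a i 0|.
have A0 : 0 <= A by rewrite sumr_ge0.
have C0 : 0 <= C := le_trans (normr_ge0 _) (hC k0 i0).
have hlip : lip (s + 2 * A + 2 * C) h.
  move=> k i l j; have e := ell_diff_le drift_lt0 a i j.
  have h1 := hC k i; have h2 := hC l j; have n0 := normr_ge0 (k%:R - l%:R : R).
  have -> : h k i - h l j = (ell s a k i - ell s a l j) +
    ((h k i - ell s a k i) - (h l j - ell s a l j)) by ring.
  apply: le_trans (ler_normD _ _) _.
  have := ler_normB (h k i - ell s a k i) (h l j - ell s a l j).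
  rewrite -/s -/A in e; have := ltW s0; nra.
have hlin : lingrow (C + (s + A)) h.
  move=> k i; rewrite -[h k i](subrK (ell s a k i)).
  apply: le_trans (ler_normD _ _) _; rewrite mulrDl; apply: lerD.
    by apply: le_trans (hC k i) _; rewrite ler_peMr ?ler1n.
  exact: (@ell_lingrow R M0 M1 s a s0 k i).
have kpi : kap * pi k0 0 i0 = 1.
  have pp := stationary_prob pi_stat.
  have idc : capped id by [].
  have B0 := balance P_stoch A_mean B_mean pp.1 pp.2
    (balanced_stationary P_stoch A_mean B_mean pi_stat) idc hlip hlin.
  have H : sums 0 (fun k => \sum_i pi k 0 i * (1 - kap * ind R i0 i)) 0.
    by apply: (eq_sums _ B0) => k _; apply: eq_bigr => i _; rewrite hE.
  have := sums_unique (sums_ind kap i0 pp) H; lra.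
have pi0 : 0 < pi k0 0 i0.
  rewrite lt0r; have [p0 _ _] := pi_stat; rewrite p0 andbT.
  by apply/eqP => z; move: kpi; rewrite z mulr0 => /eqP; rewrite eq_sym oner_eq0.
split=> // eps eps0; have e2 : 0 < eps / 2 by rewrite divr_gt0.
have [N0 HN0] := hL _ e2; exists N0 => N v N0N vst.
have vp := stationary_prob vst.
have mc : capped (minn^~ N) by move=> m; exact: geq_minl.
have B0 := balance P_stoch A_mean B_mean vp.1 vp.2
    (balanced_LI_trunc P_stoch A_mean B_mean vst) mc hlip hlin.
have lE k (i : 'I_M1) : (ell s a : fn) k.+1 i - (ell s a : fn) 1%N i = s * k%:R.
  by rewrite /= !mxE -natr1; ring.
have hlN n (i : 'I_M1) : (N <= n)%N -> `|h n.+1 i - (ell s a : fn) n.+1 i - L| <= eps / 2.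
  by move=> Nn; apply: HN0; exact: leq_trans Nn.
have sd := step_diff P_stoch A_mean B_mean hlin lE hlN.
set p := pairing v _ _.
have S1 := sumsB (sumsB B0 (sums_ind kap i0 vp)) (sumsZ s (sums_pairing (tail2B Q N) (tail2A Q N) vp)).
have S2 := sumsZ eps (sums_pairing (tail2B Q N) (tail2A Q N) vp).
have : `|0 - (1 - kap * v k0 0 i0) - s * p| <= eps * p.
  apply: (sums_abs_le _ S1 S2) => k _.
  rewrite !mulr_sumr -!sumrB; apply: le_trans (ler_norm_sum _ _ _) _.
  apply: ler_sum => i _.
  have -> : v k 0 i * (h k i - step Q (minn^~ N) h i) - v k 0 i * (1 - kap * ind R i0 i) -
      s * (v k 0 i * two_level (tail2B Q N) (tail2A Q N) i) =
      v k 0 i * (step Q id h i - step Q (minn^~ N) h i - s * two_level (tail2B Q N) (tail2A Q N) i).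
    by rewrite -hE; ring.
  rewrite normrM ger0_norm ?vp.1// mulrCA; apply: ler_wpM2l; [exact: vp.1|exact: sd].
move=> H; rewrite -(ler_pM2l pi0) in H.
rewrite mulrCA; apply: le_trans H.
rewrite -[X in _ <= X * _](gtr0_norm pi0) -normrM.
suff -> : v k0 0 i0 - pi k0 0 i0 - pi k0 0 i0 * s * p =
  pi k0 0 i0 * (0 - (1 - kap * v k0 0 i0) - s * p) by [].
have -> : pi k0 0 i0 * (0 - (1 - kap * v k0 0 i0) - s * p) =
  kap * pi k0 0 i0 * v k0 0 i0 - pi k0 0 i0 - pi k0 0 i0 * s * p by ring.
by rewrite kpi mul1r.
Qed.

Variable piN : nat -> bvec R M0 M1.
Hypothesis piN_stat : forall N, (0 < N)%N -> stationary (mg1_matrix (LI_trunc Q N)) (piN N).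

Let vN N := piN N.+1.
Let vNst N : stationary (mg1_matrix (LI_trunc Q N.+1)) (vN N) := piN_stat (ltn0Sn N).

Lemma truncated_cvg k (i : 'I_(lvl M0 M1 k)) : (fun N => vN N k 0 i) @ \oo --> pi k 0 i.
Proof.
have [pi0 Hd] := difference_bound i.
have s0 : 0 < s := slope_gt0 drift_lt0.
have p0 : 0 <= pi k 0 i := ltW pi0.
have [N0 HN0] := Hd 1 ltr01.
pose tau N := \sum_i tail2B Q N i + \sum_j tail2A Q N j.
have tau_cvg : (fun N => pi k 0 i * (s + 1) * tau N) @ \oo --> (0 : R).
  rewrite -[X in _ --> X](mulr0 (pi k 0 i * (s + 1))); apply: cvgMl_tmp.
  have zero p (u : nat -> 'I_p -> R) : (forall j, u ^~ j @ \oo --> (0 : R)) ->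
      (fun N => \sum_j u N j) @ \oo --> (0 : R).
    by move=> /(@cvg_fsum R _ (index_enum 'I_p) (fun j N => u N j) (fun=> 0)); rewrite big1.
  rewrite -[X in _ --> X]addr0; apply: cvgD; apply: zero => j.
    exact: (two_level_cvg0 P_stoch A_mean B_mean (j : 'I_(lvl M0 M1 0))).
  exact: (two_level_cvg0 P_stoch A_mean B_mean (j : 'I_(lvl M0 M1 1))).
apply/cvgn_epsP => e e0; have /cvgn_epsP/(_ e e0)[N1 HN1] := tau_cvg.
exists (maxn N0 N1) => N; rewrite geq_max => /andP[N0N N1N].
have vp := stationary_prob (vNst N).
have b0 := tail2B_ge0 P_stoch A_mean B_mean N; have a0 := tail2A_ge0 P_stoch A_mean B_mean N.
have := HN0 N _ N0N (vNst N).
have pr0 := pairing_ge0 vp b0 a0.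
have := pairing_le_sum vp b0 a0; rewrite -/(tau N).
have := HN1 N N1N; rewrite subr0.
set p := pairing _ _ _ in pr0 *; set t := tau N => H1 H2 H3.
have {}H1 : pi k 0 i * (s + 1) * t <= e := le_trans (ler_norm _) H1.
apply: le_trans H1.
rewrite -[_ - _](subrK (pi k 0 i * s * p)); apply: le_trans (ler_normD _ _) _.
rewrite [X in _ + X]ger0_norm; last by rewrite !mulr_ge0// ltW.
apply: (@le_trans _ _ (pi k 0 i * (s + 1) * p)); first by move: H3; lra.
by rewrite ler_wpM2l// mulr_ge0// addr_ge0// ltW.
Qed.

Lemma truncated_pibar0_cvg j : (fun N => pibar0 (vN N) 0 j) @ \oo --> pibar0 pi 0 j.
Proof.
apply: scheffe => [N||k i]; [exact: stationary_prob (vNst N)|exact: stationary_prob pi_stat|].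
exact: truncated_cvg.
Qed.

End DifferenceBound.

(** * The integrated tail of the level-increment distribution *)

Section IntegratedTail.
Variables (R : realType) (M0 M1 : nat).
Variable Q : mg1 R M0 M1.
Hypothesis P_stoch : stochastic (mg1_matrix Q).
Hypothesis A_mean : forall i, finite_mean (fun m => rowsum (blkA Q m) i).
Hypothesis B_mean : forall i, finite_mean (fun m => rowsum (blkB Q m) i).
Variable pi : bvec R M0 M1.
Hypothesis pi_prob : prob pi.

Lemma SNL_compl k : 1 - SNL (mg1_matrix Q) pi k =
  pairing pi (fun i => rsum k.+1 (fun m => rowsum (blkB Q m) i))
             (fun i => rsum k.+1 (fun m => rowsum (blkA Q m) i)).
Proof.
set tB := fun i => _; set tA := fun i => _.
have inner l (i : 'I_(lvl M0 M1 l)) :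
    \sum_(0 <= m < (l + k).+1) \sum_j mg1_matrix Q l m i j = 1 - two_level tB tA i.
  have [_ /(_ l i) H] := P_stoch.
  have /sums_shift H' := (sums_split (l + k).+1 _ (leq0n (l + k).+1)).2 H.
  have T : sums 0 (fun m => rowsum (up Q l (m + k)) i) (two_level tB tA i).
    case: l i {H H'} => [|l] i.
      have /sums_shift := finite_mean_sums_pos k (B_mean i).
      by apply: eq_sums => m _; rewrite addnS.
    have /sums_shift := finite_mean_sums_pos k (A_mean i).
    by apply: eq_sums => m _; rewrite addnS.
  suff : 1 - \sum_(0 <= m < (l + k).+1) \sum_j mg1_matrix Q l m i j = two_level tB tA i by lra.
  apply: (sums_unique H'); apply: (eq_sums _ T) => m _.
  rewrite (_ : m + (l + k).+1 = (l + (m + k)).+1)%N; last by lia.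
  by rewrite mg1_matrix_up.
have := sumsB pi_prob.2 (sums_pairing tB tA pi_prob) => S.
suff -> : SNL (mg1_matrix Q) pi k = 1 - pairing pi tB tA by ring.
apply: sums_rsum; apply: (eq_sums _ S) => l _.
rewrite -sumrB; apply: eq_bigr => i _; rewrite inner; ring.
Qed.

(** The integrated tail before normalisation: the mean of [max (X - N) 0] for [X]
    distributed according to [SNL]. *)
Definition excess N : R :=
  pairing pi (fun i => rsum 0 (fun m => (m - N)%N%:R * rowsum (blkB Q m) i))
             (fun i => rsum 0 (fun m => (m - N)%N%:R * rowsum (blkA Q m) i)).

Lemma sums_SNL_compl N : sums N (fun k => 1 - SNL (mg1_matrix Q) pi k) (excess N).
Proof.
have SB := @sums_big R _ (index_enum 'I_M0) N _ _
  (fun i => sumsZ (pi 0%N 0 i) (sums_of_tails N (B_mean i))).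
have SA := @sums_big R _ (index_enum 'I_M1) N _ _
  (fun i => sumsZ (pibar0 pi 0 i) (sums_of_tails N (A_mean i))).
by apply: (eq_sums _ (sumsD SB SA)) => k _; rewrite SNL_compl.
Qed.

Arguments sums_SNL_compl N : clear implicits.

Lemma excessS N : excess N.+1 = pairing pi (tail2B Q N) (tail2A Q N).
Proof.
congr (_ + _); apply: eq_bigr => i _; congr (_ * _).
  by rewrite -rowsum_tail2//; exact: blkB_ge0_pos.
by rewrite -rowsum_tail2// => *; exact: blkA_ge0.
Qed.

Lemma excess0 : excess 0 = (pi 0%N *m mB Q) 0 0 + (pibar0 pi *m mAplus Q) 0 0.
Proof.
rewrite /excess /pairing [in RHS]mxE [in X in _ = _ + X]mxE.
congr (_ + _); apply: eq_bigr => i _; congr (_ * _).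
  by rewrite /mB (rowsum_mean B_mean); apply: eq_rsum => m _; rewrite subn0.
by rewrite /mAplus (rowsum_mean A_mean); apply: eq_rsum => m _; rewrite subn0.
Qed.

Lemma excessS_ge0 N : 0 <= excess N.+1.
Proof.
rewrite excessS; apply: pairing_ge0 => // i.
  exact: tail2B_ge0.
exact: tail2A_ge0.
Qed.

Lemma SNL_compl_ge0 k : 0 <= 1 - SNL (mg1_matrix Q) pi k.
Proof.
rewrite SNL_compl; apply: pairing_ge0 => // i.
  apply: (sums_ge0 _ (finite_mean_sums_pos k (B_mean i))) => m km.
  by apply: rowsum_ge0 => j; apply: (blkB_ge0_pos P_stoch); exact: leq_trans km.
apply: (sums_ge0 _ (finite_mean_sums_pos k (A_mean i))) => m km.
by apply: rowsum_ge0 => j; exact: blkA_ge0.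
Qed.

Lemma sum_SNL_compl N :
  \sum_(0 <= k < N) (1 - SNL (mg1_matrix Q) pi k) = excess 0 - excess N.
Proof.
have E : excess N = excess 0 - \sum_(0 <= k < N) (1 - SNL (mg1_matrix Q) pi k) :=
  sums_unique (sums_SNL_compl N) ((sums_split N _ (leq0n N)).2 (sums_SNL_compl 0)).
by rewrite E subKr.
Qed.

Lemma excess_le0 N : excess N <= excess 0.
Proof.
rewrite -subr_ge0 -sum_SNL_compl.
by apply: sumr_ge0 => k _; exact: SNL_compl_ge0.
Qed.

Lemma integrated_tail_compl N : excess 0 != 0 ->
  1 - integrated_tail (SNL (mg1_matrix Q) pi) N = excess N.+1 / excess 0.
Proof.
move=> e0; rewrite /integrated_tail (sums_rsum (sums_SNL_compl 0)) sum_SNL_compl.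
by field.
Qed.

End IntegratedTail.

(** * Asymptotics of the truncated stationary distributions *)

Theorem corollary2p2 (R : realType) (M0 M1 : nat)
  (hM0 : (0 < M0)%N) (hM1 : (0 < M1)%N)
  (Q : mg1 R M0 M1)
  (P_stochastic : stochastic (mg1_matrix Q))
  (pi : bvec R M0 M1)
  (pi_stationary : stationary (mg1_matrix Q) pi)
  (piN : nat -> bvec R M0 M1)
  (piN_stationary : forall N : nat, (0 < N)%N ->
     stationary (mg1_matrix (LI_trunc Q N)) (piN N))
  (G : 'M[R]_M1) (G_minimal : is_G Q G)
  (* condition (1) *)
  (P_irreducible : irreducible (mg1_matrix Q))
  (A_irreducible : firreducible (Asum Q))
  (A_stochastic : fstochastic (Asum Q))
  (mB_finite : mx_summable 1 (fun k => k%:R *: (blkB Q k *m ones R M1)))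
  (varpi : 'rV[R]_M1) (varpi_stationary : fstationary (Asum Q) varpi)
  (drift_lt0 : drift Q varpi < 0)
  (* condition (2) *)
  (G_aperiodic : forall C : {set 'I_M1}, closed_class G C -> class_aperiodic G C)
  (* condition (3) *)
  (r : R) (r_def : r%:E = Order.min (gf_radius (blkA Q)) (gf_radius (blkB Q)))
  (r_gt1 : 1 < r)
  (* condition (4) *)
  (f : nat -> R) (f_ge0 : forall N, 0 <= f N)
  (cA : 'cV[R]_M1) (cB : 'cV[R]_M0)
  (cA_ge0 : forall i, 0 <= cA i 0) (cB_ge0 : forall i, 0 <= cB i 0)
  (c_neq0 : cA != 0 \/ cB != 0)
  (lim_A : forall i,
     (fun N : nat => (tail (tail (blkA Q)) N *m ones R M1) i 0 / (r ^- N * f N))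
       @ \oo --> cA i 0)
  (lim_B : forall i,
     (fun N : nat => (tail (tail (blkB Q)) N *m ones R M1) i 0 / (r ^- N * f N))
       @ \oo --> cB i 0)
  (lim_f : (fun N : nat => f N / f N.-1) @ \oo --> (1 : R)) :
  let DI := integrated_tail (SNL (mg1_matrix Q) pi) in
  let DIbar := fun N : nat => 1 - DI N in
  let C : R :=
    r * ((pi 0%N *m mB Q) 0 0 + (pibar0 pi *m mAplus Q) 0 0)
      / - drift Q varpi in
  forall k : nat,
    [/\ forall i,
          (fun N : nat => (piN N k - pi k) 0 i / DIbar N) @ \oo
            --> (C *: pi k) 0 i,
        forall i, 0 < (C *: pi k) 0 i,
        (fun N : nat =>
           (DIbar N)^-1 *
           l1norm (((pi k *m ones R (lvl M0 M1 k)) 0 0)^-1 *: (piN N k - pi k)))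
          @ \oo --> C &
        0 < C].
Proof.
have A_mean : forall i, finite_mean (fun m => rowsum (blkA Q m) i).
  apply: gf_radius_mean; first by move=> k i j _; exact: (blkA_ge0 P_stochastic).
  by move: r_gt1; rewrite -lte_fin r_def lt_min => /andP[].
have B_mean : forall i, finite_mean (fun m => rowsum (blkB Q m) i).
  apply: finite_mean_rowsum mB_finite => k i j; exact: (blkB_ge0_pos P_stochastic).
move=> DI DIbar C.
have pip := stationary_prob pi_stationary.
have dbound := difference_bound P_stochastic A_mean B_mean A_stochastic A_irreducible
  varpi_stationary drift_lt0 P_irreducible G_minimal hM1 G_aperiodic pi_stationary.
have pi_gt0 k i : 0 < pi k 0 i by have [] := dbound k i.
have vcvg := truncated_cvg P_stochastic A_mean B_mean A_stochastic A_irreducible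
  varpi_stationary drift_lt0 P_irreducible G_minimal hM1 G_aperiodic pi_stationary
  piN_stationary.
have bcvg := truncated_pibar0_cvg P_stochastic A_mean B_mean A_stochastic A_irreducible
  varpi_stationary drift_lt0 P_irreducible G_minimal hM1 G_aperiodic pi_stationary
  piN_stationary.
set s := (- drift Q varpi)^-1 in dbound.
have s_gt0 : 0 < s by rewrite invr_gt0 oppr_gt0.
have r_gt0 : 0 < r by apply: lt_trans r_gt1.
pose phi N := r ^- N * f N.
have pibar_gt0 j : 0 < pibar0 pi 0 j.
  apply: (lt_le_trans (pi_gt0 1%N j)).
  by apply: (sums_term_le (u := fun l => pi l.+1 0 j) (k := 0) _ (sums_pibar0 j pip)) => // l _; exact: pip.1.
(* The limit of the mean overshoots, under [pi] and under [piN], divided by [phi]. *)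
pose cst : R := \sum_i pi 0%N 0 i * cB i 0 + \sum_j pibar0 pi 0 j * cA j 0.
have cst_gt0 : 0 < cst.
  have posA : 0 <= \sum_j pibar0 pi 0 j * cA j 0.
    by apply: sumr_ge0 => j _; rewrite mulr_ge0// ltW.
  have posB : 0 <= \sum_i pi 0%N 0 i * cB i 0.
    by apply: sumr_ge0 => j _; rewrite mulr_ge0// ltW.
  have some p (w : 'I_p -> R) (c : 'cV[R]_p) : (forall i, 0 < w i) -> (forall i, 0 <= c i 0) ->
      c != 0 -> 0 < \sum_i w i * c i 0.
    move=> w0 c0 cn; rewrite lt0r sumr_ge0 ?andbT => [|i _]; last by rewrite mulr_ge0// ltW.
    rewrite psumr_neq0 => [|i _]; last by rewrite mulr_ge0// ltW.
    apply: contraT => /hasPn nh; move: cn; rewrite (_ : c = 0) ?eqxx//.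
    apply/colP => i; rewrite mxE; apply/eqP; rewrite eq_le c0 andbT leNgt.
    by apply/negP => ci; have := nh i (mem_index_enum _); rewrite /= mulr_gt0.
  case: c_neq0 => [cA0|cB0].
    by apply: ltr_wpDl => //; exact: some.
  by apply: ltr_pwDl => //; exact: some.
have pair_cvg (w : nat -> bvec R M0 M1) :
    (forall i, (fun N => w N 0%N 0 i) @ \oo --> pi 0%N 0 i) ->
    (forall j, (fun N => pibar0 (w N) 0 j) @ \oo --> pibar0 pi 0 j) ->
    (fun N => pairing (w N) (tail2B Q N) (tail2A Q N) / phi N) @ \oo --> cst.
  move=> w0 w1.
  have -> : (fun N => pairing (w N) (tail2B Q N) (tail2A Q N) / phi N) =
    (fun N => \sum_i w N 0%N 0 i * (tail2B Q N i / phi N) +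
      \sum_j pibar0 (w N) 0 j * (tail2A Q N j / phi N)).
    apply/funext => N; rewrite /pairing mulrDl !mulr_suml.
    by congr (_ + _); apply: eq_bigr => i _; rewrite mulrA.
  apply: cvgD; apply: cvg_fsum => i; apply: cvgM => //.
    have -> : (fun N => tail2B Q N i / phi N) =
        (fun N => (tail (tail (blkB Q)) N *m ones R M1) i 0 / (r ^- N * f N)).
      by apply/funext => N; rewrite mul_ones.
    exact: lim_B.
  have -> : (fun N => tail2A Q N i / phi N) =
      (fun N => (tail (tail (blkA Q)) N *m ones R M1) i 0 / (r ^- N * f N)).
    by apply/funext => N; rewrite mul_ones.
  exact: lim_A.
have ratio : (fun N => phi N / phi N.+1) @ \oo --> r.
  have -> : (fun N => phi N / phi N.+1) = (fun N => r * (f N.+1 / f N)^-1).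
    apply/funext => N.
    have rN : (r ^+ N)^-1 * r ^+ N.+1 = r.
      by rewrite exprS mulrCA mulVf ?mulr1// expf_neq0// gt_eqF.
    by rewrite /phi !invfM !invrK mulrACA rN [f N * _]mulrC.
  rewrite -[X in _ --> X]mulr1 -invr1; apply: cvgMl_tmp; apply: cvgV; first exact: oner_neq0.
  by move: lim_f; rewrite -(cvg_shiftS (fun N => f N / f N.-1)).
(* If [f N] vanished, the quotient [f N.+1 / f N] would be [0], far from [1]. *)
have [N1 phi_gt0] : exists N1, forall N, (N1 <= N)%N -> 0 < phi N.
  have half : 0 < (2^-1 : R) by rewrite invr_gt0.
  move: lim_f; rewrite -(cvg_shiftS (fun N => f N / f N.-1)) => /cvgn_epsP/(_ _ half)[N1 H].
  exists N1 => N /H /= H1; rewrite /phi mulr_gt0 ?invr_gt0 ?exprn_gt0//.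
  rewrite lt0r f_ge0 andbT; apply/eqP => z; move: H1; rewrite z invr0 mulr0 sub0r normrN normr1.
  lra.
have Dcvg : (fun N => pairing pi (tail2B Q N) (tail2A Q N) / phi N) @ \oo --> cst.
  by apply: (pair_cvg (fun=> pi)) => j; exact: cvg_cst.
(* The mean dominates the overshoots, which are positive for large [N]. *)
have mean_gt0 : 0 < excess Q pi 0.
  have c2 : 0 < cst / 2 by rewrite divr_gt0.
  have /cvgn_epsP/(_ _ c2)[N2 HN2] := Dcvg.
  have := HN2 (maxn N1 N2) (leq_maxr _ _).
  rewrite -excessS// ler_norml => /andP[H _].
  apply: lt_le_trans (excess_le0 P_stochastic A_mean B_mean pip (maxn N1 N2).+1).
  have : 0 < excess Q pi (maxn N1 N2).+1 / phi (maxn N1 N2) by lra.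
  by rewrite pmulr_lgt0// invr_gt0 phi_gt0// leq_maxl.
have CE : C = r * excess Q pi 0 * s by rewrite /C /s excess0.
have C_gt0 : 0 < C by rewrite CE !mulr_gt0.
have DIbarE N : DIbar N = excess Q pi N.+1 / excess Q pi 0.
  by rewrite /DIbar /DI integrated_tail_compl// gt_eqF.
have DIbar_ge0 N : 0 <= DIbar N.
  by rewrite DIbarE divr_ge0 ?(ltW mean_gt0)// excessS_ge0.
have main k i : (fun N : nat => (piN N k - pi k) 0 i / DIbar N) @ \oo --> C * pi k 0 i.
  (* With truncation at [N.+1], the overshoots are double tails at [N] for [piN] but
     at [N.+1] for [DIbar]: this mismatch is the source of the factor [r]. *)
  rewrite -(cvg_shiftS (fun N : nat => (piN N k - pi k) 0 i / DIbar N)).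
  pose E N := pairing (piN N.+1) (tail2B Q N) (tail2A Q N) / phi N.
  have Ecvg : E @ \oo --> cst by apply: pair_cvg => j; [exact: vcvg | exact: bcvg].
  pose u N := (piN N.+1 k 0 i - pi k 0 i) / phi N.
  have ucvg : u @ \oo --> pi k 0 i * s * cst.
    have d0 : (fun N => u N - pi k 0 i * s * E N) @ \oo --> (0 : R).
      apply/cvgn_epsP => e e0.
      have c1 : 0 < pi k 0 i * (cst + 1) by rewrite mulr_gt0// addr_gt0.
      have [_ /(_ (e / (pi k 0 i * (cst + 1))))] := dbound k i.
      rewrite divr_gt0// => /(_ erefl)[N2 HN2].
      have /cvgn_epsP/(_ _ ltr01)[N3 HN3] := Ecvg.
      exists (maxn N1 (maxn N2 N3)) => N; rewrite !geq_max => /and3P[NN1 NN2 NN3].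
      have p0 := phi_gt0 N NN1.
      have := HN2 N _ NN2 (piN_stationary N.+1 (ltn0Sn N)).
      have := HN3 N NN3; rewrite subr0 ler_norml => /andP[_ EN] H.
      have -> : u N - pi k 0 i * s * E N = (piN N.+1 k 0 i - pi k 0 i -
          pi k 0 i * s * pairing (piN N.+1) (tail2B Q N) (tail2A Q N)) / phi N.
        by rewrite /u /E; ring.
      rewrite normrM [`|_^-1|]gtr0_norm ?invr_gt0// ler_pdivrMr//.
      apply: le_trans H _.
      have -> : pairing (piN N.+1) (tail2B Q N) (tail2A Q N) = E N * phi N.
        by rewrite /E divfK// gt_eqF.
      set K := pi k 0 i * (cst + 1) in c1 *.
      have -> : e / K * (pi k 0 i * (E N * phi N)) = e * (pi k 0 i * E N / K) * phi N.
        by ring.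
      apply: ler_wpM2r; first exact: ltW.
      rewrite -[leRHS]mulr1 ler_wpM2l ?(ltW e0)// ler_pdivrMr// mul1r ler_wpM2l ?(ltW (pi_gt0 k i))//.
      lra.
    have -> : u = (fun N => (u N - pi k 0 i * s * E N) + pi k 0 i * s * E N).
      by apply/funext => N; rewrite subrK.
    rewrite -[X in _ --> X]add0r; apply: cvgD => //; exact: cvgMl_tmp.
  have DScvg : (fun N => excess Q pi N.+2 / phi N.+1) @ \oo --> cst.
    rewrite (cvg_shiftS (fun N => excess Q pi N.+1 / phi N)).
    have -> : (fun N => excess Q pi N.+1 / phi N) =
        (fun N => pairing pi (tail2B Q N) (tail2A Q N) / phi N).
      by apply/funext => N; rewrite excessS.
    exact: Dcvg.
  have DVcvg : (fun N => (excess Q pi N.+2 / phi N.+1)^-1 * excess Q pi 0) @ \oo -->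
      cst^-1 * excess Q pi 0.
    by apply: cvgMr_tmp; apply: cvgV => //; exact: lt0r_neq0.
  have lim : (fun N => u N * (phi N / phi N.+1) *
      ((excess Q pi N.+2 / phi N.+1)^-1 * excess Q pi 0)) @ \oo -->
      pi k 0 i * s * cst * r * (cst^-1 * excess Q pi 0).
    by apply: cvgM DVcvg; exact: cvgM.
  have -> : C * pi k 0 i = pi k 0 i * s * cst * r * (cst^-1 * excess Q pi 0).
    by rewrite CE; field; exact: lt0r_neq0.
  apply/cvgn_epsP => e e0; have /cvgn_epsP/(_ e e0)[N2 HN2] := lim.
  exists (maxn N1 N2) => N; rewrite geq_max => /andP[NN1 /HN2].
  have p0 := phi_gt0 N NN1; have p1 := phi_gt0 N.+1 (leq_trans NN1 (leqnSn N)).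
  suff <- : (piN N.+1 k - pi k) 0 i / DIbar N.+1 = u N * (phi N / phi N.+1) *
      ((excess Q pi N.+2 / phi N.+1)^-1 * excess Q pi 0) by [].
  rewrite DIbarE /u mxE [X in (_ + X) / _]mxE.
  have [->|x0] := eqVneq (excess Q pi N.+2) 0; first by rewrite !mul0r !invr0 mulr0 mul0r mulr0.
  by field; rewrite x0 !gt_eqF.
move=> k; split=> //.
- by move=> i; rewrite mxE; exact: main.
- by move=> i; rewrite mxE mulr_gt0.
rewrite mul_ones; set t := rowsum _ _.
have t_gt0 : 0 < t.
  have lk : (0 < lvl M0 M1 k)%N by case: (k).
  rewrite /t /rowsum (bigD1 (Ordinal lk))//= ltr_pwDl// sumr_ge0// => j _.
  exact: ltW.
have -> : (fun N => (DIbar N)^-1 * l1norm (t^-1 *: (piN N k - pi k))) =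
    (fun N => \sum_i t^-1 * `|(piN N k - pi k) 0 i / DIbar N|).
  apply/funext => N; rewrite /l1norm mulr_sumr; apply: eq_bigr => i _.
  set x := piN N k - pi k; rewrite [(_ *: x) 0 i]mxE.
  have tV : 0 <= t^-1 by rewrite invr_ge0 ltW.
  have DV : 0 <= (DIbar N)^-1 by rewrite invr_ge0.
  by rewrite !normrM (ger0_norm tV) (ger0_norm DV); ring.
have -> : C = \sum_i t^-1 * `|C * pi k 0 i|.
  under eq_bigr do rewrite normrM (gtr0_norm C_gt0) (gtr0_norm (pi_gt0 k _)).
  by rewrite -mulr_sumr -mulr_sumr -/(rowsum (pi k) 0) -/t mulrCA mulVf ?mulr1// gt_eqF.
by apply: cvg_fsum => i; apply: cvgMl_tmp; apply: cvg_norm; exact: main.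
Qed.
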